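(* Suppose that there is $0<\alpha<1$ such that for $m$-almost every $\underline{x}\in\Sigma_A^+$ one has $d(G(\underline{x},y_1),G(\underline{x},y_2))\le \alpha\, d(y_1,y_2)$ for all $y_1,y_2\in K$. Then the operator $F^*:S^\infty\to S^\infty$ can be written as $F^*=P+N$, where $P,N:S^\infty\to S^\infty$ are linear operators such that: (a) $P$ is a projection, i.e. $P^2=P$, and $\dim \operatorname{Im}(P)=1$; (b) there are $0<\xi<1$ and $M>0$ such that for all $\mu\in S^\infty$ and all $n\ge1$, $\|N^n(\mu)\|_{S^\infty}\le M\xi^n\|\mu\|_{S^\infty}$; (c) $PN=NP=0$.
   Context: Base. Let $A$ be an aperiodic $N_0\times N_0$ matrix with entries in $\{0,1\}$ (some power of $A$ has all entries positive), $\Sigma_A^+=\{\underline{x}=(x_i)_{i\ge 0}: x_i\in\{1,\dots,N_0\},\ A_{x_ix_{i+1}}=1\ \forall i\}$, with the metric $d_\theta(\underline{x},\underline{y})=\sum_{i\ge0}\theta^i(1-\delta(x_i,y_i))$, where $\theta\in(0,1)$ is fixed and $\delta(a,b)=1$ if $a=b$, $0$ otherwise. Let $\sigma$ be the left shift on $\Sigma_A^+$ and $m$ a Markov measure associated to $(\Sigma_A^+,\sigma)$ (the $\sigma$-invariant probability given by a stochastic matrix $(p_{ij})$ with $p_{ij}>0$ iff $A_{ij}=1$ and its stationary probability vector). For $\varphi:\Sigma_A^+\to\mathbb{R}$ let $|\varphi|_\theta$ be its Lipschitz constant with respect to $d_\theta$, $\mathcal{F}_\theta(\Sigma_A^+)=\{\varphi:|\varphi|_\theta<\infty\}$,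 $\|\varphi\|_\theta=\|\varphi\|_\infty+|\varphi|_\theta$. Skew product. $(K,d)$ is a compact metric space with $\operatorname{diam}(K)=1$; $\Sigma:=\Sigma_A^+\times K$; $G:\Sigma\to K$ is measurable (Borel) and $F:\Sigma\to\Sigma$ is $F(\underline{x},y)=(\sigma(\underline{x}),G(\underline{x},y))$. Put $\gamma_{\underline{x}}=\{\underline{x}\}\times K$, $\pi_1(\underline{x},y)=\underline{x}$, $\pi_2(\underline{x},y)=y$, and let $\pi_1^*$, $\pi_2^*$ denote push-forward of measures. The transfer operator is $F^*\mu(E)=\mu(F^{-1}(E))$ for signed measures $\mu$ on $\Sigma$. Spaces of measures. For a finite signed Borel measure $\nu$ on a compact metric space $X$, $\|\nu\|_W=\sup\{|\int g\,d\nu| : g:X\to\mathbb{R}\text{ Lipschitz with constant}\le1,\ \|g\|_\infty\le1\}$. Let $\mathcal{AB}$ be the set of finite signed Borel measures $\mu$ on $\Sigma$, with Jordan decomposition $\mu=\mu^+-\mu^-$, such that $\pi_1^*\mu^+\ll m$ and $\pi_1^*\mu^-\ll m$; write $\phi_1=\frac{d(\pi_1^*\mu)}{dm}$. For positive $\mu\in\mathcal{AB}$ let $\{\mu_{\gamma_{\underline{x}}}\}$ be its Rokhlin disintegration along the leaves: probabilities on $\Sigma$ with $\mu_{\gamma_{\underline{x}}}(\gamma_{\underline{x}})=1$ for $\phi_1m$-a.e. $\underline{x}$, $\underline{x}\mapsto\mu_{\gamma_{\underline{x}}}(E)$ measurable, and $\mu(E)=\int\mu_{\gamma_{\underline{x}}}(E)\phi_1(\underline{x})\,dm(\underline{x})$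 for all measurable $E\subset\Sigma$. The restriction of positive $\mu$ to $\gamma_{\underline{x}}$ is the positive measure on $K$ given by $\mu|_{\gamma_{\underline{x}}}(B)=\phi_1(\underline{x})\,\mu_{\gamma_{\underline{x}}}(\pi_2^{-1}(B))$ (zero where $\phi_1(\underline{x})=0$); for signed $\mu\in\mathcal{AB}$, $\mu|_{\gamma_{\underline{x}}}:=\mu^+|_{\gamma_{\underline{x}}}-\mu^-|_{\gamma_{\underline{x}}}$. Set $\|\mu\|_\infty=\operatorname{ess\,sup}_{\underline{x}}\|\mu|_{\gamma_{\underline{x}}}\|_W$ (with respect to $m$), $\mathcal{L}^\infty=\{\mu\in\mathcal{AB}:\|\mu\|_\infty<\infty\}$, $S^\infty=\{\mu\in\mathcal{L}^\infty:\phi_1\in\mathcal{F}_\theta(\Sigma_A^+)\}$ and $\|\mu\|_{S^\infty}=\|\phi_1\|_\theta+\|\mu\|_\infty$. These are normed vector spaces. *)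

(* Defs.v *)
From HB Require Import structures.
From mathcomp Require Import all_boot all_order all_algebra.
From mathcomp Require Import all_classical all_reals all_analysis.
From mathcomp Require Import measurable_realfun ess_sup_inf.
Set Implicit Arguments.
Unset Strict Implicit.
Unset Printing Implicit Defensive.
Import Order.TTheory GRing.Theory Num.Theory.
Import numFieldNormedType.Exports.
Local Open Scope classical_set_scope.
Local Open Scope ring_scope.

(** A [charge] is a function on all sets, so that two charges that agree on
   the sigma-algebra need not be equal.  A [smeasure] is the representative
   that vanishes outside the sigma-algebra; on [smeasure], Leibniz equality is
   equality of signed measures ([smeasure_eq]). *)

Record smeasure d (T : measurableType d) (R : realType) := SMeasure {
  smeasure_charge :> {charge set T -> \bar R};
  smeasure_out : forall E, ~ measurable E -> smeasure_charge E = 0%E }.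
Arguments SMeasure {d T R}.

Section smeasure_theory.
Context d (T : measurableType d) (R : realType).
Implicit Types (mu nu : smeasure T R) (ch : {charge set T -> \bar R}).

Lemma charge_eq ch1 ch2 : (ch1 : set T -> \bar R) = ch2 -> ch1 = ch2.
Proof.
case: ch1 => f [[h1] [h2] [h3]]; case: ch2 => g [[h1'] [h2'] [h3']] /= fg.
subst g; rewrite (Prop_irrelevance h1 h1') (Prop_irrelevance h2 h2').
by rewrite (Prop_irrelevance h3 h3').
Qed.

Lemma smeasure_eq mu nu :
  (forall E, measurable E -> mu E = nu E) -> mu = nu.
Proof.
case: mu => c hc; case: nu => c' hc' /= h.
have e : c = c'.
  apply: charge_eq; apply/funext => E.
  by have [mE|mE] := pselect (measurable E); [exact: h|rewrite hc// hc'].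
by subst c'; rewrite (Prop_irrelevance hc hc').
Qed.

Fact smeasure_of_subproof ch E :
  ~ measurable E -> crestr0 ch measurableT E = 0%E.
Proof. by move=> mE; rewrite /crestr0 memNset. Qed.

Definition smeasure_of ch : smeasure T R :=
  SMeasure (crestr0 ch measurableT : {charge set T -> \bar R})
           (@smeasure_of_subproof ch).

Lemma smeasure_ofE ch E : measurable E -> smeasure_of ch E = ch E.
Proof. by move=> mE; rewrite /= /crestr0 mem_set// /crestr setIT. Qed.

HB.instance Definition _ := gen_eqMixin (smeasure T R).
HB.instance Definition _ := gen_choiceMixin (smeasure T R).

Definition smeasure_zero := smeasure_of (@czero _ T R).
Definition smeasure_opp mu := smeasure_of (copp mu).
Definition smeasure_add mu nu := smeasure_of (cadd mu nu).
Definition smeasure_scale (a : R) mu := smeasure_of (cscale a mu).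

Lemma smeasure_fin mu E : measurable E -> mu E = (fine (mu E))%:E.
Proof. by move=> mE; rewrite fineK// fin_num_measure. Qed.

Let addE mu nu E : measurable E -> smeasure_add mu nu E = (mu E + nu E)%E.
Proof. exact: smeasure_ofE. Qed.

Let oppE mu E : measurable E -> smeasure_opp mu E = (- mu E)%E.
Proof. exact: smeasure_ofE. Qed.

Let scaleE a mu E : measurable E -> smeasure_scale a mu E = (a%:E * mu E)%E.
Proof. exact: smeasure_ofE. Qed.

Let zeroE E : measurable E -> smeasure_zero E = 0%E.
Proof. exact: smeasure_ofE. Qed.

Fact smeasure_addA : associative smeasure_add.
Proof. by move=> a b c; apply: smeasure_eq => E mE; rewrite !addE// addeA. Qed.

Fact smeasure_addC : commutative smeasure_add.
Proof. by move=> a b; apply: smeasure_eq => E mE; rewrite !addE// addeC. Qed.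

Fact smeasure_add0 : left_id smeasure_zero smeasure_add.
Proof. by move=> a; apply: smeasure_eq => E mE; rewrite addE// zeroE// add0e. Qed.

Fact smeasure_addN : left_inverse smeasure_zero smeasure_opp smeasure_add.
Proof.
move=> a; apply: smeasure_eq => E mE.
by rewrite addE// oppE// zeroE// (smeasure_fin a mE) -EFinN -EFinD addNr.
Qed.

HB.instance Definition _ := GRing.isZmodule.Build (smeasure T R)
  smeasure_addA smeasure_addC smeasure_add0 smeasure_addN.

Fact smeasure_scaleA a b mu :
  smeasure_scale a (smeasure_scale b mu) = smeasure_scale (a * b) mu.
Proof. by apply: smeasure_eq => E mE; rewrite !scaleE// muleA. Qed.

Fact smeasure_scale1 : left_id 1 smeasure_scale.
Proof. by move=> a; apply: smeasure_eq => E mE; rewrite scaleE// mul1e. Qed.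

Fact smeasure_scaleDr : right_distributive smeasure_scale +%R.
Proof.
move=> a mu nu; apply: smeasure_eq => E mE.
rewrite scaleE// !addE// !scaleE// (smeasure_fin mu mE) (smeasure_fin nu mE).
by rewrite -EFinD -!EFinM -EFinD mulrDr.
Qed.

Fact smeasure_scaleDl mu : {morph smeasure_scale^~ mu : a b / a + b}.
Proof.
move=> a b; apply: smeasure_eq => E mE.
rewrite scaleE// !addE// !scaleE// (smeasure_fin mu mE).
by rewrite -!EFinM -!EFinD mulrDl.
Qed.

HB.instance Definition _ := GRing.Zmodule_isLmodule.Build R (smeasure T R)
  smeasure_scaleA smeasure_scale1 smeasure_scaleDr smeasure_scaleDl.

Lemma smeasureDE mu nu E : measurable E -> (mu + nu) E = (mu E + nu E)%E.
Proof. exact: addE. Qed.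

Lemma smeasureZE a mu E : measurable E -> (a *: mu) E = (a%:E * mu E)%E.
Proof. exact: scaleE. Qed.

End smeasure_theory.

Section pushforward.
Context d d' (T : measurableType d) (T' : measurableType d') (R : realType).
Variables (f : T -> T') (mf : measurable_fun setT f).

Definition mpush (mu : {measure set T -> \bar R}) :
  {measure set T' -> \bar R} := 
    measure_function_pushforward__canonical__measure_function_Measure mu mf.

Definition spush (mu : smeasure T R) : smeasure T' R :=
  smeasure_of 
    (measure_function_pushforward__canonical__charge_Charge mu mf).

End pushforward.

Record aperiodic_mx (N0 : nat) := AperiodicMx {
  tmx :> 'M[nat]_N0;
  tmx_gt0 : (0 < N0)%N;
  tmx01 : forall i j, tmx i j = 0%N \/ tmx i j = 1%N;
  tmx_aperiodic : exists n, forall i j, (0 < (tmx ^+ n.+1) i j)%N }.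

Record sft (N0 : nat) (A : aperiodic_mx N0) := Sft {
  sft_seq :> nat -> 'I_N0;
  sft_admissible : forall i, A (sft_seq i) (sft_seq i.+1) = 1%N }.

Section sft_theory.
Variables (N0 : nat) (A : aperiodic_mx N0).
Implicit Types x y : sft A.

Lemma sft_eq x y : sft_seq x =1 sft_seq y -> x = y.
Proof.
case: x => u hu; case: y => v hv /= /funext uv; subst v.
by rewrite (Prop_irrelevance hu hv).
Qed.

Lemma tmx_next i : exists j, A i j = 1%N.
Proof.
have [n An] := tmx_aperiodic A.
apply: contrapT => /forallNP A0; move: (An i i).
rewrite exprS mxE big1// => j _.
by have [->|/A0//] := tmx01 A i j; rewrite mul0r.
Qed.

Fact sft_point_subproof i :
  let s n := iter n (fun i => sval (cid (tmx_next i))) (Ordinal (tmx_gt0 A)) in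
  A (s i) (s i.+1) = 1%N.
Proof. by move=> s; rewrite /s iterS; case: cid. Qed.

HB.instance Definition _ := gen_eqMixin (sft A).
HB.instance Definition _ := gen_choiceMixin (sft A).
HB.instance Definition _ := isPointed.Build (sft A) (Sft sft_point_subproof).

Definition sft_shift x : sft A :=
  @Sft _ A (fun i => x i.+1) (fun i => sft_admissible x i.+1).

Definition dtheta (R : realType) (theta : R) x y : R :=
  limn (series (fun i => theta ^+ i * (1 - (x i == y i)%:R))).

End sft_theory.

Definition dist_open (R : realType) (T : Type) (dist : T -> T -> R) :
    set (set T) :=
  [set U | forall x, U x -> exists2 e, 0 < e & [set y | dist x y < e] `<=` U].

Definition Sigma (N0 : nat) (A : aperiodic_mx N0) (R : realType) (theta : R) :=
  g_sigma_algebraType (dist_open (@dtheta N0 A R theta)).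

Section shift_measurable.
Variables (N0 : nat) (A : aperiodic_mx N0) (R : realType) (theta : R).
Hypothesis theta01 : 0 < theta < 1.
Implicit Types x y : sft A.

Let term x y i : R := theta ^+ i * (1 - (x i == y i)%:R).

Let indic01 (b : bool) : (0 : R) <= 1 - b%:R <= (1 : R).
Proof. by case: b; rewrite ?subrr ?subr0 lexx ler01. Qed.

Lemma is_cvg_dtheta x y : cvgn (series (term x y)).
Proof.
have /andP[t0 t1] := theta01.
apply: (@series_le_cvg _ _ (geometric 1 theta)).
- move=> n; rewrite /term mulr_ge0 ?exprn_ge0 ?(ltW t0)//.
  by case/andP: (indic01 (x n == y n)).
- by move=> n; rewrite /geometric /= mul1r exprn_ge0 ?(ltW t0).
- by move=> n; rewrite /geometric /= mul1r /term ler_piMr ?exprn_ge0 ?(ltW t0)//.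
- by apply: is_cvg_geometric_series; rewrite ger0_norm// ltW.
Qed.

Lemma dtheta_shift x y :
  dtheta theta x y =
  1 - (x 0%N == y 0%N)%:R + theta * dtheta theta (sft_shift x) (sft_shift y).
Proof.
apply: (@cvg_lim _ (@Rhausdorff R)).
rewrite -(cvg_shiftn 1)/=.
have -> : (fun n => series (term x y) (n + 1)%N) =
  (fun n => 1 - (x 0%N == y 0%N)%:R +
     theta * series (term (sft_shift x) (sft_shift y)) n).
  apply/funext => n; rewrite addn1 /series/= big_nat_recl// /term expr0 mul1r.
  congr (_ + _); rewrite mulr_sumr; apply: eq_bigr => i _.
  by rewrite exprS mulrA.
apply: cvgD; first exact: cvg_cst.
by apply: cvgMl_tmp; exact: is_cvg_dtheta.
Qed.

Lemma measurable_shift :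
  measurable_fun setT (@sft_shift N0 A : Sigma A theta -> Sigma A theta).
Proof.
have /andP[t0 t1] := theta01.
apply: (@measurability _ _ (Sigma A theta) (Sigma A theta) setT _
  (dist_open (@dtheta N0 A R theta))) => //.
move=> _ [U oU <-]; rewrite setTI; apply: sub_sigma_algebra => x /= Ux.
have [e e0 eU] := oU _ Ux.
exists (theta * e); first exact: mulr_gt0.
move=> y /= xy; apply: eU => /=; rewrite -(ltr_pM2l t0).
apply: le_lt_trans xy; rewrite (dtheta_shift x) lerDr.
by case/andP: (indic01 (x 0%N == y 0%N)).
Qed.

End shift_measurable.

(** A metric space with a point; the point serves only to obtain a
   [measurableType], and no definition below refers to it. *)
#[short(type="pmetricType")]
HB.structure Definition PMetric (R : numDomainType) :=
  { K of Pointed K & Metric R K }.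

Definition borel (R : numDomainType) (K : pmetricType R) :=
  g_sigma_algebraType (@open K).

Definition diam (R : realType) (K : metricType R) : \bar R :=
  ereal_sup [set (mdist z.1 z.2)%:E | z in [set: K * K]].

Section jordan.
Context d (T : measurableType d) (R : realType).
Implicit Type mu : {charge set T -> \bar R}.

Fact hahn_subproof mu : exists PN, hahn_decomposition mu PN.1 PN.2.
Proof. by have [P [N PN]] := Hahn_decomposition mu; exists (P, N). Qed.

(* The Hahn decomposition is unique up to null sets, hence the measures
   [pos_part mu] and [neg_part mu] do not depend on this choice. *)
Definition hahn mu := svalP (cid (hahn_subproof mu)).

Definition pos_part mu : {finite_measure set T -> \bar R} :=
  jordan_pos (hahn mu).
Definition neg_part mu : {finite_measure set T -> \bar R} :=
  jordan_neg (hahn mu).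

Definition charge_integral mu (g : T -> R) : R :=
  \int[pos_part mu]_(y in setT) g y - \int[neg_part mu]_(y in setT) g y.

End jordan.

Definition normW (R : realType) (K : pmetricType R)
    (nu : {charge set (borel K) -> \bar R}) : \bar R :=
  ereal_sup [set `|charge_integral nu g|%:E | g in
    [set g : K -> R | (forall y z, `|g y - g z| <= mdist y z) /\
                      (forall y, `|g y| <= 1)]].

Section lipschitz_theta.
Variables (N0 : nat) (A : aperiodic_mx N0) (R : realType) (theta : R).
Implicit Type phi : sft A -> R.

Definition lip_theta phi : \bar R :=
  ereal_inf [set C%:E | C in
    [set C : R | 0 <= C /\
       forall x y, `|phi x - phi y| <= C * dtheta theta x y]].

Definition norm_sup phi : \bar R :=
  ereal_sup [set `|phi x|%:E | x in [set: sft A]].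

Definition norm_theta phi : \bar R := (norm_sup phi + lip_theta phi)%E.

(** The values on cylinders determine [m]; its shift-invariance follows from
   [markov_stat]. *)
Record markov_measure (p : 'M[R]_N0) (q : 'rV[R]_N0)
    (m : probability (Sigma A theta) R) : Prop := {
  markov_ge0 : forall i j, 0 <= p i j;
  markov_row : forall i, \sum_j p i j = 1;
  markov_supp : forall i j, 0 < p i j <-> A i j = 1%N;
  markov_stat_ge0 : forall i, 0 <= q 0 i;
  markov_stat_sum : \sum_i q 0 i = 1;
  markov_stat : q *m p = q;
  markov_cylinder : forall (n : nat) (w : nat -> 'I_N0),
    m [set x : Sigma A theta | forall i, (i <= n)%N -> sft_seq x i = w i] =
    (q 0 (w 0%N) * \prod_(i < n) p (w i) (w i.+1))%:E }.

End lipschitz_theta.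

Section skew_product.
Variables (N0 : nat) (A : aperiodic_mx N0) (R : realType) (theta : R).
Variable (K : pmetricType R).
Local Open Scope charge_scope.
Local Notation X := (Sigma A theta).
(* On products of separable metric spaces the product sigma-algebra is the
   Borel one. *)
Local Notation XK := (Sigma A theta * borel K)%type.

Definition skew (G : XK -> borel K) (z : XK) : XK := (sft_shift z.1, G z).

Lemma measurable_skew (theta01 : 0 < theta < 1) (G : XK -> borel K) :
  measurable_fun setT G -> measurable_fun setT (skew G).
Proof.
move=> mG; apply: measurable_fun_pair => //.
by apply: (measurableT_comp (measurable_shift theta01)).
Qed.

Definition transfer (theta01 : 0 < theta < 1) (G : XK -> borel K)
    (mG : measurable_fun setT G) (mu : smeasure XK R) : smeasure XK R :=
  spush (measurable_skew theta01 mG) mu.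

Variable m : probability X R.
Implicit Types (mu : smeasure XK R) (pmu : {finite_measure set XK -> \bar R}).
Implicit Type k : X -> probability XK R.

Definition AB mu : Prop :=
  mpush measurable_fst (pos_part mu) `<< m /\
  mpush measurable_fst (neg_part mu) `<< m.

Definition phi1 mu : X -> \bar R :=
  'd (spush measurable_fst mu : {charge set X -> \bar R}) '/d m.

Definition smeasure_of_measure d (T : measurableType d)
    (nu : {finite_measure set T -> \bar R}) : smeasure T R :=
  smeasure_of (charge_of_finite_measure nu).

(** The leaf over [x] is [[set x] `*` setT], and the first marginal of [pmu] is
   the measure of density [phi1] with respect to [m]. *)
Definition disintegration pmu k : Prop :=
  [/\ {ae mpush measurable_fst pmu, forall x, k x ([set x] `*` setT) = 1%E},
      forall E, measurable E -> measurable_fun setT (k ^~ E) &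
      forall E, measurable E ->
        pmu E = (\int[m]_x (k x E * phi1 (smeasure_of_measure pmu) x))%E].

Definition leaf_pos pmu k (x : X) : smeasure (borel K) R :=
  fine (phi1 (smeasure_of_measure pmu) x) *:
  spush measurable_snd (smeasure_of_measure (k x)).

Definition leaf mu kp kn (x : X) : smeasure (borel K) R :=
  leaf_pos (pos_part mu) kp x - leaf_pos (neg_part mu) kn x.

(** The disintegrations [kp], [kn] of the Jordan parts exist and are unique up
   to null sets, so the infimum is over a single value. *)
Definition norm_Linf mu : \bar R :=
  ereal_inf [set ess_sup m (fun x => normW (leaf mu k.1 k.2 x)) | k in
    [set k : (X -> probability XK R) * (X -> probability XK R) |
      disintegration (pos_part mu) k.1 /\ disintegration (neg_part mu) k.2]].

Definition Linf mu : Prop := AB mu /\ (norm_Linf mu < +oo)%E.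

(** The density [phi1 mu] is defined [m]-almost everywhere; its versions are
   the real functions equal to it [m]-almost everywhere.  As [m] charges every
   cylinder, at most one version is Lipschitz, and the infimum in
   [norm_phi1] is over at most one finite value. *)
Definition phi1_version mu (phi : sft A -> R) : Prop :=
  {ae m, forall x : X, phi1 mu x = (phi x)%:E}.

Definition norm_phi1 mu : \bar R :=
  ereal_inf [set norm_theta theta phi | phi in phi1_version mu].

Definition Sinf mu : Prop :=
  Linf mu /\
  exists phi, phi1_version mu phi /\ (lip_theta theta phi < +oo)%E.

Definition norm_Sinf mu : \bar R := (norm_phi1 mu + norm_Linf mu)%E.

End skew_product.

Definition linear_on (R : fieldType) (V : lmodType R) (S : set V) (L : V -> V) :=
  (forall u, S u -> S (L u)) /\
  (forall (a : R) u v, S u -> S v -> L (a *: u + v) = a *: L u + L v).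

Definition dim1 (R : fieldType) (V : lmodType R) (W : set V) :=
  exists2 v, v != 0 & W = [set a *: v | a in [set: R]].

(* Main.v *)
From HB Require Import structures.
From mathcomp Require Import all_boot all_order all_algebra.
From mathcomp Require Import all_classical all_reals all_analysis.
From mathcomp Require Import measurable_realfun ess_sup_inf.
From mathcomp Require Import ring lra.
Require Import Defs.
Set Implicit Arguments.
Unset Strict Implicit.
Unset Printing Implicit Defensive.
Import Order.TTheory GRing.Theory Num.Theory.
Import numFieldNormedType.Exports.
Local Open Scope classical_set_scope.
Local Open Scope ring_scope.

(** Write [X] for the subshift, [F] for the transfer operator of the skew product
   and [L phi x = sum_i b_i(x) phi(i.x)] for that of the shift with respect to
   [m], where [b_i(x) = q_i p_{i x_0} / q_{x_0}].  There is an [F]-invariant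
   probability [mu0] of constant density in [Sinf].  As [F] preserves the total
   mass, [P mu = mu(Sigma) mu0] is a projection onto a line, it commutes with [F]
   and [N = F - P] satisfies [N^n mu = F^n (mu - mu(Sigma) mu0)] for positive [n].
   The claim is therefore that [F^n] decays exponentially on the measures of
   total mass zero.

   The norms are defined through the disintegrations of the two Jordan parts,
   which do not depend linearly on the measure and are not carried by [F] to the
   Jordan parts of the image.  The proof works instead with one signed kernel
   [kap] on the leaves such that [mu = int kap x dm] ([fibred]).  It is almost
   everywhere unique ([fibred_uniq]), as can be tested on a countable algebra of
   Borel sets of [K]; it is the difference of the Rokhlin disintegrations of the
   Jordan parts, so that both norms can be read from it ([regular_norm],
   [Sinf_regular]); and [F] sends it to [sum_i b_i(x) F (kap (i.x))]
   ([fibred_transfer]).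

   Two estimates give the decay.  The weak norm of a leaf contracts by [alpha], up
   to the mass of the leaf ([normW_contraction], [regular_transfer]), which is the
   density.  The density evolves by [L], and the oscillation of [L^n phi] decays
   exponentially: [L] contracts Lipschitz constants inside the cylinders of length
   one, while aperiodicity mixes the cylinders (Doeblin), see [spectral_gap].  When
   the total mass is zero the oscillation controls the whole Lipschitz norm
   ([osc_norm_mass0], [osc_norm_lipschitz]).  The leaf bounds then satisfy
   [a_{n+1} <= alpha a_n + O(rho^n)], hence decay exponentially ([decay]).

   For [mu0], the inverse of the natural extension of the shift is realised as a
   baker map [S (x, u) = (i.x, u')] of [X] times the unit interval, where [u] falls
   in the [i]-th piece of a partition into intervals of lengths [b_i(x)] and [u']
   is its rescaled position; [S] preserves [m] times the uniform law
   ([baker_preserving]).  The contraction yields a measurable solution of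
   [Y z = G ((S z).1, Y (S z))] ([contraction_section]), and [mu0] is the law of
   [(x, Y (x, u))] ([invariant_measure]). *)

(** * Countable generating algebras *)

Section algebra_approximation.
Context d (T : measurableType d) (R : realType).
Variable G : set (set T).
Hypothesis GT : G setT.
Hypothesis GC : forall A, G A -> G (~` A).
Hypothesis GU : forall A B, G A -> G B -> G (A `|` B).
Hypothesis mG : @measurable d T = <<s G >>.

Let approx (lam : {finite_measure set T -> \bar R}) (E : set T) :=
  measurable E /\ forall e : R, 0 < e ->
    exists2 A, G A & (lam (E `\` A) + lam (A `\` E) < e%:E)%E.

Let measurableG A : G A -> measurable A.
Proof. by move=> GA; rewrite mG; exact: sub_sigma_algebra. Qed.

Let approxU lam E F : approx lam E -> approx lam F -> approx lam (E `|` F).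
Proof.
move=> [mE hE] [mF hF]; split; first exact: measurableU.
move=> e e0; have e20 : 0 < e / 2 by rewrite divr_gt0.
have [A GA EA] := hE _ e20; have [B GB FB] := hF _ e20.
have mA := measurableG GA; have mB := measurableG GB.
exists (A `|` B); first exact: GU.
rewrite [e in ltRHS]splitr EFinD.
apply: le_lt_trans (lteD EA FB); rewrite addeACA; apply: leeD.
- apply: (le_trans _ (measureU2 lam (measurableD mE mA) (measurableD mF mB))).
  apply: le_measure; rewrite ?inE//.
  + by apply: measurableD; exact: measurableU.
  + by apply: measurableU; exact: measurableD.
  + move=> x [[Ex|Fx] /not_orP[Ax Bx]]; by [left|right].
- apply: (le_trans _ (measureU2 lam (measurableD mA mE) (measurableD mB mF))).
  apply: le_measure; rewrite ?inE//.
  + by apply: measurableD; exact: measurableU.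
  + by apply: measurableU; exact: measurableD.
  + move=> x [[Ex|Fx] /not_orP[Ax Bx]]; by [left|right].
Qed.

(** The approximable sets form a sigma-algebra; countable unions are reduced to
   finite ones by continuity from above. *)
Lemma algebra_approx (lam : {finite_measure set T -> \bar R}) E (e : R) :
  measurable E -> 0 < e ->
  exists2 A, G A & (lam (E `\` A) + lam (A `\` E) < e%:E)%E.
Proof.
move=> mE e0; suff : approx lam E by move=> [_]; exact.
move: mE; rewrite mG; apply: smallest_sub => [|A GA]; last first.
  split; first exact: measurableG.
  by move=> r r0; exists A => //; rewrite !setDv !measure0 adde0 lte_fin.
have G0 : G set0 by rewrite -setCT; exact: GC.
split.
- by split=> // r r0; exists set0 => //; rewrite !setDv !measure0 adde0 lte_fin.
- move=> B [mB hB]; split; first by rewrite setTD; exact: measurableC.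
  move=> r /hB[A GA BA]; exists (~` A); first exact: GC.
  by rewrite setTD !setDE !setCK addeC (setIC (~` A)) (setIC (~` B)) -!setDE.
- move=> F hF; have mF n : measurable (F n) by have [] := hF n.
  split; first exact: bigcup_measurable.
  move=> r r0; have r20 : 0 < r / 2 by rewrite divr_gt0.
  pose S n := \big[setU/set0]_(i < n) F i.
  have aS n : approx lam (S n).
    elim: n => [|n ih]; last first.
      by rewrite /S big_ord_recr/=; apply: approxU.
    rewrite /S big_ord0; split=> // s s0.
    by exists set0 => //; rewrite !setDv !measure0 adde0 lte_fin.
  have mS n : measurable (S n) by have [] := aS n.
  have SF n : S n `<=` \bigcup_i F i.
    by rewrite /S -bigcup_mkord => x [i _ Fx]; exists i.
  have [n Sn] : exists n, (lam (\bigcup_i F i `\` S n) < (r / 2)%:E)%E.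
    have : lam (\bigcap_n (\bigcup_i F i `\` S n)) = 0%E.
      rewrite (_ : \bigcap_n _ = set0) ?measure0// -subset0 => x hx.
      have [[i _ Fx] _] := hx 0%N Logic.I.
      have [_ /=] := hx i.+1 Logic.I; apply.
      by rewrite /S big_ord_recr/=; right.
    move=> L.
    have mD n : measurable (\bigcup_i F i `\` S n).
      by apply: measurableD => //; exact: bigcup_measurable.
    have : (lam \o (fun n => \bigcup_i F i `\` S n)) @ \oo --> 0%E.
      rewrite -L; apply: nonincreasing_cvg_mu => //.
      - by rewrite ltey_eq fin_num_measure.
      - exact: bigcap_measurable.
      - move=> p q pq; apply/subsetPset => x [Fx Sx]; split=> // Spx; apply: Sx.
        by move: Spx; rewrite /S -!bigcup_mkord => -[i /= ip Fix];
          exists i => //=; exact: leq_trans pq.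
    move=> /fine_cvgP[_ /cvgrPdist_lt /(_ _ r20)[n _ /(_ n (leqnn n))]].
    rewrite /= sub0r normrN ger0_norm ?fine_ge0// => h; exists n.
    by rewrite -(@fineK _ (lam _)) ?fin_num_measure// lte_fin.
  have [A GA SA] := (aS n).2 _ r20.
  have mA := measurableG GA.
  exists A => //.
  have mF' : measurable (\bigcup_i F i) by exact: bigcup_measurable.
  rewrite [r in ltRHS]splitr EFinD; apply: le_lt_trans (lteD Sn SA).
  rewrite addeA; apply: leeD.
  + apply: le_trans (measureU2 lam (measurableD mF' (mS n)) (measurableD (mS n) mA)).
    apply: le_measure; rewrite ?inE//; first exact: measurableD.
      by apply: measurableU; exact: measurableD.
    by move=> x [Fx Ax]; have [Sx|Sx] := pselect (S n x); [right|left].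
  + apply: le_measure; rewrite ?inE//; [exact: measurableD..|].
    by move=> x [Ax Fx]; split=> // /SF.
Qed.

(** A set of negative charge would be approximated, in total variation, by a
   member of the algebra, whose charge would be negative as well. *)
Lemma charge_ge0_algebra (nu : {charge set T -> \bar R}) E :
  (forall A, G A -> (0 <= nu A)%E) -> measurable E -> (0 <= nu E)%E.
Proof.
move=> nuG mE; have [P [N PN]] := Hahn_decomposition nu.
pose lam : {measure set T -> \bar R} := charge_variation PN.
have lamfin A : measurable A -> lam A \is a fin_num.
  by move=> mA; exact: (fin_num_measure (charge_variation PN : {charge set T -> \bar R})).
have absnu A : measurable A -> (`|nu A| <= lam A)%E.
  exact: abse_charge_variation.
rewrite leNgt; apply/negP => nuE0.
pose flam : {finite_measure set T -> \bar R} :=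
  HB.pack (lam : set T -> \bar R) (Measure.class lam)
   (Measure_isFinite.Build _ _ _ _ lamfin).
have e0 : 0 < - fine (nu E).
  by rewrite oppr_gt0 -lte_fin fineK ?fin_num_measure.
have [A GA EA'] := algebra_approx flam mE e0; have mA := measurableG GA.
have EA : (lam (E `\` A) + lam (A `\` E) < (- fine (nu E))%:E)%E by [].
have mEA : measurable (E `\` A) by exact: measurableD.
have mAE : measurable (A `\` E) by exact: measurableD.
have := nuG _ GA; apply/negP; rewrite -ltNge.
rewrite (chargeDI _ mA mE) setIC.
have : nu E = (nu (E `\` A) + nu (E `&` A))%E by exact: chargeDI.
move: EA (absnu _ mEA) (absnu _ mAE).
have mI : measurable (E `&` A) by exact: measurableI.
have f1 := fin_num_measure nu _ mE.
have f2 := fin_num_measure nu _ mEA.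
have f3 := fin_num_measure nu _ mAE.
have f4 := fin_num_measure nu _ mI.
rewrite -(fineK f1) /= -(fineK f2) -(fineK f3) -(fineK f4).
rewrite -(fineK (lamfin _ mEA)) -(fineK (lamfin _ mAE)).
rewrite !abse_EFin -!EFinD !lee_fin !lte_fin => h1 h2 h3 [h4].
move: h2 h3; rewrite !ler_norml => /andP[h2 h2'] /andP[h3 h3'].
lra.
Qed.

End algebra_approximation.

(** A compact metric space has a countable basis, and the finite Boolean
   combinations of its members form a countable generating algebra; they are
   indexed here by the truth tables of the first [n] members. *)
Lemma compact_borel_algebra (R : realType) (K : pmetricType R) :
  compact [set: K] ->
  exists G : nat -> set (borel K),
    [/\ range G setT, forall A, range G A -> range G (~` A),
        forall A B, range G A -> range G B -> range G (A `|` B) &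
        (measurable : set (set (borel K))) = <<s range G >>].
Proof.
move=> /compact_second_countable[B cB [Bo Bb]].
have [g gB] : exists g : nat -> set K, B `<=` range g.
  by have /pcard_surjP[g gB] := cB; exists g.
pose b i : set K := if `[< B (g i) >] then g i else set0.
have bo i : open (b i).
  by rewrite /b; case: asboolP => [/Bo//|_]; exact: open0.
have Bb' U : B U -> exists i, U = b i.
  by move=> BU; have [i _ gi] := gB _ BU; exists i; rewrite /b gi asboolT.
pose code n (y : K) := mkseq (fun i => `[< b i y >]) n.
pose H (k : nat * seq (seq bool)) : set (borel K) := [set y | code k.1 y \in k.2].
pose G n := if unpickle n is Some k then H k else H (0%N, [:: [::]]).
have GH A : range G A <-> exists k, A = H k.
  split => [[n _ <-]|[k ->]].
    by rewrite /G; case: unpickle => [k|]; [exists k|exists (0%N, [:: [::]])].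
  by exists (pickle k) => //; rewrite /G pickleK.
pose all_codes n := [seq val t | t <- enum {: n.-tuple bool}].
have codeH n (p : pred (seq bool)) :
    [set y : borel K | p (code n y)] = H (n, [seq s <- all_codes n | p s]).
  apply/seteqP; split=> y; rewrite /H/= mem_filter; last by move=> /andP[].
  move=> ->/=.
  have sz : size (code n y) == n by rewrite size_mkseq.
  by apply/mapP; exists (Tuple sz) => //; rewrite mem_enum.
have GP n (p : pred (seq bool)) A :
    (forall y, A y <-> p (code n y)) -> range G A.
  move=> Ap; apply/GH; exists (n, [seq s <- all_codes n | p s]).
  by rewrite -codeH; apply/seteqP; split=> y /=; rewrite Ap.
have codeS k n y : (k <= n)%N -> take k (code n y) = code k y.
  by move=> kn; rewrite /code -map_take take_iota (minn_idPl kn).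
exists G; split.
- by rewrite GH; exists (0%N, [:: [::]]); rewrite /H; apply/seteqP; split=> y.
- move=> A /GH[[n S] ->]; apply: (GP n (fun s => s \notin S)) => y.
  by split=> /= /negP.
- move=> A A' /GH[[n S] ->] /GH[[n' S'] ->].
  apply: (GP (maxn n n') (fun s => (take n s \in S) || (take n' s \in S'))) => y.
  by rewrite codeS ?leq_maxl// codeS ?leq_maxr//; split=> /orP.
- have mb i : measurable (b i : set (borel K)) by exact: sub_sigma_algebra.
  have mcode n s : measurable [set y : borel K | code n y = s].
    elim: n s => [|n ih] s.
      by rewrite /code/mkseq/=; have [<-|] := eqVneq [::] s;
        [rewrite (_ : [set _ | _] = setT)//; apply/seteqP; split|
         move=> /eqP ns; rewrite (_ : [set _ | _] = set0)// -subset0 => y].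
    case/lastP: s => [|s c].
      rewrite (_ : [set _ | _] = set0)// -subset0 => y /=.
      by move=> /(congr1 size); rewrite size_mkseq.
    rewrite (_ : [set _ | _] = [set y : borel K | code n y = s] `&`
      (if c then b n else ~` b n)).
      by apply: measurableI => //; case: c => //; exact: measurableC.
    have codeSn y : code n.+1 y = rcons (code n y) `[< b n y >].
      by rewrite /code /mkseq -addn1 iotaD map_cat/= add0n cats1.
    apply/seteqP; split=> y /=; rewrite codeSn.
      by move=> /rcons_inj[<- <-]; split=> //; case: asboolP.
    move=> [->]; case: c => /=.
      by move=> /asboolT ->.
    by move=> /asboolF ->.
  apply/seteqP; split.
  + apply: smallest_sub; first exact: smallest_sigma_algebra.
    move=> U oU; have -> : U = \bigcup_(i in [set i | b i `<=` U]) b i.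
      apply/seteqP; split=> [x Ux|x [i /= iU /iU]//].
      have /(Bb x)[V [BV Vx] VU] : nbhs x U by exact: open_nbhs_nbhs.
      by have [i Vi] := Bb' _ BV; exists i => //=; rewrite -Vi.
    rewrite bigcup_mkcond; apply: sigma_algebra_bigcup => i.
    case: ifPn => _; last exact: sigma_algebra0.
    apply: sub_sigma_algebra; apply: (GP i.+1 (fun s => nth false s i)) => y.
    by rewrite nth_mkseq//; split=> /asboolP.
  + apply: smallest_sub; first exact: sigma_algebra_measurable.
    move=> A /GH[[n S] ->]; rewrite /H/=.
    elim: S => [|s S ih].
      by rewrite (_ : [set _ | _] = set0)// -subset0 => y.
    rewrite (_ : [set _ | _] = [set y : borel K | code n y = s] `|`
       [set y : borel K | code n y \in S]); first exact: measurableU.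
    apply/seteqP; split=> y /=; rewrite inE.
      by move=> /orP[/eqP|]; [left|right].
    by move=> [->|->]; rewrite ?eqxx ?orbT.
Qed.

(** * The one-sided subshift *)

Section shift_space.
Variables (N0 : nat) (A : aperiodic_mx N0) (R : realType) (theta : R).
Hypothesis theta01 : 0 < theta < 1.
Implicit Types x y : sft A.
Local Notation dist := (@dtheta N0 A R theta).
Local Notation X := (Sigma A theta).

Let t0 : 0 < theta. Proof. by case/andP: theta01. Qed.
Let t1 : theta < 1. Proof. by case/andP: theta01. Qed.

Lemma dtheta_ge0 x y : 0 <= dist x y.
Proof.
apply: limr_ge; first exact: is_cvg_dtheta.
apply: nearW => n; rewrite /series/= sumr_ge0// => i _.
by rewrite mulr_ge0 ?exprn_ge0 ?(ltW t0)// subr_ge0; case: eqP.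
Qed.

Lemma dtheta_le x y : dist x y <= (1 - theta)^-1.
Proof.
apply: limr_le; first exact: is_cvg_dtheta.
apply: nearW => n; rewrite /series/=.
apply: (@le_trans _ _ (\sum_(0 <= i < n) theta ^+ i)).
  apply: ler_sum => i _; rewrite ler_piMr ?exprn_ge0 ?(ltW t0)//.
have t10 : 0 < 1 - theta by rewrite subr_gt0.
rewrite big_mkord -[leLHS]mul1r -[leRHS]mulr1 -{1}(mulVf (lt0r_neq0 t10)) -mulrA.
rewrite ler_wpM2l ?invr_ge0 ?(ltW t10)//.
by rewrite -opprB mulNr -subrX1 opprB lerBlDr lerDl exprn_ge0 ?(ltW t0).
Qed.

Definition sft_agree n x y := forall i, (i < n)%N -> x i = y i.

Definition sft_iter n x : sft A := iter n (@sft_shift N0 A) x.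

Lemma sft_iterE n x i : sft_iter n x i = x (n + i)%N.
Proof. by elim: n i => [//|n ih] i; rewrite /sft_iter iterS/= -/(sft_iter n x) ih addnS. Qed.

Lemma dtheta_agree n x y : sft_agree n x y ->
  dist x y = theta ^+ n * dist (sft_iter n x) (sft_iter n y).
Proof.
elim: n => [|n ih] xy; first by rewrite expr0 mul1r.
rewrite ih; last by move=> i im; apply: xy; exact: ltnW.
rewrite (dtheta_shift theta01) -!/(sft_iter n.+1 _) !sft_iterE addn0 xy// eqxx.
by rewrite subrr add0r exprSr mulrA.
Qed.

Lemma dtheta_agree_le n x y : sft_agree n x y ->
  dist x y <= theta ^+ n * (1 - theta)^-1.
Proof.
move=> /dtheta_agree ->; rewrite ler_wpM2l ?exprn_ge0 ?(ltW t0)//.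
exact: dtheta_le.
Qed.

Lemma dtheta_lt_agree n x y : dist x y < theta ^+ n -> sft_agree n.+1 x y.
Proof.
move=> xy; suff : forall k, (k <= n.+1)%N -> sft_agree k x y by exact.
elim=> [//|k ih] kn i; rewrite ltnS leq_eqVlt => /predU1P[->{i}|]; last first.
  by apply: ih; exact: ltnW.
have [//|/eqP/negbTE xyk] := pselect (x k = y k); exfalso; move: xy; rewrite ltNge => /negP; apply.
rewrite (dtheta_agree (ih (ltnW kn))) (dtheta_shift theta01) !sft_iterE addn0 xyk subr0.
apply: (@le_trans _ _ (theta ^+ k)); first by rewrite ler_wiXn2l ?(ltW t0) ?(ltW t1).
by rewrite ler_peMr ?exprn_ge0 ?(ltW t0)// lerDl mulr_ge0 ?dtheta_ge0 ?(ltW t0).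
Qed.

Lemma dtheta_lt1 x y : dist x y < 1 -> x 0%N = y 0%N.
Proof. by rewrite -(expr0 theta) => /dtheta_lt_agree; apply. Qed.

Lemma measurable_open (U : set X) : dist_open dist U -> measurable U.
Proof. exact: sub_sigma_algebra. Qed.

(** A function of the zeroth symbol is locally constant. *)
Lemma measurable_head d (T : measurableType d) (f : 'I_N0 -> T) :
  measurable_fun setT (fun x : X => f (x 0%N)).
Proof.
move=> _ B mB; rewrite setTI; apply: measurable_open => x Bx.
by exists 1 => // y /= /dtheta_lt1 xy; move: Bx; rewrite /preimage/= xy.
Qed.

Lemma measurable_head_set (P : set 'I_N0) : measurable [set x : X | P (x 0%N)].
Proof.
apply: measurable_open => x /= Px; exists 1 => // y /= /dtheta_lt1 xy.
by rewrite -xy.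
Qed.

Definition cyl n (w : nat -> 'I_N0) : set X :=
  [set x : X | forall i, (i <= n)%N -> sft_seq x i = w i].

Lemma open_cyl n w : dist_open dist (cyl n w).
Proof.
move=> x xw; exists (theta ^+ n); first by rewrite exprn_gt0.
move=> y /= /dtheta_lt_agree xy i iN.
by rewrite -xw// xy// ltnS.
Qed.

Lemma measurable_cyl n w : measurable (cyl n w).
Proof. by apply: measurable_open; exact: open_cyl. Qed.

Lemma measurable_set1_sft x : measurable ([set x] : set X).
Proof.
have -> : [set x] = \bigcap_n cyl n x.
  apply/seteqP; split=> [y -> n _ i//|y h]; apply: sft_eq => i.
  exact: (h i Logic.I i).
by apply: bigcap_measurable => // n _; exact: measurable_cyl.
Qed.

(** The length of the cylinders is at least two: the transfer identity for the
   Markov measure is proved on these. *)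
Definition cyls : set (set X) :=
  [set C | C = set0 \/ C = setT \/ exists n w, C = cyl n.+1 w].

Lemma cyls_generate : (measurable : set (set X)) = <<s cyls>>.
Proof.
apply/seteqP; split; last first.
  apply: smallest_sub; first exact: sigma_algebra_measurable.
  by move=> _ [->//|[->//|[n [w ->]]]]; exact: measurable_cyl.
apply: smallest_sub; first exact: smallest_sigma_algebra.
move=> U oU.
pose W (s : seq 'I_N0) : set X := cyl (size s).-2.+1 (nth (sft_seq (point : sft A) 0%N) s).
pose V k := if unpickle k is Some s then (if `[< W s `<=` U >] then W s else set0) else set0.
have -> : U = \bigcup_k V k.
  apply/seteqP; split=> [x Ux|x [k _]].
    have [e e0 eU] := oU _ Ux.
    have [n ne] : exists n, theta ^+ n * (1 - theta)^-1 < e.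
      have /cvgrPdist_lt/(_ (e * (1 - theta)))[] : (fun n => theta ^+ n) @ \oo --> (0 : R).
      - by apply: cvg_expr; rewrite ger0_norm ?ltW.
      - by rewrite mulr_gt0// subr_gt0.
      move=> n _ /(_ n (leqnn n)) /=; rewrite sub0r normrN ger0_norm ?exprn_ge0 ?ltW//.
      by move=> h; exists n; rewrite ltr_pdivrMr// subr_gt0.
    pose s := mkseq x n.+2.
    have sW y : W s y -> sft_agree n.+2 y x.
      move=> Wy i iN; by rewrite (Wy i) ?size_mkseq//= nth_mkseq.
    exists (pickle s); rewrite // /V pickleK asboolT.
      by move=> i; rewrite size_mkseq/= => iN; rewrite nth_mkseq.
    move=> y /sW xy; apply: eU => /=; apply: le_lt_trans ne.
    apply: dtheta_agree_le => i iN; apply/esym/xy.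
    by rewrite (leq_trans iN)// leqW.
  by rewrite /V; case: unpickle => // s; case: asboolP => // WU /WU.
apply: sigma_algebra_bigcup => k; rewrite /V.
case: unpickle => [s|]; last exact: sigma_algebra0.
case: ifPn => _; last exact: sigma_algebra0.
by apply: sub_sigma_algebra; right; right; exists (size s).-2; eexists.
Qed.

Lemma cyls_setI : setI_closed cyls.
Proof.
have cylI n n' w w' : (n <= n')%N -> cyls (cyl n.+1 w `&` cyl n'.+1 w').
  move=> nn'; have [ww'|ww'] := pselect (forall i, (i <= n.+1)%N -> w i = w' i).
    right; right; exists n', w'; apply/seteqP; split=> [x []//|x xw]; split=> // i iN.
    by rewrite ww'// xw// (leq_trans iN).
  left; rewrite -subset0 => x [xw xw']; apply: ww' => i iN.
  by rewrite -xw// xw'// (leq_trans iN).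
move=> C D [->|[->|[n [w ->]]]].
- by rewrite set0I; left.
- by rewrite setTI.
- move=> [->|[->|[n' [w' ->]]]]; first by rewrite setI0; left.
    by rewrite setIT; right; right; exists n, w.
  have [nn'|/ltnW nn'] := leqP n n'; first exact: cylI.
  by rewrite setIC; exact: cylI.
Qed.

Fact sft_cons_subproof i x : A i (x 0%N) = 1%N ->
  forall n, A (if n is n'.+1 then x n' else i) (x n) = 1%N.
Proof. by move=> Ai [|n] //; exact: sft_admissible. Qed.

(** The [i]-th inverse branch of the shift; it is the identity, an arbitrary
   choice, where the symbol [i] may not precede [x]. *)
Definition sft_cons i x : sft A :=
  match pselect (A i (x 0%N) = 1%N) with
  | left h => @Sft _ A (fun n => if n is n'.+1 then x n' else i) (sft_cons_subproof h)
  | right _ => x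
  end.

Lemma sft_consE i x n : A i (x 0%N) = 1%N ->
  sft_cons i x n = if n is n'.+1 then x n' else i.
Proof. by rewrite /sft_cons; case: pselect. Qed.

Lemma sft_consK i x : A i (x 0%N) = 1%N -> sft_shift (sft_cons i x) = x.
Proof. by move=> Ai; apply: sft_eq => n; rewrite /sft_shift/= sft_consE. Qed.

Lemma dtheta_cons i x y : A i (x 0%N) = 1%N -> A i (y 0%N) = 1%N ->
  dist (sft_cons i x) (sft_cons i y) = theta * dist x y.
Proof.
move=> Ax Ay; rewrite (dtheta_shift theta01) !sft_consE// eqxx subrr add0r.
by rewrite !sft_consK.
Qed.

Lemma measurable_cons i : measurable_fun setT (sft_cons i : X -> X).
Proof.
apply: (@measurability _ _ X X setT _ (dist_open dist)) => //.
move=> _ [U oU <-]; rewrite setTI; apply: measurable_open => x /= Ux.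
have [e e0 eU] := oU _ Ux; exists (Num.min 1 e); first by rewrite lt_min ltr01.
move=> y /=; rewrite lt_min => /andP[/dtheta_lt1 xy0 xye]; apply: eU => /=.
have [Ax|Ax] := pselect (A i (x 0%N) = 1%N).
  rewrite dtheta_cons// -?xy0//; apply: le_lt_trans xye.
  by rewrite ler_piMl ?dtheta_ge0 ?ltW.
have Ay : A i (y 0%N) <> 1%N by rewrite -xy0.
by rewrite /sft_cons; case: pselect => // _; case: pselect.
Qed.

End shift_space.

(** * Signed disintegrations along the leaves *)

Section ae_integral.
Context d (T : measurableType d) (R : realType) (m : {measure set T -> \bar R}).

Lemma ae_ge0_integral (f : T -> \bar R) :
  m.-integrable setT f ->
  (forall B, measurable B -> (0 <= \int[m]_(x in B) f x)%E) ->
  \forall x \ae m, (0 <= f x)%E.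
Proof.
move=> fi f0; have mf := measurable_int _ fi.
pose B := [set x | (f x < 0)%E].
have mB : measurable B.
  by rewrite -[B]setTI; apply: emeasurable_fun_lt => //; exact: measurable_cst.
have fiB : m.-integrable B f by exact: integrableS fi.
have : (\int[m]_(x in B) `|f x| = 0)%E.
  apply/eqP; rewrite eq_le integral_ge0// andbT.
  have -> : (\int[m]_(x in B) `|f x| = \int[m]_(x in B) - f x)%E.
    by apply: eq_integral => x; rewrite inE => /ltW fx0; rewrite lee0_abs.
  rewrite integralN; last exact: integrable_add_def.
  by rewrite leeNl oppe0; exact: f0.
move=> /(ae_eq_integral_abs m mB (measurable_funTS mf)).
apply: filterS => x h; rewrite leNgt; apply/negP => fx0.
by have := h fx0 => /= e; move: fx0; rewrite e ltxx.
Qed.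

Lemma ae_exists_measurable (P : T -> Prop) :
  (\forall x \ae m, P x) ->
  exists E, [/\ measurable E, m (~` E) = 0%E & forall x, E x -> P x].
Proof.
move=> [N [mN N0 PN]]; exists (~` N); split; rewrite ?setCK//.
  exact: measurableC.
by move=> x Nx; apply: contrapT => Px; apply: Nx; exact: PN.
Qed.
End ae_integral.

Section jordan_parts.
Context d (T : measurableType d) (R : realType).
Variable nu : {charge set T -> \bar R}.
Local Open Scope ereal_scope.

Definition hahnP := (sval (cid (hahn_subproof nu))).1.
Definition hahnN := (sval (cid (hahn_subproof nu))).2.

Lemma measurable_hahnP : measurable hahnP. Proof. by case: (hahn nu) => -[]. Qed.

Lemma measurable_hahnN : measurable hahnN. Proof. by case: (hahn nu) => _ []. Qed.

Lemma pos_partE E : measurable E -> pos_part nu E = nu (E `&` hahnP).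
Proof.
by move=> mE; rewrite /pos_part/= /jordan_pos/= /measure_of_charge /crestr0 ifT// inE.
Qed.

Lemma neg_partE E : measurable E -> neg_part nu E = - nu (E `&` hahnN).
Proof.
move=> mE; rewrite /neg_part/= /jordan_neg/= /measure_of_charge cscaleN1.
by congr (- _); rewrite [LHS]/= /crestr0 ifT// inE.
Qed.

Lemma jordanE E : measurable E -> nu E = pos_part nu E - neg_part nu E.
Proof.
move=> mE; rewrite pos_partE// neg_partE// oppeK.
apply: charge_partition => //; [exact: measurable_hahnP|exact: measurable_hahnN|..];
  by case: (hahn nu).
Qed.

End jordan_parts.

Lemma mule_eq_id (R : realType) (a b : \bar R) : (a * b = b)%E -> b <> 0%E ->
  a \is a fin_num -> b \is a fin_num -> a = 1%E.
Proof.
move=> + + af bf; rewrite -(fineK af) -(fineK bf) -EFinM => -[ab] b0; congr EFin.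
apply/eqP; rewrite -subr_eq0.
have : (fine a - 1) * fine b = 0 by rewrite mulrBl ab mul1r subrr.
by move=> /eqP; rewrite mulf_eq0 => /orP[//|/eqP b00]; exfalso; apply: b0; rewrite b00.
Qed.

Section fibred.
Variables (N0 : nat) (A : aperiodic_mx N0) (R : realType) (theta : R).
Hypothesis theta01 : 0 < theta < 1.
Variables (K : pmetricType R) (cK : compact [set: K]).
Local Notation X := (Sigma A theta).
Local Notation XK := (Sigma A theta * borel K)%type.
Variable m : probability X R.
Local Open Scope ereal_scope.
Implicit Types (mu nu : smeasure XK R) (kap : X -> smeasure XK R).

Definition on_leaf (x : X) (nu : smeasure XK R) :=
  forall E, measurable E -> (forall y, ~ E (x, y)) -> nu E = 0.

(** A signed disintegration along the leaves.  Unlike a pair of Rokhlin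
   disintegrations of the Jordan parts, it depends linearly on the measure. *)
Record fibred mu kap : Prop := {
  fibred_int : forall E, measurable E -> m.-integrable setT (fun x => kap x E);
  fibred_leaf : \forall x \ae m, on_leaf x (kap x);
  fibredE : forall E, measurable E -> mu E = \int[m]_x kap x E }.

Lemma fibred_lin a mu nu kap kap' : fibred mu kap -> fibred nu kap' ->
  fibred (a *: mu + nu)%R (fun x => a *: kap x + kap' x)%R.
Proof.
move=> [i1 l1 e1] [i2 l2 e2].
have E1 E : measurable E -> (fun x => (a *: kap x + kap' x)%R E) =
    (fun x => a%:E * kap x E + kap' x E).
  by move=> mE; apply/funext => x; rewrite smeasureDE// smeasureZE.
have i3 E : measurable E -> m.-integrable setT (fun x => a%:E * kap x E).
  by move=> mE; apply: integrableZl => //; exact: i1.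
split.
- by move=> E mE; rewrite E1//; apply: integrableD => //; [exact: i3|exact: i2].
- apply: filterS2 l1 l2 => x h1 h2 E mE xE.
  by rewrite smeasureDE// smeasureZE// h1// h2// mule0 adde0.
- move=> E mE; rewrite E1// integralD//; [|exact: i3|exact: i2].
  by rewrite integralZl//; [rewrite smeasureDE// smeasureZE// e1// e2|exact: i1].
Qed.

(** Restriction to a Hahn set produces signed disintegrations of the Jordan parts. *)
Lemma fibred_restr mu kap D (mD : measurable D) : fibred mu kap ->
  fibred (smeasure_of (crestr mu mD)) (fun x => smeasure_of (crestr (kap x) mD)).
Proof.
move=> [i l e]; have E1 E : measurable E ->
    (fun x => smeasure_of (crestr (kap x) mD) E) = (fun x => kap x (E `&` D)).
  by move=> mE; apply/funext => x; rewrite smeasure_ofE.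
split.
- by move=> E mE; rewrite E1//; apply: i; exact: measurableI.
- apply: filterS l => x h E mE xE; rewrite smeasure_ofE//; apply: h => [|y []].
    exact: measurableI.
  by move=> /xE.
- by move=> E mE; rewrite smeasure_ofE//= E1// -e//; exact: measurableI.
Qed.

Lemma on_leaf_fst x nu (B : set X) (E : set (borel K)) :
  on_leaf x nu -> measurable B -> measurable E ->
  nu (B `*` E) = if x \in B then nu (setT `*` E) else 0.
Proof.
move=> lx mB mE; have mBE : measurable (B `*` E) by exact: measurableX.
case: ifPn => [|]; rewrite ?inE ?notin_setE => xB; last first.
  by apply: lx => // y [].
have mTE : measurable (setT `*` E : set XK) by exact: measurableX.
have <- : (setT `*` E) `&` (B `*` E) = B `*` E.
  by apply/seteqP; split=> [[? ?] [_ []]|[? ?] []]//.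
rewrite [RHS](chargeDI _ mTE mBE) (lx (_ `\` _)) ?add0e//.
  exact: measurableD.
by move=> y [[_ /= Ey]]; apply.
Qed.

Lemma on_leaf_xsection x nu E : on_leaf x nu -> measurable E ->
  nu E = nu (setT `*` xsection E x).
Proof.
move=> lx mE; have mTE : measurable (setT `*` xsection E x : set XK).
  by apply: measurableX => //; exact: measurable_xsection.
rewrite (chargeDI _ mE mTE) [RHS](chargeDI _ mTE mE) setIC.
rewrite (lx (_ `\` _)) ?(lx (_ `*` _ `\` _))//; first exact: measurableD.
- by move=> y [[_ /xsectionP/=]].
- exact: measurableD.
- by move=> y [Exy /=]; apply; split => //; apply/xsectionP.
Qed.

Lemma fibred_rect mu kap (B : set X) (E : set (borel K)) :
  fibred mu kap -> measurable B -> measurable E ->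
  mu (B `*` E) = \int[m]_(x in B) kap x (setT `*` E).
Proof.
move=> [i l e] mB mE; rewrite e; last exact: measurableX.
have mTE : measurable (setT `*` E : set XK) by exact: measurableX.
have mBE : measurable (B `*` E : set XK) by exact: measurableX.
rewrite [RHS]integral_mkcond; apply: ae_eq_integral => //.
- exact: measurable_int (i _ mBE).
- apply/(measurable_restrictT _ mB); apply: measurable_funTS.
  exact: measurable_int (i _ mTE).
- by apply: filterS l => x lx _; rewrite (on_leaf_fst lx)// patchE.
Qed.

(** Nonnegativity can be tested on the countable algebra of [compact_borel_algebra],
   so that the exceptional null set does not depend on the measured set. *)
Lemma fibred_ge0 mu kap : fibred mu kap ->
  (forall E, measurable E -> 0 <= mu E) ->
  \forall x \ae m, forall E, measurable E -> 0 <= kap x E.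
Proof.
move=> mk mu0; have [i l e] := mk.
have [G [GT GC GU mG]] := compact_borel_algebra cK.
have mGn n : measurable (G n) by rewrite mG; apply: sub_sigma_algebra; exists n.
have mTG n : measurable (setT `*` G n : set XK) by exact: measurableX.
have : \forall x \ae m, forall n, 0 <= kap x (setT `*` G n).
  apply: ae_foralln => n; apply: ae_ge0_integral; first exact: i.
  move=> B mB; rewrite -(fibred_rect mk)// mu0//; exact: measurableX.
apply: filterS2 l => x lx h E mE; rewrite (on_leaf_xsection lx)//.
pose nu := spush measurable_snd (kap x).
have nuE B : measurable B -> nu B = kap x (setT `*` B).
  move=> mB; rewrite /nu /spush smeasure_ofE//=/pushforward.
  by congr (kap x _); apply/seteqP; split=> [] [? ?] // [].
rewrite -nuE; last exact: measurable_xsection.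
apply: (charge_ge0_algebra GT GC GU mG); last exact: measurable_xsection.
by move=> _ [n _ <-]; rewrite nuE.
Qed.

(** The difference of two kernels disintegrates the zero measure, so that it is
   nonnegative, and so is its opposite. *)
Lemma fibred_uniq mu kap kap' : fibred mu kap -> fibred mu kap' ->
  \forall x \ae m, kap x = kap' x.
Proof.
move=> f1 f2.
have mumu E : measurable E -> 0 <= (-1 *: mu + mu)%R E.
  by move=> mE; rewrite scaleN1r addNr smeasure_ofE.
have h1 := fibred_ge0 (fibred_lin (-1) f1 f2) mumu.
have h2 := fibred_ge0 (fibred_lin (-1) f2 f1) mumu.
apply: filterS2 h1 h2 => x h1 h2; apply: smeasure_eq => E mE.
move: (h1 _ mE) (h2 _ mE);
have f k : kap x E \is a fin_num by exact: fin_num_measure.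
rewrite !smeasureDE// !smeasureZE//.
rewrite (smeasure_fin (kap x))// (smeasure_fin (kap' x))//.
rewrite -!EFinM -!EFinD !lee_fin => a1 a2; congr EFin; lra.
Qed.

Definition marginal mu := spush (measurable_fst : measurable_fun setT (fst : XK -> X)) mu.

Lemma marginalE mu B : measurable B -> marginal mu B = mu (B `*` setT).
Proof.
move=> mB; rewrite /marginal /spush smeasure_ofE//= /pushforward.
by congr (mu _); apply/seteqP; split=> [] [? ?] // [].
Qed.

Lemma fibred_marginal mu kap : fibred mu kap -> marginal mu `<< m.
Proof.
move=> mk; apply/null_content_dominatesP => B mB B0.
rewrite marginalE// (fibred_rect mk)//.
apply: null_set_integral => //; apply: measurable_funTS.
exact: measurable_int (fibred_int mk (measurableX measurableT measurableT)).
Qed.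

(** The mass of the leaves integrates to the marginal over every Borel set of the
   base, as the Radon-Nikodym density does. *)
Lemma fibred_phi1 mu kap : fibred mu kap ->
  \forall x \ae m, phi1 m mu x = kap x setT.
Proof.
move=> mk; have dom := fibred_marginal mk; have [i l e] := mk.
have : ae_eq m setT (phi1 m mu) (fun x => kap x setT).
  apply: integral_ae_eq => //.
  - exact: Radon_Nikodym_integrable.
  - exact: measurable_int (i _ measurableT).
  - move=> B _ mB; rewrite -Radon_Nikodym_integral//.
    by rewrite [LHS]marginalE// (fibred_rect mk)// setXTT.
by apply: filterS => x; apply.
Qed.

Lemma smeasure_of_measureE (nu : {finite_measure set XK -> \bar R}) E :
  measurable E -> smeasure_of_measure nu E = nu E.
Proof. exact: smeasure_ofE. Qed.

(** Each Jordan part is, up to sign, a restriction of the measure to a Hahn set, which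
   is again fibred and hence has a marginal dominated by [m]. *)
Lemma fibred_AB mu kap : fibred mu kap -> AB m mu.
Proof.
move=> mk; have [i l e] := mk.
have null D B (mD : measurable D) : measurable B -> m B = 0 ->
    mu (B `*` setT `&` D) = 0.
  move=> mB B0; have := fibred_marginal (fibred_restr mD mk).
  move=> /null_content_dominatesP/(_ _ mB B0).
  rewrite marginalE// smeasure_ofE//; exact: measurableX.
have mfst B : measurable B -> measurable (fst @^-1` B : set XK).
  by move=> mB; rewrite -[X in measurable X]setTI; exact: measurable_fst.
have fstE B : fst @^-1` B = B `*` setT :> set XK.
  by apply/seteqP; split=> [] [? ?]// [].
split; apply/null_content_dominatesP => B mB B0.
- rewrite [LHS](pos_partE mu (mfst _ mB)) fstE; apply: null => //.
  exact: measurable_hahnP.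
- rewrite [LHS](neg_partE mu (mfst _ mB)) fstE null ?oppe0//.
  exact: measurable_hahnN.
Qed.

Lemma fibred_pos mu kap : fibred mu kap ->
  exists kap', fibred (smeasure_of_measure (pos_part mu)) kap'.
Proof.
move=> mk; have mP := measurable_hahnP mu.
eexists; rewrite [smeasure_of_measure _](_ : _ = smeasure_of (crestr mu mP)).
  exact: fibred_restr mk.
apply: smeasure_eq => E mE; rewrite smeasure_of_measureE// smeasure_ofE//.
exact: pos_partE.
Qed.

Lemma fibred_neg mu kap : fibred mu kap ->
  exists kap', fibred (smeasure_of_measure (neg_part mu)) kap'.
Proof.
move=> mk; have mN := measurable_hahnN mu.
(* [-2 nu + nu] writes the opposite of the restriction [nu] as an instance of
   [fibred_lin]. *)
have f0 := fibred_lin (-2) (fibred_restr mN mk) (fibred_restr mN mk).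
eexists; rewrite [smeasure_of_measure _](_ : _ = -2 *: smeasure_of (crestr mu mN) +
  smeasure_of (crestr mu mN))%R; first exact: f0.
apply: smeasure_eq => E mE; rewrite smeasure_of_measureE//.
rewrite smeasureDE// smeasureZE// smeasure_ofE// neg_partE//= /crestr.
rewrite (smeasure_fin mu (measurableI _ _ mE mN)) -!EFinM -EFinD -EFinN.
by congr EFin; lra.
Qed.

(** The leaves of a positive measure are almost all positive, and normalising them
   gives Rokhlin's conditional probabilities.  A leaf of mass zero receives an
   arbitrary probability, which the zero density annihilates. *)
Lemma fibred_disintegration (nu : {finite_measure set XK -> \bar R}) kap :
  fibred (smeasure_of_measure nu) kap -> exists k, disintegration m nu k.
Proof.
move=> mk; have [i l e] := mk.
have nu0 E : measurable E -> 0 <= smeasure_of_measure nu E.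
  by move=> mE; rewrite smeasure_of_measureE.
have [Q [mQ Q0 QP]] := ae_exists_measurable (filterI l (fibred_ge0 mk nu0)).
have Qge0 x : Q x -> forall E, 0 <= kap x E.
  move=> Qx E; have [mE|mE] := pselect (measurable E); first exact: (QP _ Qx).2.
  by rewrite smeasure_out.
pose gam x : {measure set XK -> \bar R} :=
  match pselect (Q x) with
  | left Qx => measure_of_charge (kap x) (Qge0 _ Qx) | right _ => mzero end.
have gamE x E : gam x E = if x \in Q then kap x E else 0.
  rewrite /gam; case: pselect => Qx; first by rewrite mem_set.
  by rewrite memNset.
have mgam E : measurable E -> measurable_fun setT (gam ^~ E).
  move=> mE; rewrite (_ : (fun x => _) = fun x => if x \in Q then kap x E else 0).
    apply: measurable_fun_ifT => //; last exact: measurable_int (i _ mE).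
    apply: (measurable_fun_bool true); rewrite setTI (_ : _ @^-1` _ = Q)//.
    by apply/seteqP; split=> x /=; [move=> /set_mem|move=> ?; apply/mem_set].
  by apply/funext => x; rewrite gamE.
pose kg : R.-ker X ~> XK := HB.pack gam (isKernel.Build _ _ _ _ R gam mgam).
pose pt : probability XK R := \d_(point : XK).
pose k (x : X) : probability XK R := mnormalize (gam x) pt.
have kE x E : Q x -> measurable E -> k x E * kap x setT = kap x E.
  move=> Qx mE; have gx F : gam x F = kap x F by rewrite gamE mem_set.
  rewrite /k/= /mnormalize !gx.
  have fT : kap x setT \is a fin_num by exact: fin_num_measure.
  case: ifPn => [/orP[/eqP k0|/eqP koo]|].
  - rewrite k0 mule0; apply/esym/eqP; rewrite eq_le Qge0// andbT -k0.
    by rewrite -!gx; apply: le_measure; rewrite ?inE.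
  - by move: fT; rewrite koo.
  - rewrite negb_or => /andP[kn0 _]; rewrite gx -muleA -{2}(fineK fT) -EFinM mulVf ?mule1//.
    by rewrite fine_eq0.
have mk' E : measurable E -> measurable_fun setT (fun x => k x E).
  by move=> mE; exact: measurable_kernel (knormalize kg pt) E mE.
exists k; split => //.
- pose Z := ~` Q `|` ((fun x => kap x setT) @^-1` [set 0]).
  have mZ0 : measurable ((fun x => kap x setT) @^-1` [set 0]).
    rewrite -[X in measurable X]setTI.
    exact: (measurable_int _ (i _ measurableT)) measurableT _ (emeasurable_set1 0).
  have mZ : measurable Z by apply: measurableU => //; exact: measurableC.
  exists Z; split => //.
  + have -> : mpush measurable_fst nu Z = smeasure_of_measure nu (Z `*` setT).
      by rewrite -marginalE// /marginal /spush smeasure_ofE//= /pushforward smeasure_of_measureE//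
        -[X in measurable X]setTI; exact: measurable_fst.
    rewrite (fibred_rect mk)// setXTT -[RHS](integral0 m Z).
    apply: ae_eq_integral => //.
      exact: measurable_funTS (measurable_int _ (i _ measurableT)).
    have QQ : \forall x \ae m, Q x by exists (~` Q); split => //; exact: measurableC.
    by apply: filterS QQ => x Qx [].
  + move=> x /= kx; apply: contrapT => /not_orP[/contrapT Qx k0]; apply: kx.
    have mx : measurable ([set x] `*` setT : set XK).
      by apply: measurableX => //; exact: measurable_set1_sft.
    suff : k x ([set x] `*` setT) = 1 by [].
    have := kE _ _ Qx mx; rewrite (on_leaf_fst (QP _ Qx).1 (measurable_set1_sft theta01 x))//.
    rewrite mem_set// setXTT => /mule_eq_id; apply => //; exact: fin_num_measure.
- move=> E mE; rewrite -smeasure_of_measureE// e//.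
  have mphi : measurable_fun setT (phi1 m (smeasure_of_measure nu)).
    by apply: measurable_int; apply: Radon_Nikodym_integrable; exact: fibred_marginal mk.
  apply: ae_eq_integral => //.
  + exact: measurable_int (i _ mE).
  + by apply: emeasurable_funM => //; exact: mk'.
  + have QQ : \forall x \ae m, Q x by exists (~` Q); split => //; exact: measurableC.
    by apply: filterS2 (fibred_phi1 mk) QQ => x -> Qx _; rewrite kE.
Qed.

(** The conditional probability need not charge its leaf where the density
   vanishes, but there the kernel is zero. *)
Lemma disintegration_fibred (nu : {finite_measure set XK -> \bar R}) k :
  marginal (smeasure_of_measure nu) `<< m -> disintegration m nu k ->
  fibred (smeasure_of_measure nu)
    (fun x => fine (phi1 m (smeasure_of_measure nu) x) *: smeasure_of_measure (k x))%R.
Proof.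
move=> dom [kl mk kE].
have phii : m.-integrable setT (phi1 m (smeasure_of_measure nu)).
  exact: Radon_Nikodym_integrable.
have phifin x : phi1 m (smeasure_of_measure nu) x \is a fin_num.
  exact: Radon_Nikodym_fin_num.
have E1 E : measurable E ->
    (fun x => (fine (phi1 m (smeasure_of_measure nu) x) *: smeasure_of_measure (k x))%R E)
    = (fun x => k x E * phi1 m (smeasure_of_measure nu) x).
  move=> mE; apply/funext => x.
  by rewrite smeasureZE// smeasure_of_measureE// fineK// muleC.
split.
- move=> E mE; rewrite E1//; apply: (le_integrable _ _ _ phii) => //.
    by apply: emeasurable_funM; [exact: mk|exact: measurable_int phii].
  move=> x _; rewrite abseM gee0_abs//.
  rewrite -[leRHS]mul1e lee_wpmul2r// probability_le1//.
- have [Z [mZ Z0 ZP]] := kl.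
  have Z1 : ae_eq m Z (phi1 m (smeasure_of_measure nu)) (cst 0).
    apply: integral_ae_eq => //; first exact: integrableS phii.
    move=> E EZ mE; rewrite integral0 -Radon_Nikodym_integral//.
    have -> : spush measurable_fst (smeasure_of_measure nu) E = mpush measurable_fst nu E.
      rewrite smeasure_ofE//= /pushforward smeasure_of_measureE//.
      by rewrite -[X in measurable X]setTI; exact: measurable_fst.
    exact: subset_measure0 EZ _.
  apply: filterS Z1 => x Z1 E mE xE; rewrite smeasureZE// smeasure_of_measureE//.
  have [Zx|Zx] := pselect (Z x); first by rewrite Z1//= mul0e.
  have kx1 : k x ([set x] `*` setT) = 1 by apply: contrapT => kx; exact/Zx/ZP.
  have mx : measurable ([set x] `*` setT : set XK).
    by apply: measurableX => //; exact: measurable_set1_sft.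
  rewrite [X in _ * X](_ : _ = 0) ?mule0//; apply/eqP; rewrite eq_le measure_ge0 andbT.
  have <- : k x (~` ([set x] `*` setT)) = 0 by rewrite probability_setC// kx1 subee.
  apply: le_measure; rewrite ?inE//; first exact: measurableC.
  by move=> [z y] Ezy [/= zx _]; apply: (xE y); rewrite -zx.
- by move=> E mE; rewrite E1// smeasure_of_measureE// kE.
Qed.

End fibred.

(** * Integration against charges and the Wasserstein norm *)

Section charge_integral.
Context d (T : measurableType d) (R : realType).
Implicit Types (nu : {charge set T -> \bar R}) (mu : smeasure T R).

Definition bounded_meas (g : T -> R) :=
  measurable_fun setT g /\ exists M, forall x, `|g x| <= M.

Lemma bounded_meas_integrable (l : {measure set T -> \bar R}) g :
  (l setT < +oo)%E -> bounded_meas g -> l.-integrable setT (EFin \o g).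
Proof.
move=> lT [mg [M gM]]; apply: measurable_bounded_integrable => //.
exists M; split; first by rewrite num_real.
by move=> r Mr x _; rewrite /= (le_trans (gM x))// ltW.
Qed.

Let finite_lty (l : {finite_measure set T -> \bar R}) : (l setT < +oo)%E.
Proof. by rewrite ltey_eq fin_num_measure. Qed.

(** Adding crosswise two decompositions of the same charge gives equal measures.
   This frees the integral from the Hahn decomposition in its definition, which
   neither sums nor push-forwards respect. *)
Lemma charge_integral_diff nu (l1 l2 : {measure set T -> \bar R}) g :
  (l1 setT < +oo)%E -> (l2 setT < +oo)%E -> bounded_meas g ->
  (forall E, measurable E -> nu E = l1 E - l2 E)%E ->
  charge_integral nu g = \int[l1]_(y in setT) g y - \int[l2]_(y in setT) g y.
Proof.
move=> f1 f2 bg nuE; have [mg _] := bg.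
have mg' : measurable_fun setT (EFin \o g) by exact/measurable_EFinP.
have ip := bounded_meas_integrable (finite_lty (pos_part nu)) bg.
have in_ := bounded_meas_integrable (finite_lty (neg_part nu)) bg.
have i1 := bounded_meas_integrable f1 bg.
have i2 := bounded_meas_integrable f2 bg.
have : (\int[measure_add (pos_part nu) l2]_y (g y)%:E =
        \int[measure_add (neg_part nu) l1]_y (g y)%:E)%E.
  apply: eq_measure_integral => E mE _.
  have := nuE _ mE; rewrite (jordanE nu mE) !/measure_add/= !/msum !big_ord_recl !big_ord0/= !adde0.
  have fin (l : {measure set T -> \bar R}) : (l setT < +oo)%E -> l E \is a fin_num.
    move=> lT; rewrite ge0_fin_numE//; apply: le_lt_trans lT.
    by apply: le_measure; rewrite ?inE.
  have h1 := fin _ f1; have h2 := fin _ f2.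
  have h3 := fin_num_measure (pos_part nu) _ mE.
  have h4 := fin_num_measure (neg_part nu) _ mE.
  rewrite -(fineK h1) -(fineK h2) -(fineK h3) -(fineK h4) -!EFinN -!EFinD => -[e].
  by congr EFin; lra.
rewrite !integral_measure_add// /charge_integral /Rintegral.
have h1 := integrable_fin_num measurableT i1; have h2 := integrable_fin_num measurableT i2.
have h3 := integrable_fin_num measurableT ip.
have h4 := integrable_fin_num measurableT in_.
rewrite -(fineK h1) -(fineK h2) -(fineK h3) -(fineK h4) -!EFinD => -[e].
by rewrite /=; lra.
Qed.

Let Rintegral_measure_add (l1 l2 : {measure set T -> \bar R}) g :
  (l1 setT < +oo)%E -> (l2 setT < +oo)%E -> bounded_meas g ->
  \int[measure_add l1 l2]_y g y = \int[l1]_y g y + \int[l2]_y g y.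
Proof.
move=> f1 f2 bg; rewrite /Rintegral integral_measure_add//.
- rewrite fineD//; apply: integrable_fin_num => //; exact: bounded_meas_integrable.
- exact: bounded_meas_integrable.
- exact: bounded_meas_integrable.
Qed.

Let Rintegral_mscale (k : {nonneg R}) (l : {measure set T -> \bar R}) g :
  (l setT < +oo)%E -> bounded_meas g ->
  \int[mscale k l]_y g y = k%:num * \int[l]_y g y.
Proof.
move=> f1 bg; have il := bounded_meas_integrable f1 bg.
have mg : measurable_fun setT (EFin \o g) by exact: measurable_int il.
have ip : (\int[l]_x (EFin \o g)^\+ x)%E \is a fin_num.
  by apply: integrable_fin_num => //; exact: integrable_funepos.
have in_ : (\int[l]_x (EFin \o g)^\- x)%E \is a fin_num.
  by apply: integrable_fin_num => //; exact: integrable_funeneg.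
rewrite /Rintegral integralE [in RHS]integralE !ge0_integral_mscale//.
- rewrite -muleBr; first by rewrite fineM// fin_numB ip in_.
    by [].
  by rewrite fin_num_adde_defl// fin_numN.
- exact: measurable_funeneg.
- exact: measurable_funepos.
Qed.

Let measure_add_lty (l1 l2 : {measure set T -> \bar R}) :
  (l1 setT < +oo)%E -> (l2 setT < +oo)%E -> (measure_add l1 l2 setT < +oo)%E.
Proof.
by move=> f1 f2; rewrite /measure_add/= /msum !big_ord_recl big_ord0/= adde0 lte_add_pinfty.
Qed.

Let measure_addE (l1 l2 : {measure set T -> \bar R}) E :
  measure_add l1 l2 E = (l1 E + l2 E)%E.
Proof. by rewrite /measure_add/= /msum !big_ord_recl big_ord0/= adde0. Qed.

Let mscale_lty k (l : {measure set T -> \bar R}) :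
  (l setT < +oo)%E -> (mscale k l setT < +oo)%E.
Proof. by move=> f1; rewrite /mscale/= lte_mul_pinfty. Qed.

Lemma charge_integral_lin a mu mu' g : bounded_meas g ->
  charge_integral (a *: mu + mu') g = a * charge_integral mu g + charge_integral mu' g.
Proof.
move=> bg.
pose k : {nonneg R} := NngNum (normr_ge0 a).
pose P (b : bool) : {finite_measure set T -> \bar R} := if b then pos_part mu else neg_part mu.
pose l1 : {measure set T -> \bar R} := measure_add (mscale k (P (0 <= a))) (pos_part mu').
pose l2 : {measure set T -> \bar R} := measure_add (mscale k (P (a < 0))) (neg_part mu').
rewrite (@charge_integral_diff _ l1 l2)//.
- have e1 : \int[l1]_y g y = `|a| * \int[P (0 <= a)%R]_y g y + \int[pos_part mu']_y g y.
    rewrite [LHS](Rintegral_measure_add (mscale_lty k (finite_lty _)) (finite_lty _) bg).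
    by congr (_ + _); exact: (Rintegral_mscale k (finite_lty _) bg).
  have e2 : \int[l2]_y g y = `|a| * \int[P (a < 0)%R]_y g y + \int[neg_part mu']_y g y.
    rewrite [LHS](Rintegral_measure_add (mscale_lty k (finite_lty _)) (finite_lty _) bg).
    by congr (_ + _); exact: (Rintegral_mscale k (finite_lty _) bg).
  rewrite e1 e2 /charge_integral /P.
  by case: (ltrP a 0) => a0; [rewrite ltr0_norm//|rewrite ger0_norm//]; lra.
- exact: (measure_add_lty (mscale_lty k (finite_lty _)) (finite_lty _)).
- exact: (measure_add_lty (mscale_lty k (finite_lty _)) (finite_lty _)).
- move=> E mE; rewrite smeasureDE// smeasureZE// (jordanE mu mE) (jordanE mu' mE).
  have -> : l1 E = (`|a|%:E * P (0 <= a)%R E + pos_part mu' E)%E by exact: measure_addE.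
  have -> : l2 E = (`|a|%:E * P (a < 0)%R E + neg_part mu' E)%E by exact: measure_addE.
  have h3 := fin_num_measure (pos_part mu) _ mE.
  have h4 := fin_num_measure (neg_part mu) _ mE.
  have h1 := fin_num_measure (pos_part mu') _ mE.
  have h2 := fin_num_measure (neg_part mu') _ mE.
  rewrite /P; case: (ltrP a 0) => a0;
    rewrite -(fineK h1) -(fineK h2) -(fineK h3) -(fineK h4) -!EFinB -!EFinM -!EFinD; congr EFin.
    by rewrite ltr0_norm//; lra.
  by rewrite ger0_norm//; lra.
Qed.

Lemma charge_integralZ a mu g : bounded_meas g ->
  charge_integral (a *: mu) g = a * charge_integral mu g.
Proof.
move=> bg; have h0 : charge_integral (0 : smeasure T R) g = 0.
  by have := charge_integral_lin 1 0 0 bg; rewrite scale1r addr0 mul1r; lra.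
by rewrite -[a *: mu]addr0 charge_integral_lin// h0 addr0.
Qed.

Lemma charge_integral_fun mu g a c : bounded_meas g ->
  charge_integral mu (fun x => a * g x + c) = a * charge_integral mu g + c * fine (mu setT).
Proof.
move=> bg; rewrite /charge_integral.
have h (l : {finite_measure set T -> \bar R}) :
    \int[l]_x (a * g x + c) = a * \int[l]_x g x + c * fine (l setT).
  have il := bounded_meas_integrable (finite_lty l) bg.
  rewrite RintegralD//.
  - by rewrite RintegralZl// Rintegral_cst.
  - exact: (integrableZl _ a il).
  - exact: finite_measure_integrable_cst.
rewrite !h (jordanE mu measurableT) fineB ?fin_num_measure//; lra.
Qed.

Lemma charge_integral_prob (P : probability T R) mu g : bounded_meas g ->
  (forall E, measurable E -> mu E = P E) -> (forall x, `|g x| <= 1) ->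
  `|charge_integral mu g| <= 1.
Proof.
move=> bg muE g1.
have PT : (P setT < +oo)%E by exact: finite_lty.
have iP := bounded_meas_integrable PT bg.
rewrite (@charge_integral_diff _ P mzero)//; first last.
- by move=> E mE; rewrite muE// /mzero/= sube0.
- exact: ltry.
rewrite [X in _ - X](_ : _ = 0); last by rewrite /Rintegral integral_measure_zero.
rewrite subr0; apply: le_trans (le_normr_Rintegral measurableT iP) _.
have <- : \int[P]_(x in setT) cst 1 x = 1.
  transitivity (1 * fine (P setT)); first exact: Rintegral_cst.
  by rewrite probability_setT mul1r.
apply: le_Rintegral => //.
- by have := integrable_abse iP.
- exact: finite_measure_integrable_cst.
Qed.
End charge_integral.

Section charge_integral_push.
Context d d' (T : measurableType d) (T' : measurableType d') (R : realType).
Variables (f : T -> T') (mf : measurable_fun setT f).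

Lemma spushE (mu : smeasure T R) E : measurable E -> spush mf mu E = mu (f @^-1` E).
Proof. by move=> mE; rewrite /spush smeasure_ofE. Qed.

Let mpre E : measurable E -> measurable (f @^-1` E).
Proof. by move=> mE; rewrite -[X in measurable X]setTI; exact: mf. Qed.

Lemma spush_lin a (mu nu : smeasure T R) :
  spush mf (a *: mu + nu) = a *: spush mf mu + spush mf nu.
Proof.
apply: smeasure_eq => E mE; have mE' := mpre mE.
by rewrite spushE// !smeasureDE// !smeasureZE// !spushE.
Qed.

Lemma charge_integral_push (mu : smeasure T R) g : bounded_meas g ->
  charge_integral (spush mf mu) g = charge_integral mu (g \o f).
Proof.
move=> bg; have [mg [M gM]] := bg.
have bgf : bounded_meas (g \o f).
  by split; [exact: measurableT_comp|exists M => x /=].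
have fl (l : {finite_measure set T -> \bar R}) : (l setT < +oo)%E.
  by rewrite ltey_eq fin_num_measure.
rewrite (@charge_integral_diff _ _ _ _ (mpush mf (pos_part mu)) (mpush mf (neg_part mu)))//.
- rewrite /charge_integral /Rintegral !integral_pushforward//.
  + exact/measurable_EFinP.
  + by rewrite preimage_setT; exact: (bounded_meas_integrable (fl _) bgf).
  + exact/measurable_EFinP.
  + by rewrite preimage_setT; exact: (bounded_meas_integrable (fl _) bgf).
- exact: fl.
- exact: fl.
- by move=> E mE; rewrite spushE//; apply: jordanE; exact: mpre.
Qed.
End charge_integral_push.

Section wasserstein.
Variables (R : realType) (K : pmetricType R).
Implicit Types (nu : smeasure (borel K) R) (g : K -> R).

Definition wtest : set (K -> R) :=
  [set g | (forall y z, `|g y - g z| <= mdist y z) /\ (forall y, `|g y| <= 1)].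

Lemma lipschitz_borel_measurable g :
  (forall y z, `|g y - g z| <= mdist y z) -> measurable_fun setT (g : borel K -> R).
Proof.
move=> lg; apply: (measurability _ (RGenOInfty.measurableE R)).
move=> _ [_ [r ->] <-]; rewrite setTI; apply: sub_sigma_algebra.
rewrite openE => y; rewrite /preimage/= in_itv/= andbT => ry.
apply/nbhs_ballP; exists (g y - r); rewrite /= ?subr_gt0// => z.
rewrite ballEmdist/= in_itv/= andbT => /(le_lt_trans (lg y z)).
by rewrite ltr_norml => /andP[_]; lra.
Qed.

Lemma wtest_bounded g : wtest g -> bounded_meas (g : borel K -> R).
Proof.
by move=> [lg g1]; split; [exact: lipschitz_borel_measurable|exists 1].
Qed.

Lemma normW_leP nu a :
  (normW nu <= a%:E)%E <-> forall g, wtest g -> `|charge_integral nu g| <= a.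
Proof.
split=> [h g gt|h].
  by rewrite -lee_fin; apply: le_trans h; apply: ereal_sup_ubound; exists g.
by apply: ge_ereal_sup => _ [g gt <-]; rewrite lee_fin; exact: h.
Qed.

Lemma normW_lin c nu nu' a b : (normW nu <= a%:E)%E -> (normW nu' <= b%:E)%E ->
  (normW (c *: nu + nu' : smeasure (borel K) R)%R <= (`|c| * a + b)%:E)%E.
Proof.
move=> /normW_leP h /normW_leP h'; apply/normW_leP => g gt.
rewrite charge_integral_lin; last exact: wtest_bounded.
apply: le_trans (ler_normD _ _) _; rewrite normrM.
by apply: lerD; [rewrite ler_wpM2l// h|exact: h'].
Qed.

Lemma normW_prob nu (P : probability (borel K) R) :
  (forall E, measurable E -> nu E = P E) -> (normW nu <= 1%:E)%E.
Proof.
move=> nuE; apply/normW_leP => g gt; apply: (charge_integral_prob (P := P)) => //.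
  exact: wtest_bounded.
by case: gt.
Qed.

Lemma normW_ge0 nu a : (normW nu <= a%:E)%E -> 0 <= a.
Proof.
move=> /normW_leP/(_ (cst 0)) h; apply: le_trans (h _) => //.
by split=> [y z|y]; rewrite ?subrr normr0 ?mdist_ge0.
Qed.

(** Pulling a test function back by an [al]-Lipschitz map and subtracting one of
   its values gives [al] times a test function, because the diameter is at most
   one; the constant integrates to a multiple of the total mass. *)
Lemma normW_contraction (h : borel K -> borel K) (mh : measurable_fun setT h)
    (al : R) nu a :
  (forall y z : K, mdist y z <= 1) -> 0 < al ->
  (forall y z : K, mdist (h y : K) (h z) <= al * mdist y z) ->
  (normW nu <= a%:E)%E ->
  (normW (spush mh nu) <= (al * a + `|fine (nu setT)|)%:E)%E.
Proof.
move=> diam al0 hal /normW_leP nua; apply/normW_leP => g gt.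
have bg := wtest_bounded gt; have [lg g1] := gt.
rewrite charge_integral_push//.
pose c := g (h point); pose g' y := al^-1 * (g (h y) - c).
have gt' : wtest g'.
  have l y z : `|g' y - g' z| <= mdist y z.
    rewrite /g' -mulrBr opprB addrA subrK normrM gtr0_norm ?invr_gt0//.
    rewrite mulrC ler_pdivrMr// mulrC; apply: le_trans (hal y z); exact: lg.
  split=> // y; have h0 : g' point = 0 by rewrite /g' subrr mulr0.
  by rewrite -[g' y]subr0 -h0; apply: le_trans (l _ _) (diam _ _).
have gE : (g \o h) = (fun y => al * g' y + c).
  by apply/funext => y; rewrite /g' mulrA divff ?gt_eqF// mul1r subrK.
rewrite gE charge_integral_fun; last exact: wtest_bounded.
apply: le_trans (ler_normD _ _) _; rewrite !normrM gtr0_norm//.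
apply: lerD; first by rewrite ler_wpM2l ?(ltW al0)// nua.
by rewrite ler_piMl// g1.
Qed.

End wasserstein.

(** * The baker map of a Markov measure *)

Section slots.
Variables (R : realType) (N : nat) (b : 'I_N -> R).
Hypothesis b0 : forall i, 0 <= b i.
Hypothesis b1 : \sum_i b i = 1.

Definition cum (n : nat) : R := \sum_(k < N | (k < n)%N) b k.

Lemma cum0 : cum 0 = 0. Proof. by rewrite /cum big_pred0. Qed.

Lemma cumN : cum N = 1.
Proof. by rewrite /cum -b1; apply: eq_bigl => k; rewrite ltn_ord. Qed.

Lemma cumS (i : 'I_N) : cum i.+1 = cum i + b i.
Proof.
rewrite /cum (bigD1 i) ?ltnS//= addrC; congr (_ + _).
apply: eq_bigl => k; rewrite ltnS [in RHS]ltn_neqAle andbC.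
by congr (_ && _).
Qed.

Lemma cum_le m n : (m <= n)%N -> cum m <= cum n.
Proof.
move=> mn; rewrite /cum [leRHS](bigID (fun k : 'I_N => (k < m)%N))/=.
rewrite [X in _ <= X + _](_ : _ = cum m); last first.
  apply: eq_bigl => k; case: (ltnP k m) => km; rewrite ?andbF// andbT.
  exact: leq_trans mn.
by rewrite lerDl sumr_ge0.
Qed.

(** The unit interval is cut into consecutive half-open pieces of lengths [b], so
   that the slot of a uniform variable is a symbol of law [b], independent of the
   rescaled position in the piece ([unif_slot]). *)
Definition slot (u : R) : option 'I_N := [pick i : 'I_N | cum i <= u < cum i.+1].

Lemma slotP u i : slot u = Some i <-> cum i <= u < cum i.+1.
Proof.
rewrite /slot; case: pickP => [j /andP[ju uj]|h]; last first.
  by split=> //; rewrite h.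
split=> [[<-]|/andP[iu ui]]; first by rewrite ju uj.
congr Some; apply: val_inj; apply/eqP; rewrite eqn_leq; apply/andP; split.
- rewrite leqNgt; apply/negP => /cum_le ij.
  by move: (le_lt_trans ju (lt_le_trans ui ij)); rewrite ltxx.
- rewrite leqNgt; apply/negP => /cum_le ij.
  by move: (le_lt_trans iu (lt_le_trans uj ij)); rewrite ltxx.
Qed.

Lemma slot_total u : 0 <= u < 1 -> exists i, slot u = Some i.
Proof.
move=> /andP[u0 u1].
have ex : exists n, u < cum n by exists N; rewrite cumN.
case: (ex_minnP ex) => -[|n]; first by rewrite cum0 ltNge u0.
move=> un min; have nN : (n < N)%N by apply: (min N); rewrite cumN.
exists (Ordinal nN); apply/slotP => /=; rewrite un andbT leNgt; apply/negP.
by move=> /min; rewrite ltnn.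
Qed.

Lemma slot_in u i : slot u = Some i -> 0 <= u < 1.
Proof.
move=> /slotP/andP[iu ui]; rewrite (le_trans _ iu)/= ?(lt_le_trans ui)//.
  by rewrite -cumN cum_le.
by rewrite -cum0 cum_le.
Qed.

Definition rescale (i : 'I_N) (u : R) : R := (u - cum i) / b i.

Lemma slot_rescale u i : 0 < b i -> slot u = Some i <-> 0 <= rescale i u < 1.
Proof.
move=> bi; rewrite slotP cumS /rescale ltr_pdivrMr// mul1r ltrBlDl.
by rewrite pmulr_lge0 ?invr_gt0// subr_ge0.
Qed.

Lemma slot_pos u i : slot u = Some i -> 0 < b i.
Proof. by move=> /slotP; rewrite cumS => /andP[h /(le_lt_trans h)]; rewrite ltrDl. Qed.

End slots.

Section uniform.
Variable R : realType.
Local Open Scope ereal_scope.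

Definition unif : set (measurableTypeR R) -> \bar R :=
  mrestr lebesgue_measure (measurable_itv `[0%R, 1%R[ : measurable (`[0%R, 1%R[%classic : set R)).

HB.instance Definition _ := Measure.on unif.

Let unifT : unif setT = 1.
Proof.
by rewrite /unif /mrestr setTI lebesgue_measure_itv/= lte_fin ltr01 -EFinB subr0.
Qed.

HB.instance Definition _ := Measure_isProbability.Build _ _ _ unif unifT.

(** The rescaled push-forward of the Lebesgue measure gives intervals their length,
   which characterises the Lebesgue measure. *)
Lemma lebesgue_affine (c b : R) (E : set R) : (0 < b)%R -> measurable E ->
  lebesgue_measure ((fun u : R => ((u - c) / b)%R) @^-1` E) = b%:E * lebesgue_measure E.
Proof.
move=> b0 mE.
have mf : measurable_fun setT (fun u : measurableTypeR R => ((u - c) / b)%R : measurableTypeR R).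
  by apply: measurable_funM => //; exact: measurable_funB.
have b1 : (0 <= b^-1)%R by rewrite invr_ge0 ltW.
pose mu : {measure set (measurableTypeR R) -> \bar R} :=
  mscale (NngNum b1) (mpush mf lebesgue_measure).
have : lebesgue_measure E = mu E.
  apply: lebesgue_measure_unique => // _ [[x y] _ <-].
  transitivity ((b^-1)%:E * lebesgue_measure ((fun u : R => ((u - c) / b)%R) @^-1` `]x, y])) => //.
  have -> : (fun u => ((u - c) / b)%R) @^-1` `]x, y] = `](c + b * x)%R, (c + b * y)%R]%classic.
    apply/seteqP; split=> u /=; rewrite !in_itv/= ltr_pdivlMr// ler_pdivrMr//;
      by rewrite ltrBrDl lerBlDl !(mulrC b).
  rewrite !lebesgue_measure_itv/= !lte_fin ltrD2l ltr_pM2l//.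
  case: ifPn => xy; last by rewrite mule0.
  by rewrite -!EFinB -EFinM; congr EFin; field; rewrite gt_eqF.
move=> ->; rewrite /mu /mscale/= muleA -EFinM divff ?gt_eqF// mul1e.
by [].
Qed.

Lemma unif_slot N (b : 'I_N -> R) i (E : set R) : (forall i, (0 <= b i)%R) ->
  (\sum_i b i)%R = 1%R -> measurable E ->
  unif [set u | slot b u = Some i /\ E (rescale b i u)] = (b i)%:E * unif E.
Proof.
move=> b0 b1 mE; have [bi|bi] := ltP 0%R (b i); last first.
  have -> : b i = 0%R by apply/eqP; rewrite eq_le bi b0.
  rewrite mul0e (_ : [set _ | _] = set0) ?measure0// -subset0 => u [/slot_pos] h _.
  by move: (h b0); rewrite ltNge bi.
rewrite /unif /mrestr -(lebesgue_affine (cum b i))//; last exact: measurableI.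
congr lebesgue_measure; apply/seteqP; split=> u /=; rewrite !in_itv/=.
  move=> [[si Eu] _]; split => //.
  exact/(slot_rescale b0 u bi).
move=> [Eu /(slot_rescale b0 u bi) si]; split => //.
exact: slot_in si.
Qed.

End uniform.

Section piecewise.
Context d d' (T : measurableType d) (T' : measurableType d').

Lemma measurable_piecewise (I : countType) (k : T -> I) (g : I -> T -> T') :
  (forall i, measurable [set z | k z = i]) ->
  (forall i, measurable_fun setT (g i)) -> measurable_fun setT (fun z => g (k z) z).
Proof.
move=> mk mg _ B mB; rewrite setTI.
rewrite (_ : _ @^-1` B = \bigcup_i ([set z | k z = i] `&` g i @^-1` B)).
  apply: countable_bigcupT_measurable; first exact: countableP.
  by move=> i; apply: measurableI => //; rewrite -[X in measurable X]setTI; exact: mg.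
by apply/seteqP; split=> [z Bz|z [i _ [/= <-]]]//; exists (k z).
Qed.

End piecewise.

Section markov_weights.
Variables (N0 : nat) (A : aperiodic_mx N0) (R : realType) (theta : R).
Hypothesis theta01 : 0 < theta < 1.
Variables (p : 'M[R]_N0) (q : 'rV[R]_N0) (m : probability (Sigma A theta) R).
Hypothesis hm : markov_measure p q m.
Local Notation X := (Sigma A theta).
Local Notation mL := (@unif R).
Local Notation cylX := (@cyl N0 A R theta).
Local Notation cylsX := (@cyls N0 A R theta).

Let mxpow_mxE n i j (P : 'M[R]_N0) : (P ^+ n.+1) i j = \sum_k P i k * (P ^+ n) k j.
Proof. by rewrite exprS mxE. Qed.

Lemma mxpow_ge0 n i j : 0 <= (p ^+ n) i j.
Proof.
elim: n i j => [|n ih] i j; first by rewrite expr0 mxE ler0n.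
by rewrite mxpow_mxE sumr_ge0// => k _; rewrite mulr_ge0// (markov_ge0 hm).
Qed.

Lemma mxpow_gt0 n i j : (0 < (tmx A ^+ n) i j)%N -> 0 < (p ^+ n) i j.
Proof.
elim: n i j => [|n ih] i j; first by rewrite !expr0 !mxE; case: (i == j) => //; rewrite ltr01.
rewrite exprS mxE => An; rewrite mxpow_mxE.
have [k Ak Ank] : exists2 k, A i k = 1%N & (0 < (tmx A ^+ n) k j)%N.
  apply: contrapT => h; move: An; rewrite big1// => k _.
  have [->|Aik] := tmx01 A i k; first by rewrite mul0r.
  have [->|Ank] := posnP ((tmx A ^+ n) k j); first by rewrite mulr0.
  by exfalso; apply: h; exists k.
rewrite (bigD1 k)//= ltr_pwDl//.
  by rewrite mulr_gt0 ?ih//; apply/(markov_supp hm).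
by rewrite sumr_ge0// => l _; rewrite mulr_ge0 ?(markov_ge0 hm)// mxpow_ge0.
Qed.

Lemma markov_stat_pow n : q *m (p ^+ n) = q.
Proof.
elim: n => [|n ih]; first by rewrite expr0 mulmx1.
by rewrite exprS -[p * _]/(p *m _) mulmxA (markov_stat hm).
Qed.

(** Some symbol has positive stationary probability, and aperiodicity carries its
   mass to every symbol in a fixed number of steps. *)
Lemma stat_gt0 j : 0 < q 0 j.
Proof.
have [n An] := tmx_aperiodic A.
have [i qi] : exists i, 0 < q 0 i.
  apply: contrapT => h; have := markov_stat_sum hm; rewrite big1 => [/eqP|i _].
    by rewrite eq_sym oner_eq0.
  apply/eqP; rewrite eq_le (markov_stat_ge0 hm) andbT leNgt; apply/negP => qi.
  by apply: h; exists i.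
rewrite -(markov_stat_pow n.+1) mxE (bigD1 i)//= ltr_pwDl//.
  by rewrite mulr_gt0// mxpow_gt0.
by rewrite sumr_ge0// => k _; rewrite mulr_ge0 ?(markov_stat_ge0 hm)// mxpow_ge0.
Qed.

(** The transition probabilities of the time-reversed chain. *)
Definition rev_weight (j i : 'I_N0) : R := q 0 i * p i j / q 0 j.

Lemma rev_weight_ge0 j i : 0 <= rev_weight j i.
Proof.
by rewrite /rev_weight divr_ge0 ?mulr_ge0 ?(markov_stat_ge0 hm) ?(markov_ge0 hm).
Qed.

Lemma rev_weight_sum j : \sum_i rev_weight j i = 1.
Proof.
rewrite /rev_weight -mulr_suml.
have -> : \sum_i q 0 i * p i j = q 0 j by rewrite -[in RHS](markov_stat hm) mxE.
by rewrite divff// gt_eqF// stat_gt0.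
Qed.

Lemma rev_weight_supp j i : 0 < rev_weight j i -> A i j = 1%N.
Proof.
move=> b0; apply/(markov_supp hm); rewrite lt_neqAle (markov_ge0 hm) andbT.
by apply/eqP => p0; move: b0; rewrite /rev_weight -p0 mulr0 mul0r ltxx.
Qed.

Definition slot_at (x : X) (u : R) : option 'I_N0 := slot (rev_weight (x 0%N)) u.

(** The inverse of the natural extension of the shift: the pieces of the unit
   interval choose the symbol to prepend, as in a baker map.  The points with [u] in
   no piece are kept; they form a null set. *)
Definition baker (z : X * measurableTypeR R) : X * measurableTypeR R :=
  if slot_at z.1 z.2 is Some i
  then (sft_cons i z.1 : X, rescale (rev_weight (z.1 0%N)) i z.2 : measurableTypeR R) else z.

Lemma measurable_slot j o :
  measurable ([set u | slot (rev_weight j) u = o] : set (measurableTypeR R)).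
Proof.
have ms i : measurable ([set u | slot (rev_weight j) u = Some i] : set (measurableTypeR R)).
  rewrite (_ : [set _ | _] = `[cum (rev_weight j) i, cum (rev_weight j) i.+1[%classic)//.
  apply/seteqP; split=> u /=; rewrite in_itv/= slotP//; exact: rev_weight_ge0.
case: o => [//|].
rewrite (_ : [set _ | _] = ~` \bigcup_i [set u | slot (rev_weight j) u = Some i]).
  apply: measurableC; apply: countable_bigcupT_measurable => //; exact: countableP.
apply/seteqP; split=> u /=; first by move=> uN [i _ /=]; rewrite uN.
by case E : slot => [i|]// h; exfalso; apply: h; exists i.
Qed.

Lemma measurable_baker : measurable_fun setT baker.
Proof.
pose k (z : X * measurableTypeR R) := (z.1 0%N, slot_at z.1 z.2).
pose g (i : 'I_N0 * option 'I_N0) (z : X * measurableTypeR R) : X * measurableTypeR R :=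
  if i.2 is Some l
  then (sft_cons l z.1 : X, rescale (rev_weight i.1) l z.2 : measurableTypeR R) else z.
have -> : baker = (fun z => g (k z) z) by [].
apply: measurable_piecewise => [[j o]|[j [l|]]].
- rewrite (_ : [set _ | _] = [set x : X | x 0%N = j] `*` [set u | slot (rev_weight j) u = o]).
    apply: measurableX; last exact: measurable_slot.
    exact: (measurable_head_set theta01 (fun i => i = j)).
  by apply/seteqP; split=> [[x u] [/= <- <-]|[x u] [/= <- <-]].
- rewrite /g/=; apply: measurable_fun_pair.
    by apply: measurableT_comp => //; exact: measurable_cons.
  rewrite /rescale; apply: measurable_funM => //; apply: measurable_funB => //.
- exact: measurable_id.
Qed.

Let mslot j i : measurable ([set u | slot (rev_weight j) u = Some i] : set (measurableTypeR R)).
Proof. exact: measurable_slot. Qed.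

Local Open Scope ereal_scope.

Lemma unif_noslot j : mL [set u | slot (rev_weight j) u = None] = 0.
Proof.
rewrite /unif /mrestr (_ : _ `&` _ = set0) ?measure0// -subset0 => u [/= uN].
rewrite in_itv/= => u01.
by have [i] := slot_total (rev_weight_ge0 j) (rev_weight_sum j) u01; rewrite uN.
Qed.

Lemma unif_slots j (V : set (measurableTypeR R)) : measurable V ->
  mL V = \sum_i mL (V `&` [set u | slot (rev_weight j) u = Some i]).
Proof.
move=> mV; pose S i := V `&` [set u | slot (rev_weight j) u = Some i].
have mS i : measurable (S i) by exact: measurableI.
rewrite -measure_bigsetU_ord//; last first.
  by move=> i i' _ _ [u [[_ /= ui] [_ /= ui']]]; apply/Some_inj; rewrite -ui.
rewrite -bigcup_seq; apply: (congr1 lebesgue_measure).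
apply/seteqP; split=> [u [Vu /= u01]|u [[i _ [Vu _]] u01]]//.
split => //; have [i ui] : exists i, slot (rev_weight j) u = Some i.
  apply: slot_total; last by move: u01; rewrite in_itv.
    exact: rev_weight_ge0.
  exact: rev_weight_sum.
by exists i; rewrite //= mem_index_enum.
Qed.

Lemma measurable_branch_sum (f : X -> \bar R) : measurable_fun setT f ->
  measurable_fun setT (fun x : X => \sum_i (rev_weight (x 0%N) i)%:E * f (sft_cons i x)).
Proof.
move=> mf; apply: emeasurable_sum => i; apply: emeasurable_funM.
  exact: (measurable_head theta01 (fun j => (rev_weight j i)%:E)).
by apply: measurableT_comp mf _; exact: measurable_cons.
Qed.

Definition prepend (x : X) (C : set X) : \bar R :=
  \sum_i (rev_weight (x 0%N) i)%:E * (\1_C (sft_cons i x : X))%:E.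

(** Given [x], the prepended symbol and the rescaled position are independent. *)
Lemma unif_baker x (C : set X) (E : set (measurableTypeR R)) : measurable C -> measurable E ->
  mL (xsection (baker @^-1` (C `*` E)) x) = prepend x C * mL E.
Proof.
move=> mC mE.
have mV : measurable (xsection (baker @^-1` (C `*` E)) x).
  apply: measurable_xsection; rewrite -[X in measurable X]setTI.
  by apply: measurable_baker => //; exact: measurableX.
rewrite (unif_slots (x 0%N) mV) /prepend ge0_sume_distrl; last first.
  by move=> i _; rewrite mule_ge0// lee_fin ?rev_weight_ge0// indicE.
apply: eq_bigr => i _.
have bE u : slot (rev_weight (x 0%N)) u = Some i ->
    xsection (baker @^-1` (C `*` E)) x u <->
    C (sft_cons i x) /\ E (rescale (rev_weight (x 0%N)) i u).
  by rewrite /xsection/= inE /baker/= /slot_at/= => ->.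
rewrite indicE; case: (asboolP (C (sft_cons i x))) => Ci.
  rewrite mem_set//= mule1 -unif_slot//; [|exact: rev_weight_ge0|exact: rev_weight_sum].
  congr (mL _); apply/seteqP; split=> u /=.
    by move=> [+ ui] => /(bE _ ui)[].
  by move=> [ui Eu]; split=> //; apply/(bE _ ui).
rewrite memNset//= mule0 mul0e (_ : _ `&` _ = set0) ?measure0// -subset0 => u /=.
by move=> [+ ui] => /(bE _ ui)[].
Qed.

Lemma measurable_baker_preimage D : measurable D -> measurable (baker @^-1` D).
Proof. by move=> mD; rewrite -[X in measurable X]setTI; exact: measurable_baker. Qed.

Lemma baker_rect C E : measurable C -> measurable E ->
  (m \x mL) (baker @^-1` (C `*` E)) = \int[m]_x prepend x C * mL E.
Proof.
move=> mC mE; rewrite /product_measure1/= -ge0_integralZr//.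
- by apply: eq_integral => x _; rewrite -unif_baker.
- apply: (measurable_branch_sum (f := EFin \o \1_C)).
  by apply/measurable_EFinP; exact: measurable_indic.
- by move=> x _; apply: sume_ge0 => i _; rewrite mule_ge0// lee_fin ?rev_weight_ge0// indicE.
Qed.

(** Only the first letter of the word can be prepended with success. *)
Lemma prepend_cyl n (w : nat -> 'I_N0) x :
  prepend x (cylX n.+1 w) =
  (rev_weight (w 1%N) (w 0%N))%:E * (\1_(cylX n (w \o S)) x)%:E.
Proof.
rewrite /prepend (bigD1 (w 0%N))//= big1 ?adde0 => [|i iw].
  have [b0|] := ltP 0%R (rev_weight (x 0%N) (w 0%N)).
    have Ax := rev_weight_supp b0.
    rewrite !indicE; case: (asboolP (cylX n (w \o S) x)) => xw.
      rewrite (xw 0%N)//= !mem_set// => -[|k] kn; first by rewrite sft_consE.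
      by rewrite sft_consE// xw.
    rewrite !memNset ?mule0// => xw'; apply: xw => k kn.
    by have := xw' k.+1 kn; rewrite sft_consE.
  move=> b0; have {}b0 : rev_weight (x 0%N) (w 0%N) = 0%R.
    by apply/eqP; rewrite eq_le b0 rev_weight_ge0.
  rewrite b0 mul0e indicE; case: (asboolP (cylX n (w \o S) x)) => xw.
    have xw0 : x 0%N = w 1%N := xw 0%N isT.
    by rewrite -xw0 b0 mul0e.
  by rewrite memNset// mule0.
have [b0|] := ltP 0%R (rev_weight (x 0%N) i); last first.
  move=> b0; rewrite (_ : rev_weight _ _ = 0%R) ?mul0e//.
  by apply/eqP; rewrite eq_le b0 rev_weight_ge0.
rewrite indicE memNset ?mule0// => /(_ 0%N isT).
by rewrite sft_consE; [move/eqP; rewrite (negbTE iw)|exact: rev_weight_supp b0].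
Qed.

(** On cylinders this is how the reversed chain is made: the weight [q_i p_ij / q_j]
   turns the stationary factor [q_j] of the shifted word into [q_i p_ij]. *)
Lemma markov_prepend_cyls C : cylsX C -> \int[m]_x prepend x C = m C.
Proof.
move=> [->|[->|[n [w ->]]]].
- rewrite measure0 integral0_eq// => x _.
  by rewrite /prepend big1// => i _; rewrite indicE in_set0 mule0.
- rewrite -[RHS]mul1e -[in RHS]integral_cst//; apply: eq_integral => x _.
  have -> : cst 1 x = (\sum_i rev_weight (x 0%N) i)%:E by rewrite rev_weight_sum.
  rewrite /prepend -sumEFin; apply: eq_bigr => i _.
  by rewrite indicE in_setT mule1.
- under eq_integral do rewrite prepend_cyl.
  rewrite ge0_integralZl//; last 2 first.
  + by apply/measurable_EFinP; apply: measurable_indic; exact: measurable_cyl.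
  + by rewrite lee_fin rev_weight_ge0.
  rewrite integral_indic ?setIT//; last exact: measurable_cyl.
  have cylE k v : m (cylX k v) = (q 0 (v 0%N) * \prod_(i < k) p (v i) (v i.+1))%R%:E.
    exact: (markov_cylinder hm).
  rewrite [X in _ * X](cylE n (w \o S)) [RHS](cylE n.+1 w) -EFinM big_ord_recl/=.
  rewrite /rev_weight; congr EFin.
  transitivity (q 0 (w 0%N) *
    (p (w 0%N) (w 1%N) * \prod_(i < n) p (w i.+1) (w i.+2)))%R; last by [].
  by rewrite /=; field; rewrite gt_eqF// stat_gt0.
Qed.

(** Both sides are probabilities in [C], the left one being a marginal of the image
   of the baker map, so that cylinders determine them. *)
Lemma markov_prepend C : measurable C -> \int[m]_x prepend x C = m C.
Proof.
move=> mC.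
pose mu : {measure set X -> \bar R} :=
  mpush (measurableT_comp measurable_fst measurable_baker) (m \x mL).
have muE D : measurable D -> mu D = \int[m]_x prepend x D.
  move=> mD; rewrite -[RHS]mule1 -[X in _ * X](@probability_setT _ _ _ mL) -baker_rect//.
  congr ((m \x mL) _); apply/seteqP; split=> z //= [].
  by [].
rewrite -muE//; apply/esym; apply: (measure_unique cylsX (fun=> setT)) => //.
- exact: cyls_generate.
- exact: cyls_setI.
- by move=> _; right; left.
- by rewrite bigcup_const.
- move=> D cD; have mD : measurable D.
    by rewrite (cyls_generate A theta01); exact: sub_sigma_algebra.
  by rewrite muE// markov_prepend_cyls.
- by move=> _; rewrite ltey_eq fin_num_measure.
Qed.

Lemma baker_preserving D : measurable D -> (m \x mL) (baker @^-1` D) = (m \x mL) D.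
Proof.
move=> mD; apply/esym.
pose mu := mpush measurable_baker (m \x mL).
rewrite (product_measure_unique (m' := mu))// => C E mC mE.
by rewrite [LHS]baker_rect// markov_prepend.
Qed.

(** Invariance under the baker map, for a function of the first coordinate: the
   integral over [u] is the sum over the pieces. *)
Lemma ge0_markov_transfer (f : X -> \bar R) : measurable_fun setT f -> (forall x, 0 <= f x) ->
  \int[m]_x (\sum_i (rev_weight (x 0%N) i)%:E * f (sft_cons i x)) = \int[m]_x f x.
Proof.
move=> mf f0.
pose mu : {measure set X -> \bar R} :=
  mpush (measurableT_comp measurable_fst measurable_baker) (m \x mL).
have -> : \int[m]_x f x = \int[mu]_x f x.
  apply: eq_measure_integral => D mD _.
  rewrite [RHS](_ : _ = (m \x mL) (D `*` setT)).
    transitivity (m D * mL setT); last by rewrite product_measure1E.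
    by rewrite (_ : mL setT = 1) ?mule1//; exact: probability_setT.
  rewrite -baker_preserving; last exact: measurableX.
  by congr ((m \x mL) _); apply/seteqP; split=> z //= [].
have mphi := measurableT_comp measurable_fst measurable_baker.
have f0' : {in (setT : set X), forall y, 0 <= f y} by move=> y _; exact: f0.
rewrite [RHS](ge0_integral_pushforward mphi (m \x mL) measurableT mf f0').
rewrite preimage_setT fubini_tonelli1//; last 2 first.
- exact: measurableT_comp mf mphi.
- by move=> z; exact: f0.
apply: eq_integral => x _; rewrite /fubini_F/=.
pose D i : set (measurableTypeR R) := [set u | slot (rev_weight (x 0%N)) u = Some i].
have mD i : measurable (D i) by exact: mslot.
have m1D i : measurable_fun setT (fun u => (\1_(D i) u)%:E : \bar R).
  by apply/measurable_EFinP; exact: measurable_indic.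
transitivity (\int[mL]_u (\sum_i (f (sft_cons i x) * (\1_(D i) u)%:E))).
  rewrite ge0_integral_sum//; last 2 first.
  - by move=> i; apply: emeasurable_funM; [exact: measurable_cst|exact: m1D].
  - by move=> i u _; rewrite mule_ge0// lee_fin indicE.
  apply: eq_bigr => i _; rewrite ge0_integralZl//.
  rewrite integral_indic// setIT muleC; congr (_ * _).
  have := unif_slot i (rev_weight_ge0 (x 0%N)) (rev_weight_sum (x 0%N))
    (measurableT : measurable (setT : set (measurableTypeR R))).
  rewrite probability_setT mule1 => <-; congr (mL _).
  by apply/seteqP; split=> u //= [].
apply: ae_eq_integral => //.
- by apply: emeasurable_sum => i; apply: emeasurable_funM; [exact: measurable_cst|exact: m1D].
- apply: measurableT_comp mf _; apply: measurableT_comp measurable_fst _.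
  by apply: measurableT_comp measurable_baker _; exact: measurable_pair1.
- exists [set u | slot (rev_weight (x 0%N)) u = None]; split; first exact: measurable_slot.
    exact: unif_noslot.
  move=> u /= h; case E : slot => [i|]//; exfalso; apply: h => _.
  rewrite /baker/= /slot_at/= E (bigD1 i)//= big1 ?adde0 => [|k ki].
    by rewrite indicE mem_set// mule1.
  rewrite indicE memNset ?mule0// /D/= E => -[ik].
  by move: ki; rewrite ik eqxx.
Qed.

Definition branch_sum (g : X -> R) (x : X) : R :=
  (\sum_i rev_weight (x 0%N) i * g (sft_cons i x))%R.

Let branch_sumE g x : (branch_sum g x)%:E =
  \sum_i (rev_weight (x 0%N) i)%:E * (EFin \o g) (sft_cons i x).
Proof. by rewrite /branch_sum -sumEFin. Qed.

Let ge0_branch_sum (g : X -> R) : (forall x, 0 <= g x)%R -> m.-integrable setT (EFin \o g) ->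
  m.-integrable setT (EFin \o branch_sum g) /\
  \int[m]_x (branch_sum g x)%:E = \int[m]_x (g x)%:E.
Proof.
move=> g0 ig; have mg := measurable_int _ ig.
have e : \int[m]_x (branch_sum g x)%:E = \int[m]_x (g x)%:E.
  under eq_integral do rewrite branch_sumE.
  by rewrite ge0_markov_transfer// => x; rewrite lee_fin.
split=> //; apply/integrableP; split.
  rewrite (_ : _ \o _ = fun x : X => \sum_i (rev_weight (x 0%N) i)%:E * (EFin \o g) (sft_cons i x)).
    exact: measurable_branch_sum.
  by apply/funext => x; rewrite /= branch_sumE.
under eq_integral => x _.
  rewrite gee0_abs; last by rewrite lee_fin sumr_ge0// => i _; rewrite mulr_ge0 ?rev_weight_ge0.
  over.
rewrite e; move/integrableP : ig => [_]; congr (_ < _).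
by apply: eq_integral => x _; rewrite /= ger0_norm.
Qed.

(** [branch_sum] is the conditional expectation given the shifted sequence.  The
   nonnegative case [ge0_branch_sum] applies to [|g| + g] and [|g|]. *)
Lemma branch_sum_integral (g : X -> R) : m.-integrable setT (EFin \o g) ->
  m.-integrable setT (EFin \o branch_sum g) /\
  \int[m]_x (branch_sum g x)%:E = \int[m]_x (g x)%:E.
Proof.
move=> ig; pose h1 x := `|g x|%R; pose h2 x := (`|g x| + g x)%R.
have i1 : m.-integrable setT (EFin \o h1) by exact: integrable_abse ig.
have i2 : m.-integrable setT (EFin \o h2) by exact: integrableD i1 ig.
have h10 x : (0 <= h1 x)%R by exact: normr_ge0.
have h20 x : (0 <= h2 x)%R by rewrite /h2 -lerBlDr sub0r -normrN ler_norm.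
have [j1 e1] := ge0_branch_sum h10 i1; have [j2 e2] := ge0_branch_sum h20 i2.
have E x : (branch_sum g x)%:E = (EFin \o branch_sum h2) x - (EFin \o branch_sum h1) x.
  rewrite /= -EFinB; congr EFin; rewrite /branch_sum -sumrB; apply: eq_bigr => i _.
  by rewrite -mulrBr /h2 /h1 addrAC subrr add0r.
split.
  rewrite (_ : EFin \o branch_sum g = (EFin \o branch_sum h2) \- (EFin \o branch_sum h1)).
    exact: integrableB.
  by apply/funext => x; exact: E.
under eq_integral do rewrite E.
rewrite integralB//= e1 e2 -integralB//; apply: eq_integral => x _.
by rewrite -EFinB; congr EFin; rewrite /h2 /h1 addrAC subrr add0r.
Qed.

(** The inverse branches of positive weight pull null sets back to null sets,
   because the weighted sum of the indicators has the same integral. *)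
Lemma markov_ae_branch (Q : X -> Prop) : {ae m, forall x : X, Q x} ->
  {ae m, forall (x : X) i, (0 < rev_weight (x 0%N) i)%R -> Q (sft_cons i x : X)}.
Proof.
move=> [Z [mZ Z0 ZQ]].
have mp : measurable_fun setT (fun x => prepend x Z).
  apply: (measurable_branch_sum (f := EFin \o \1_Z)).
  by apply/measurable_EFinP; exact: measurable_indic.
have p0 (x : X) i : 0 <= (rev_weight (x 0%N) i)%:E * (\1_Z (sft_cons i x : X))%:E.
  by rewrite mule_ge0// lee_fin ?rev_weight_ge0// indicE.
have : \int[m]_x `|prepend x Z| = 0.
  rewrite -Z0 -markov_prepend//; apply: eq_integral => x _; rewrite gee0_abs//.
  by apply: sume_ge0 => i _; exact: p0.
move=> /(ae_eq_integral_abs m measurableT mp); apply: filterS => x /(_ Logic.I) /= h i b0.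
apply: contrapT => nQ; have Zi : Z (sft_cons i x) by exact: ZQ.
have : (rev_weight (x 0%N) i)%:E <= prepend x Z.
  rewrite /prepend (bigD1 i)//= indicE mem_set// mule1 leeDl//.
  by apply: sume_ge0 => k _; exact: p0.
by rewrite h lee_fin leNgt b0.
Qed.

End markov_weights.

(** * The norms in terms of signed disintegrations *)

Section smeasure_sum.
Context d (T : measurableType d) (R : realType).

Lemma smeasure_sumE (I : finType) (c : I -> R) (nu : I -> smeasure T R) E : measurable E ->
  (\sum_i c i *: nu i : smeasure T R) E = (\sum_i c i * fine (nu i E))%:E.
Proof.
move=> mE; elim/big_rec2: _ => [|i r s _ ih]; first by rewrite smeasure_ofE.
by rewrite smeasureDE// smeasureZE// ih (smeasure_fin _ mE).
Qed.

Lemma charge_integral_sum (I : finType) (c : I -> R) (nu : I -> smeasure T R) g :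
  bounded_meas g ->
  charge_integral (\sum_i c i *: nu i : smeasure T R) g = \sum_i c i * charge_integral (nu i) g.
Proof.
move=> bg; elim/big_rec2: _ => [|i r s _ ih]; last by rewrite charge_integral_lin// ih.
by have := charge_integralZ 0 (0 : smeasure T R) bg; rewrite scale0r mul0r.
Qed.

End smeasure_sum.

(** Branches of weight zero are excluded from the bound: the prepended sequence
   is then not admissible and nothing is known on its leaf. *)
Lemma normW_convex (R : realType) (K : pmetricType R) (I : finType) (b : I -> R)
    (nu : I -> smeasure (borel K) R) a :
  (forall i, 0 <= b i) -> \sum_i b i = 1 ->
  (forall i, 0 < b i -> (normW (nu i) <= a%:E)%E) ->
  (normW (\sum_i b i *: nu i : smeasure (borel K) R)%R <= a%:E)%E.
Proof.
move=> b0 b1 nua; apply/normW_leP => g gt.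
rewrite charge_integral_sum; last exact: wtest_bounded.
rewrite -[leRHS]mul1r -b1 mulr_suml; apply: le_trans (ler_norm_sum _ _ _) _.
apply: ler_sum => i _; rewrite normrM (ger0_norm (b0 i)).
have [bi|bi] := ltP 0 (b i); first by rewrite ler_wpM2l//; exact: (normW_leP _ _).1 (nua _ bi) _ gt.
by rewrite (_ : b i = 0) ?mul0r//; apply/eqP; rewrite eq_le bi b0.
Qed.

Lemma normW_ge0e (R : realType) (K : pmetricType R) (nu : smeasure (borel K) R) :
  (0 <= normW nu)%E.
Proof.
apply: (@le_trans _ _ `|charge_integral nu (cst 0)|%:E); first by rewrite lee_fin.
apply: ereal_sup_ubound; exists (cst 0) => //.
by split=> [y z|y]; rewrite ?subrr normr0 ?mdist_ge0.
Qed.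

Section regular.
Variables (N0 : nat) (A : aperiodic_mx N0) (R : realType) (theta : R).
Hypothesis theta01 : 0 < theta < 1.
Variables (K : pmetricType R) (cK : compact [set: K]).
Local Notation X := (Sigma A theta).
Local Notation XK := (Sigma A theta * borel K)%type.
Variable m : probability X R.
Implicit Types (mu : smeasure XK R) (kap : X -> smeasure XK R) (phi : sft A -> R).

Definition fiber (nu : smeasure XK R) : smeasure (borel K) R := spush measurable_snd nu.

Definition lipschitz_sft phi (C : R) :=
  forall x y, `|phi x - phi y| <= C * dtheta theta x y.

(** The data that bound the norm of [Sinf].  Contrary to that norm, which is an
   infimum over pairs of disintegrations, they pass explicitly through linear
   combinations and through the transfer operator. *)
Record regular mu kap phi (a : R) : Prop := {
  regular_fibred : fibred m mu kap;
  regular_normW : {ae m, forall x : X, (normW (fiber (kap x)) <= a%:E)%E};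
  regular_density : {ae m, forall x : X, kap x setT = (phi x)%:E} }.

Lemma regular_ge0 mu kap phi a : regular mu kap phi a -> 0 <= a.
Proof.
move=> [_ nW _]; have m0 : (0 < m setT)%E by rewrite probability_setT lte01.
have : ProperFilter (almost_everywhere m) by exact: ae_properfilter_algebraOfSetsType.
by move=> FF; have [x /normW_ge0] := filter_ex nW.
Qed.

Lemma regular_lin c mu mu' kap kap' phi phi' a a' :
  regular mu kap phi a -> regular mu' kap' phi' a' ->
  regular (c *: mu + mu') (fun x => c *: kap x + kap' x)
    (fun x => c * phi x + phi' x) (`|c| * a + a').
Proof.
move=> [f n p] [f' n' p']; split; first exact: fibred_lin.
- apply: filterS2 n n' => x nx nx'; rewrite /fiber spush_lin; exact: normW_lin.
- by apply: filterS2 p p' => x px px'; rewrite smeasureDE// smeasureZE// px px'.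
Qed.

(** [leaf] before projection to [K], which [fibred] can express; it is written as
   an instance of [fibred_lin]. *)
Definition joint_leaf mu (kp kn : X -> probability XK R) (x : X) : smeasure XK R :=
  -1 *: (fine (phi1 m (smeasure_of_measure (neg_part mu)) x) *: smeasure_of_measure (kn x)) +
  fine (phi1 m (smeasure_of_measure (pos_part mu)) x) *: smeasure_of_measure (kp x).

Lemma fiber_joint_leaf mu kp kn x : fiber (joint_leaf mu kp kn x) = leaf m mu kp kn x.
Proof.
have spushZ a (nu : smeasure XK R) : fiber (a *: nu) = a *: fiber nu.
  apply: smeasure_eq => E mE; rewrite /fiber spushE// !smeasureZE ?spushE//.
  by rewrite -[X in measurable X]setTI; exact: measurable_snd.
rewrite /joint_leaf /fiber spush_lin -!/(fiber _) !spushZ addrC scaleN1r.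
by [].
Qed.

Lemma disintegrations_fibred mu kp kn : AB m mu ->
  disintegration m (pos_part mu) kp -> disintegration m (neg_part mu) kn ->
  fibred m mu (joint_leaf mu kp kn).
Proof.
move=> [dp dn] hp hn.
have dom (nu : {finite_measure set XK -> \bar R}) : mpush measurable_fst nu `<< m ->
    marginal (smeasure_of_measure nu) `<< m.
  move=> /null_content_dominatesP h; apply/null_content_dominatesP => B mB B0.
  rewrite -[RHS](h B mB B0) /marginal spushE// smeasure_of_measureE//.
  by rewrite -[X in measurable X]setTI; exact: measurable_fst.
have fp := disintegration_fibred theta01 (dom _ dp) hp.
have fn := disintegration_fibred theta01 (dom _ dn) hn.
have := fibred_lin (-1) fn fp.
rewrite (_ : -1 *: _ + _ = mu)//; apply: smeasure_eq => E mE.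
rewrite smeasureDE// smeasureZE// !smeasure_of_measureE// (jordanE mu mE).
by rewrite addeC mulN1e.
Qed.

(** A signed disintegration yields disintegrations of the Jordan parts, and by
   uniqueness their leaves have the given difference. *)
Lemma fibred_norm_Linf mu kap (a : \bar R) : fibred m mu kap ->
  {ae m, forall x : X, (normW (fiber (kap x)) <= a)%E} -> (norm_Linf m mu <= a)%E.
Proof.
move=> mk nW.
have [kapp /(fibred_disintegration theta01 cK)[kp dp]] := fibred_pos mk.
have [kapn /(fibred_disintegration theta01 cK)[kn dn]] := fibred_neg mk.
have fk := disintegrations_fibred (fibred_AB mk) dp dn.
apply: le_trans (ereal_inf_lbound _) _; first by exists (kp, kn).
apply/ess_supP; apply: filterS2 nW (fibred_uniq cK fk mk) => x nx kx.
suff : (normW (leaf m mu kp kn x) <= a)%E by [].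
by rewrite -fiber_joint_leaf kx.
Qed.

Lemma Linf_fibred mu a : AB m mu -> (norm_Linf m mu < a%:E)%E ->
  exists2 kap, fibred m mu kap & {ae m, forall x : X, (normW (fiber (kap x)) <= a%:E)%E}.
Proof.
move=> ABmu /ereal_inf_lt[_ [[kp kn] [dp dn] <-]] /ltW/ess_supP nW.
exists (joint_leaf mu kp kn); first exact: disintegrations_fibred.
by apply: filterS nW => x nx; rewrite fiber_joint_leaf.
Qed.

Lemma norm_Linf_ge0 mu : (0 <= norm_Linf m mu)%E.
Proof.
have m0 : (0 < m setT)%E by rewrite probability_setT lte01.
apply: le_ereal_inf_tmp => _ [[kp kn] _ <-]; apply: ess_sup_gee => //.
by apply: nearW => x; exact: normW_ge0e.
Qed.

Lemma norm_sup_ge0 phi : (0 <= norm_sup phi)%E.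
Proof.
apply: (@le_trans _ _ `|phi point|%:E); first by rewrite lee_fin.
by apply: ereal_sup_ubound; exists point.
Qed.

Lemma lip_theta_ge0 phi : (0 <= lip_theta theta phi)%E.
Proof. by apply: le_ereal_inf_tmp => _ [C [C0 _] <-]; rewrite lee_fin. Qed.

Lemma lip_theta_le phi C : 0 <= C -> lipschitz_sft phi C -> (lip_theta theta phi <= C%:E)%E.
Proof. by move=> C0 hC; apply: ereal_inf_lbound; exists C. Qed.

Lemma regular_norm mu kap phi a S C : regular mu kap phi a ->
  (forall x, `|phi x| <= S) -> 0 <= C -> lipschitz_sft phi C ->
  (norm_Sinf m mu <= (S + C + a)%:E)%E.
Proof.
move=> [f n p] phiS C0 phiC; rewrite /norm_Sinf EFinD; apply: leeD.
  apply: (@le_trans _ _ (norm_theta theta phi)).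
    by apply: ereal_inf_lbound; exists phi => //; apply: filterS2 p (fibred_phi1 f) => x -> ->.
  rewrite /norm_theta EFinD; apply: leeD; last exact: lip_theta_le.
  by apply: ge_ereal_sup => _ [x _ <-]; rewrite lee_fin.
exact: fibred_norm_Linf n.
Qed.

Lemma regular_Sinf mu kap phi a C : regular mu kap phi a ->
  0 <= C -> lipschitz_sft phi C -> Sinf m mu.
Proof.
move=> [f n p] C0 phiC; split.
  split; first exact: fibred_AB f.
  by apply: le_lt_trans (fibred_norm_Linf f n) _; rewrite ltry.
exists phi; split; first by apply: filterS2 p (fibred_phi1 f) => x -> ->.
by apply: le_lt_trans (lip_theta_le C0 phiC) _; rewrite ltry.
Qed.

(** The norm is assembled from three infima, over the versions of the density, its
   Lipschitz constants and the pairs of disintegrations; each of them is approached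
   within [e / 3]. *)
Lemma Sinf_regular mu e : Sinf m mu -> 0 < e -> exists kap phi a S C,
  [/\ regular mu kap phi a, forall x, `|phi x| <= S, 0 <= C, lipschitz_sft phi C &
     ((S + C + a)%:E <= norm_Sinf m mu + e%:E)%E].
Proof.
move=> [[ABmu nL] [phi0 [v0 lip0]]] e0.
have e3 : 0 < e / 3 by rewrite divr_gt0.
have nphi0 : (0 <= norm_phi1 m mu)%E.
  apply: le_ereal_inf_tmp => _ [phi _ <-].
  by rewrite adde_ge0 ?norm_sup_ge0 ?lip_theta_ge0.
have nphi : (norm_phi1 m mu < +oo)%E.
  apply: (@le_lt_trans _ _ (norm_theta theta phi0)).
    by apply: ereal_inf_lbound; exists phi0.
  rewrite /norm_theta lte_add_pinfty//.
  have [_ [C [C0 hC] <-] _] := ereal_inf_lt lip0.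
  apply: (@le_lt_trans _ _ (`|phi0 point| + C * (1 - theta)^-1)%:E); last exact: ltry.
  apply: ge_ereal_sup => _ [x _ <-]; rewrite lee_fin.
  rewrite -[phi0 x](subrK (phi0 point)) addrC; apply: le_trans (ler_normD _ _) _.
  rewrite lerD2l; apply: le_trans (hC _ _) _.
  by rewrite ler_wpM2l// dtheta_le.
have fphi : norm_phi1 m mu \is a fin_num by rewrite ge0_fin_numE.
have fL : norm_Linf m mu \is a fin_num by rewrite ge0_fin_numE// norm_Linf_ge0.
have [kap f n] : exists2 kap, fibred m mu kap &
    {ae m, forall x : X, (normW (fiber (kap x)) <= (fine (norm_Linf m mu) + e / 3)%:E)%E}.
  apply: Linf_fibred => //; rewrite EFinD fineK// lteDl// lte_fin//.
have : (norm_phi1 m mu < norm_phi1 m mu + (e / 3)%:E)%E by rewrite lteDl// lte_fin.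
move=> /ereal_inf_lt[_ [phi vphi <-]].
have s0 := norm_sup_ge0 phi; have l0 := lip_theta_ge0 phi.
rewrite -(fineK fphi) -EFinD /norm_theta => sl.
have fs : norm_sup phi \is a fin_num.
  rewrite ge0_fin_numE//; apply: le_lt_trans (ltry _); apply: le_trans (ltW sl).
  by rewrite leeDl.
have fl : lip_theta theta phi \is a fin_num.
  rewrite ge0_fin_numE//; apply: le_lt_trans (ltry _); apply: le_trans (ltW sl).
  by rewrite leeDr.
have : (lip_theta theta phi < lip_theta theta phi + (e / 3)%:E)%E by rewrite lteDl// lte_fin.
move=> /ereal_inf_lt[_ [C [C0 hC] <-]].
move: sl; rewrite -(fineK fs) -(fineK fl) -!EFinD !lte_fin => sl Cl.
exists kap, phi, (fine (norm_Linf m mu) + e / 3), (fine (norm_sup phi)), C; split => //.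
- split => //; apply: filterS2 vphi (fibred_phi1 f) => x v1 v2.
  by rewrite -v2 v1.
- by move=> x; rewrite -lee_fin fineK//; apply: ereal_sup_ubound; exists x.
- rewrite /norm_Sinf -(fineK fphi) -(fineK fL) -!EFinD lee_fin; lra.
Qed.

End regular.

(** * The transfer operator on disintegrations *)

Section transfer.
Variables (N0 : nat) (A : aperiodic_mx N0) (R : realType) (theta : R).
Hypothesis theta01 : 0 < theta < 1.
Variables (p : 'M[R]_N0) (q : 'rV[R]_N0) (m : probability (Sigma A theta) R).
Hypothesis hm : markov_measure p q m.
Variables (K : pmetricType R).
Local Notation X := (Sigma A theta).
Local Notation XK := (Sigma A theta * borel K)%type.
Variables (G : XK -> borel K) (mG : measurable_fun setT G).
Local Notation F := (transfer theta01 mG).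
Local Notation weight := (rev_weight p q).
Implicit Types (mu nu : smeasure XK R) (kap : X -> smeasure XK R).

Lemma transferE nu E : measurable E -> F nu E = nu (skew G @^-1` E).
Proof. exact: spushE. Qed.

Lemma transfer_lin a mu nu : F (a *: mu + nu) = a *: F mu + F nu.
Proof. exact: spush_lin. Qed.

Lemma measurable_skew_preimage E : measurable E -> measurable (skew G @^-1` E).
Proof.
move=> mE; rewrite -[X in measurable X]setTI.
by have := measurable_skew theta01 mG; exact.
Qed.

Lemma transferT nu : F nu setT = nu setT.
Proof. by rewrite transferE. Qed.

(** The fibre of the skew product over [x] consists of the leaves over the
   preimages of [x] under the shift, weighted by their conditional probabilities. *)
Definition branch_kernel kap (x : X) : smeasure XK R :=
  \sum_i weight (x 0%N) i *: F (kap (sft_cons i x : X)).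

Lemma branch_kernelE kap x E : measurable E ->
  branch_kernel kap x E = (branch_sum p q (fun z : X => fine (kap z (skew G @^-1` E))) x)%:E.
Proof.
move=> mE; rewrite /branch_kernel smeasure_sumE//.
by congr EFin; apply: eq_bigr => i _; rewrite transferE.
Qed.

Lemma on_leaf_transfer i (x : X) nu : A i (x 0%N) = 1%N ->
  on_leaf (sft_cons i x : X) nu -> on_leaf x (F nu).
Proof.
move=> Ai lx E mE xE; rewrite transferE// lx//; first exact: measurable_skew_preimage.
by move=> y; rewrite /preimage/= /skew/= sft_consK//; exact: xE.
Qed.

Lemma fibred_transfer mu kap : fibred m mu kap -> fibred m (F mu) (branch_kernel kap).
Proof.
move=> [i l e]; have h E : measurable E ->
    m.-integrable setT (EFin \o (fun z : X => fine (kap z (skew G @^-1` E)))).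
  move=> mE; have mE' := measurable_skew_preimage mE.
  rewrite (_ : _ \o _ = fun z => kap z (skew G @^-1` E)); first exact: i.
  by apply/funext => z; rewrite /= -smeasure_fin.
split.
- move=> E mE; rewrite (_ : (fun x => _) =
    (EFin \o branch_sum p q (fun z : X => fine (kap z (skew G @^-1` E))))).
    exact: (branch_sum_integral theta01 hm (h _ mE)).1.
  by apply/funext => x; rewrite branch_kernelE.
- apply: filterS (markov_ae_branch theta01 hm l) => x lx E mE xE.
  rewrite /branch_kernel smeasure_sumE// big1// => j _.
  have [b0|b0] := ltP 0 (weight (x 0%N) j).
    rewrite (@on_leaf_transfer j x) ?mulr0//; last exact: lx.
    exact: (rev_weight_supp hm b0).
  rewrite (_ : weight _ _ = 0) ?mul0r//; apply/eqP; rewrite eq_le b0.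
  exact: (rev_weight_ge0 hm).
- move=> E mE; have mE' := measurable_skew_preimage mE.
  under eq_integral do rewrite branch_kernelE//.
  rewrite (branch_sum_integral theta01 hm (h _ mE)).2 transferE// e//.
  by apply: eq_integral => x _; rewrite -smeasure_fin.
Qed.

Lemma measurable_fiber_map z : measurable_fun setT (fun y : borel K => G (z, y)).
Proof. by apply: measurableT_comp mG _; exact: measurable_pair1. Qed.

(** On one leaf the skew product is the fibre map [G (z, _)]. *)
Lemma fiber_transfer z nu : on_leaf z nu ->
  fiber (F nu) = spush (measurable_fiber_map z) (fiber nu).
Proof.
move=> lz; apply: smeasure_eq => E mE.
have msnd (B : set (borel K)) : measurable B -> measurable (snd @^-1` B : set XK).
  by move=> mB; rewrite -[X in measurable X]setTI; exact: measurable_snd.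
have mGz : measurable ((fun y : borel K => G (z, y)) @^-1` E).
  by rewrite -[X in measurable X]setTI; exact: measurable_fiber_map.
rewrite /fiber !spushE//; last exact: msnd.
rewrite (on_leaf_xsection lz); last first.
  by apply: measurable_skew_preimage; exact: msnd.
congr (nu _); apply/seteqP; split=> [[x y] [_ /xsectionP]|[x y] /= Gy]//.
by split=> //; apply/xsectionP.
Qed.

Lemma fiber_mass nu : fiber nu setT = nu setT.
Proof. by rewrite /fiber spushE// preimage_setT. Qed.

Variables (cK : compact [set: K]) (diamK : diam K = 1%E).
Variables (alpha : R) (alpha01 : 0 < alpha < 1).
Hypothesis contr : {ae m, forall x, forall y1 y2 : K,
  mdist (G (x, y1) : K) (G (x, y2)) <= alpha * mdist y1 y2}.

Lemma diam_le1 (y z : K) : mdist y z <= 1.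
Proof. by rewrite -lee_fin -diamK; apply: ereal_sup_ubound; exists (y, z). Qed.

Lemma fiber_sum (I : finType) (c : I -> R) (nu : I -> smeasure XK R) :
  fiber (\sum_i c i *: nu i) = \sum_i c i *: fiber (nu i).
Proof.
have mT E : measurable E -> measurable (snd @^-1` E : set XK).
  by move=> mE; rewrite -[X in measurable X]setTI; exact: measurable_snd.
apply: smeasure_eq => E mE; rewrite /fiber spushE// !smeasure_sumE//; last exact: mT.
by congr EFin; apply: eq_bigr => i _; rewrite spushE.
Qed.

(** Lasota-Yorke inequality: on each leaf the fibre map contracts the weak norm up
   to the mass of the leaf, which the density bounds, and the average over the
   inverse branches preserves bounds. *)
Lemma regular_transfer mu kap phi a s : regular m mu kap phi a ->
  (forall x, `|phi x| <= s) ->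
  regular m (F mu) (branch_kernel kap) (branch_sum p q (phi : X -> R)) (alpha * a + s).
Proof.
move=> [f n d] phis; have [al0 al1] := andP alpha01.
have [_ l _] := f.
split; first exact: fibred_transfer.
- have h4 : {ae m, forall z : X, [/\ (normW (fiber (kap z)) <= a%:E)%E,
      kap z setT = (phi z)%:E, on_leaf z (kap z) & forall y1 y2 : K,
      mdist (G (z, y1) : K) (G (z, y2)) <= alpha * mdist y1 y2]}.
    by apply: filterS2 (filterI n d) (filterI l contr) => z [? ?] [? ?]; split.
  apply: filterS (markov_ae_branch theta01 hm h4) => x hx; rewrite /branch_kernel fiber_sum.
  apply: normW_convex => [i||i bi].
  + exact: (rev_weight_ge0 hm).
  + exact: (rev_weight_sum hm).
  + have [nx dx lx cx] := hx i bi.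
    rewrite (fiber_transfer lx).
    apply: le_trans (normW_contraction (measurable_fiber_map _) diam_le1 al0 cx nx) _.
    by rewrite lee_fin lerD2l fiber_mass dx/=.
- apply: filterS (markov_ae_branch theta01 hm d) => x dx.
  rewrite branch_kernelE// preimage_setT; congr EFin; apply: eq_bigr => i _.
  have [b0|b0] := ltP 0 (weight (x 0%N) i); first by rewrite dx.
  rewrite (_ : weight _ _ = 0) ?mul0r//; apply/eqP; rewrite eq_le b0.
  exact: (rev_weight_ge0 hm).
Qed.

End transfer.

(** * Spectral gap on the densities *)

Section spectral_gap.
Variables (N0 : nat) (A : aperiodic_mx N0) (R : realType) (theta : R).
Hypothesis theta01 : 0 < theta < 1.
Variables (p : 'M[R]_N0) (q : 'rV[R]_N0) (m : probability (Sigma A theta) R).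
Hypothesis hm : markov_measure p q m.
Local Notation X := (Sigma A theta).
Local Notation weight := (rev_weight p q).
Local Notation dist := (@dtheta N0 A R theta).
Local Notation L := (branch_sum p q : (X -> R) -> X -> R).
Implicit Types (phi psi : X -> R) (x y : X).

Let w0 j i : 0 <= weight j i. Proof. exact: rev_weight_ge0 hm j i. Qed.
Let w1 j : \sum_i weight j i = 1. Proof. exact: rev_weight_sum hm j. Qed.

Lemma average_close (b : 'I_N0 -> R) (u v : 'I_N0 -> R) c :
  (forall i, 0 <= b i) -> \sum_i b i = 1 ->
  (forall i, 0 < b i -> `|u i - v i| <= c) ->
  `|\sum_i b i * u i - \sum_i b i * v i| <= c.
Proof.
move=> b0 b1 uv; rewrite -sumrB; apply: le_trans (ler_norm_sum _ _ _) _.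
rewrite -[leRHS]mul1r -b1 mulr_suml; apply: ler_sum => i _.
rewrite -mulrBr normrM ger0_norm//.
have [bi|bi] := ltP 0 (b i); first by rewrite ler_wpM2l// uv.
by rewrite (_ : b i = 0) ?mul0r//; apply/eqP; rewrite eq_le bi b0.
Qed.

Lemma average_close2 (b b' : 'I_N0 -> R) (u v : 'I_N0 -> R) c :
  (forall i, 0 <= b i) -> \sum_i b i = 1 -> (forall i, 0 <= b' i) -> \sum_i b' i = 1 ->
  (forall i j, `|u i - v j| <= c) ->
  `|\sum_i b i * u i - \sum_i b' i * v i| <= c.
Proof.
move=> b0 b1 b'0 b'1 uv.
have cst (a : 'I_N0 -> R) r : \sum_i a i = 1 -> \sum_i a i * r = r.
  by move=> a1; rewrite -mulr_suml a1 mul1r.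
rewrite -[X in `|X - _|](cst b')//; apply: average_close => // j _.
by rewrite -[X in `|_ - X|](cst b)//; apply: average_close.
Qed.

Definition local_lip phi (D : R) :=
  forall x y, x 0%N = y 0%N -> `|phi x - phi y| <= D * dist x y.

Definition osc_le phi (o : R) := forall x y, `|phi x - phi y| <= o.

Lemma local_lip_branch phi D : 0 <= D -> local_lip phi D -> local_lip (L phi) (theta * D).
Proof.
move=> D0 hD x y xy; rewrite /branch_sum xy; apply: average_close => // i bi.
have Ay := rev_weight_supp hm bi.
have Ax : A i (x 0%N) = 1%N by rewrite xy.
apply: le_trans (hD _ _ _) _; first by rewrite !sft_consE.
by rewrite dtheta_cons// mulrCA mulrA.
Qed.

Lemma osc_branch phi o : osc_le phi o -> osc_le (L phi) o.
Proof.
move=> ho x y; rewrite /branch_sum.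
apply: average_close2 => // i j; exact: ho.
Qed.

Definition mxavg (f : 'I_N0 -> R) (j : 'I_N0) : R := \sum_i weight j i * f i.

(** On functions of the zeroth symbol the transfer operator is the matrix of the
   reversed chain; averages keep the distance to such a function. *)
Lemma branch_mxavg psi f c : (forall x, `|psi x - f (x 0%N)| <= c) ->
  forall x, `|L psi x - mxavg f (x 0%N)| <= c.
Proof.
move=> pf x; rewrite /mxavg /branch_sum; apply: average_close => // i bi.
have := pf (sft_cons i x); rewrite sft_consE//; exact: (rev_weight_supp hm bi).
Qed.

Lemma branch_mxavg_iter k psi f c : (forall x, `|psi x - f (x 0%N)| <= c) ->
  forall x, `|iter k L psi x - iter k mxavg f (x 0%N)| <= c.
Proof. by move=> pf; elim: k => [//|k ih]; exact: branch_mxavg. Qed.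

(** The coefficients are the [k]-step transition probabilities of the reversed
   chain. *)
Lemma mxavg_iter k f j :
  iter k mxavg f j = \sum_i (q 0 i * (p ^+ k) i j / q 0 j) * f i.
Proof.
have q0 i : q 0 i != 0 by rewrite gt_eqF// (stat_gt0 hm).
elim: k j => [|k ih] j.
  rewrite (bigD1 j)//= big1 => [|i ij]; rewrite expr0 mxE ?eqxx ?(negbTE ij).
    by rewrite mulr1 divff// mul1r addr0.
  by rewrite mulr0 !mul0r.
rewrite iterS /mxavg.
under eq_bigr do rewrite ih mulr_sumr.
rewrite exchange_big/=; apply: eq_bigr => i _.
rewrite exprSr [in RHS]mxE mulr_sumr !mulr_suml; apply: eq_bigr => l _.
by rewrite /rev_weight; field; rewrite !q0.
Qed.

(** Doeblin: in [k] steps the reversed chain reaches the symbol [i0] with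
   probability at least [eps] from everywhere, so that the averages of [f] share
   a common part of mass [eps]. *)
Lemma mxavg_contract : exists k eps, [/\ 0 < eps < 1 &
  forall f (o : R), (forall i j, `|f i - f j| <= o) ->
    forall i j, `|iter k.+1 mxavg f i - iter k.+1 mxavg f j| <= (1 - eps) * o].
Proof.
have [k Ak] := tmx_aperiodic A.
pose w j i := q 0 i * (p ^+ k.+1) i j / q 0 j.
have w_gt0 j i : 0 < w j i.
  by rewrite /w divr_gt0 ?mulr_gt0 ?(stat_gt0 hm)// (mxpow_gt0 hm).
have w_sum j : \sum_i w j i = 1.
  rewrite /w -mulr_suml.
  have -> : \sum_i q 0 i * (p ^+ k.+1) i j = q 0 j.
    by rewrite -[in RHS](markov_stat_pow hm k.+1) mxE.
  by rewrite divff// gt_eqF// (stat_gt0 hm).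
pose i0 := Ordinal (tmx_gt0 A).
pose s := \sum_j (w j i0)^-1.
have s_ge j : (w j i0)^-1 <= s.
  by rewrite /s (bigD1 j)//= lerDl sumr_ge0// => l _; rewrite invr_ge0 ltW.
have s_gt0 : 0 < s by apply: lt_le_trans (s_ge i0); rewrite invr_gt0.
(* [s^-1] is a lower bound of the weights of [i0]; half of it is less than one. *)
pose eps := s^-1 / 2.
have eps_gt0 : 0 < eps by rewrite /eps divr_gt0// invr_gt0.
have eps_le j : 2 * eps <= w j i0.
  rewrite /eps mulrC divfK ?gt_eqF// -[leRHS]invrK lef_pV2// posrE// invr_gt0//.
have w_le1 j : w j i0 <= 1.
  by rewrite -(w_sum j) (bigD1 i0)//= lerDl sumr_ge0// => l _; exact: ltW.
have eps_lt1 : eps < 1 by have := eps_le i0; have := w_le1 i0; lra.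
exists k, eps; split; first by rewrite eps_gt0.
move=> f o fo i j; rewrite !mxavg_iter -!/(w _ _).
pose c j l := (w j l - eps * (l == i0)%:R) / (1 - eps).
have e1 : 0 < 1 - eps by rewrite subr_gt0.
have c0 j' l : 0 <= c j' l.
  rewrite /c divr_ge0 ?(ltW e1)// subr_ge0; case: eqP => [->|_].
    by rewrite mulr1; have := eps_le j'; lra.
  by rewrite mulr0 ltW.
have sum_i0 (h : 'I_N0 -> R) : \sum_l eps * (l == i0)%:R * h l = eps * h i0.
  rewrite (bigD1 i0)//= mulr1 big1 => [|l /negbTE ->]; first exact: addr0.
  by rewrite mulr0 mul0r.
have c1 j' : \sum_l c j' l = 1.
  rewrite /c -mulr_suml sumrB w_sum.
  have := sum_i0 (fun=> 1); under eq_bigr do rewrite mulr1.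
  by move=> ->; rewrite mulr1 divff// gt_eqF.
have E j' : \sum_l w j' l * f l = eps * f i0 + (1 - eps) * \sum_l c j' l * f l.
  rewrite -sum_i0 mulr_sumr -big_split/=; apply: eq_bigr => l _.
  by rewrite /c; field; rewrite gt_eqF.
rewrite !E opprD addrACA subrr add0r -mulrBr normrM gtr0_norm//.
by rewrite ler_wpM2l ?(ltW e1)//; apply: average_close2.
Qed.

Fact sft_from_subproof i n :
  let s n := iter n (fun i => sval (cid (tmx_next A i))) i in A (s n) (s n.+1) = 1%N.
Proof. by move=> s; rewrite /s iterS; case: cid. Qed.

(** A representative of each cylinder of length one, through which a function is
   replaced by one of the zeroth symbol. *)
Definition sft_from i : sft A := @Sft _ A _ (sft_from_subproof i).

Let d0 : R := (1 - theta)^-1.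

Let t0 : 0 < theta. Proof. by case/andP: theta01. Qed.
Let t1 : theta < 1. Proof. by case/andP: theta01. Qed.
Let d0_gt0 : 0 < d0. Proof. by rewrite /d0 invr_gt0 subr_gt0. Qed.

(** Up to the variation inside cylinders of length one, [phi] is a function of the
   zeroth symbol, whose oscillation the reversed chain contracts. *)
Lemma osc_block k eps phi o D : 0 <= D ->
  (forall f o', (forall i j, `|f i - f j| <= o') ->
    forall i j, `|iter k mxavg f i - iter k mxavg f j| <= (1 - eps) * o') ->
  osc_le phi o -> local_lip phi D -> osc_le (iter k L phi) ((1 - eps) * o + 2 * d0 * D).
Proof.
move=> D0 hk ho hD x y; pose f i := phi (sft_from i).
have pf z : `|phi z - f (z 0%N)| <= D * d0.
  apply: le_trans (hD _ _ _) _ => //.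
  by rewrite ler_wpM2l//; exact: dtheta_le.
have /hk fo i j : `|f i - f j| <= o by exact: ho.
have hx := branch_mxavg_iter k pf x; have hy := branch_mxavg_iter k pf y.
have hxy := fo (x 0%N) (y 0%N).
move: hx hy hxy; rewrite !ler_norml => /andP[a1 a2] /andP[b1 b2] /andP[c1 c2].
apply/andP; split; lra.
Qed.

(** The Lipschitz constant inside the cylinders of length one contracts at each
   step, whereas the oscillation decreases only after several steps and up to a
   multiple of that constant ([osc_block]).  A large weight [B] absorbs this
   multiple, and some power of the transfer operator contracts the sum. *)
Definition osc_norm (B : R) phi (v : R) :=
  exists o D, [/\ 0 <= D, osc_le phi o, local_lip phi D & o + B * D <= v].

Lemma osc_le_ge0 phi o : osc_le phi o -> 0 <= o.
Proof. by move=> /(_ point point); apply: le_trans. Qed.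

Lemma local_lip_iter k phi D : 0 <= D -> local_lip phi D ->
  local_lip (iter k.+1 L phi) (theta * D).
Proof.
move=> D0 hD; elim: k => [|k ih]; first exact: local_lip_branch.
rewrite iterS => x y xy.
apply: le_trans (local_lip_branch _ ih xy) _; first by rewrite mulr_ge0 ?(ltW t0).
rewrite ler_wpM2r ?dtheta_ge0// ler_piMl ?mulr_ge0 ?(ltW t0)//.
exact: ltW.
Qed.

Lemma bernoulli n (t : R) : 0 <= t -> t <= 1 -> 1 - n%:R * t <= (1 - t) ^+ n.
Proof.
move=> t0' t1'; elim: n => [|n ih]; first by rewrite mul0r subr0 expr0.
rewrite exprS; apply: (@le_trans _ _ ((1 - t) * (1 - n%:R * t))).
  have n0 : 0 <= n%:R * (t * t) by rewrite !mulr_ge0.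
  rewrite -natr1; move: n0; set a : R := n%:R => n0.
  have -> : (1 - t) * (1 - a * t) = 1 - (a + 1) * t + a * (t * t) by ring.
  by rewrite lerDl.
by rewrite ler_wpM2l// subr_ge0.
Qed.

Lemma osc_normW B phi v w : v <= w -> osc_norm B phi v -> osc_norm B phi w.
Proof.
by move=> vw; case=> o [] D [? ? ? oD]; exists o, D; split=> //; exact: le_trans vw.
Qed.

(** [k.+1] steps multiply [osc_norm] by [r]; the remaining steps do not increase
   it, which the constant [M] accounts for. *)
Lemma spectral_gap : exists B M rho, [/\ 1 <= B, 0 < M, 0 < rho < 1 &
  forall phi v n, osc_norm B phi v -> osc_norm B (iter n L phi) (M * rho ^+ n * v)].
Proof.
have [k [eps [/andP[eps0 eps1] hk]]] := mxavg_contract.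
have d1 : 1 <= d0 by rewrite /d0 invf_ge1 ?subr_gt0// lerBlDr lerDl ltW.
(* With this [B], [2 d0 D + B theta D] equals [(1 + theta) / 2 * (B D)]. *)
pose B := 4 * d0 / (1 - theta).
have BE : B * (1 - theta) = 4 * d0 by rewrite /B divfK// gt_eqF// subr_gt0.
have B1 : 1 <= B.
  by rewrite /B -/d0; have := mulr_ege1 d1 d1; rewrite -mulrA => h; lra.
pose r := Num.max (1 - eps) ((1 + theta) / 2).
have r1 : r < 1 by rewrite /r gt_max; apply/andP; split; have := t1; lra.
have re : 1 - eps <= r by rewrite /r le_max lexx.
have rt : (1 + theta) / 2 <= r by rewrite /r le_max lexx orbT.
have r0 : 0 < r by apply: lt_le_trans re; lra.
(* A root is avoided: [r <= rho ^+ k.+1] by Bernoulli's inequality. *)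
pose rho := 1 - (1 - r) / k.+1%:R.
have kr : 0 < k.+1%:R :> R by rewrite ltr0n.
have k1 : 1 <= k.+1%:R :> R by rewrite ler1n.
have rr : 0 < (1 - r) / k.+1%:R by rewrite divr_gt0// subr_gt0.
have rr1 : (1 - r) / k.+1%:R < 1.
  by rewrite ltr_pdivrMr// mul1r; apply: lt_le_trans k1; rewrite gtrBl.
have rho0 : 0 < rho by rewrite /rho subr_gt0.
have rho1 : rho < 1 by rewrite /rho gtrBl.
have rhok : r <= rho ^+ k.+1.
  apply: le_trans (bernoulli k.+1 (ltW rr) (ltW rr1)).
  by rewrite mulrC divfK ?gt_eqF// subKr.
have step phi v : osc_norm B phi v -> osc_norm B (L phi) v.
  case=> o [] D [D0 ho hD oD]; exists o, (theta * D); split.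
  - by rewrite mulr_ge0 ?(ltW t0).
  - exact: osc_branch.
  - exact: local_lip_branch.
  - apply: le_trans oD; rewrite lerD2l ler_wpM2l//; first by lra.
    by rewrite ler_piMl// ltW.
have block phi v : osc_norm B phi v -> osc_norm B (iter k.+1 L phi) (r * v).
  case=> o [] D [D0 ho hD oD].
  exists ((1 - eps) * o + 2 * d0 * D), (theta * D); split.
  - by rewrite mulr_ge0 ?(ltW t0).
  - exact: osc_block.
  - exact: local_lip_iter.
  - have o0 := osc_le_ge0 ho.
    apply: (@le_trans _ _ (r * (o + B * D))); last by rewrite ler_wpM2l ?(ltW r0).
    have h1 : (1 - eps) * o <= r * o by rewrite ler_wpM2r.
    have h2 : (1 + theta) / 2 * (B * D) <= r * (B * D).
      by rewrite ler_wpM2r// mulr_ge0//; lra.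
    have h3 : 2 * d0 * D + B * (theta * D) = (1 + theta) / 2 * (B * D).
      have -> : 2 * d0 = B * (1 - theta) / 2 by rewrite BE; field.
      by field.
    rewrite mulrDr; lra.
have small n phi v : (n <= k.+1)%N -> osc_norm B phi v ->
    osc_norm B (iter n L phi) (rho ^- k.+1 * rho ^+ n * v).
  move=> nk hv; case: (hv) => o [] D [D0 ho hD oD].
  have v0 : 0 <= v by apply: le_trans oD; rewrite addr_ge0 ?(osc_le_ge0 ho)// mulr_ge0//; lra.
  have : osc_norm B (iter n L phi) v by elim: (n) => [//|l]; exact: step.
  case=> o' [] D' [? ? ? oD']; exists o', D'; split=> //.
  apply: le_trans oD' _; rewrite ler_peMl//.
  rewrite mulrC ler_pdivlMr ?exprn_gt0// mul1r ler_wiXn2l// ?(ltW rho0) ?(ltW rho1)//.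
exists B, (rho ^- k.+1), rho; split => //.
- by rewrite invr_gt0 exprn_gt0.
- by rewrite rho0.
move=> phi v n; elim/ltn_ind: n phi v => n ih phi v hv.
have [nk|kn] := leqP n k.+1; first exact: small.
have v0 : 0 <= v.
  case: (hv) => o [] D [D0 ho hD oD].
  by apply: le_trans oD; rewrite addr_ge0 ?(osc_le_ge0 ho)// mulr_ge0//; lra.
rewrite -[in iter n](subnK (ltnW kn)) iterD.
have nk : (n - k.+1 < n)%N by rewrite -[ltnRHS](subnK (ltnW kn)) -[ltnLHS]addn0 ltn_add2l.
apply: osc_normW (ih _ nk _ _ (block _ _ hv)).
rewrite mulrA ler_wpM2r// -mulrA ler_wpM2l ?invr_ge0 ?exprn_ge0 ?(ltW rho0)//.
rewrite -[in leRHS](subnK (ltnW kn)) exprD ler_wpM2l ?exprn_ge0 ?(ltW rho0)//.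
Qed.

Lemma lipschitz_osc_norm (B : R) phi (C S : R) : 0 <= B ->
  0 <= C -> (forall x, `|phi x| <= S) -> lipschitz_sft theta phi C ->
  osc_norm B phi (2 * S + B * C).
Proof.
move=> B0 C0 pS pC; exists (2 * S), C; split=> // x y.
apply: le_trans (ler_normB _ _) _.
by have := pS x; have := pS y; lra.
Qed.

(** Points with distinct first symbols are at distance at least one, so that the
   oscillation controls the Lipschitz quotients across cylinders. *)
Lemma osc_norm_lipschitz (B : R) phi v : 1 <= B -> osc_norm B phi v ->
  lipschitz_sft theta phi v.
Proof.
move=> B1; case=> o [] D [D0 ho hD oD] x y.
have o0 := osc_le_ge0 ho; have d0' := @dtheta_ge0 N0 A R theta theta01 x y.
have [xy|xy] := eqVneq (x 0%N) (y 0%N).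
  apply: le_trans (hD x y xy) _; rewrite ler_wpM2r//.
  by apply: le_trans oD; rewrite -[leLHS]mul1r -[leLHS]add0r lerD// ler_wpM2r.
have d1 : 1 <= dist x y by rewrite leNgt; apply: contra xy => /dtheta_lt1 ->.
have v0 : o <= v by apply: le_trans oD; rewrite lerDl mulr_ge0//; lra.
apply: le_trans (ho x y) _; apply: le_trans v0 _.
by rewrite ler_peMr//; apply: le_trans oD; rewrite addr_ge0// mulr_ge0//; lra.
Qed.

(** A density further from zero than it oscillates has constant sign, and then
   the total mass is not zero. *)
Lemma osc_norm_mass0 K (mu : smeasure (X * borel K)%type R) kap (B : R) phi v :
  fibred m mu kap -> {ae m, forall x : X, kap x setT = (phi x)%:E} -> mu setT = 0%E ->
  0 <= B -> osc_norm B phi v -> forall x, `|phi x| <= v.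
Proof.
move=> fk pk mu0 B0; case=> o [] D [D0 ho hD oD] x.
have ov : o <= v by apply: le_trans oD; rewrite lerDl mulr_ge0.
apply: le_trans ov; rewrite leNgt; apply/negP => op.
have sgn c : `|c| = 1 -> c * phi x <= o.
  move=> c1; rewrite leNgt; apply/negP => op'.
  pose e := c * phi x - o.
  have e0 : 0 < e by rewrite subr_gt0.
  have ephi y : e <= c * phi y.
    rewrite /e lerBlDr -lerBlDl -mulrBr.
    by apply: le_trans (ler_norm _) _; rewrite normrM c1 mul1r.
  have int := fibred_int fk measurableT.
  have intc : m.-integrable setT (fun y => c%:E * kap y setT)%E by exact: integrableZl.
  have inte : m.-integrable setT (cst e%:E).
    exact: finite_measure_integrable_cst.
  have : (0 <= \int[m]_y (c%:E * kap y setT - e%:E))%E.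
    pose h y := (c%:E * kap y setT - e%:E)%E.
    have mh : measurable_fun setT h by apply: (measurable_int m); exact: integrableB.
    rewrite (_ : integral _ _ _ = (\int[m]_y h^\+ y)%E); first exact: integral_ge0.
    apply: ae_eq_integral => //; first exact: measurable_funepos.
    apply: filterS pk => y pky _; rewrite -/(h y) funeposE max_l//.
    by rewrite /h pky -EFinM -EFinB lee_fin subr_ge0.
  have -> : (\int[m]_y (c%:E * kap y setT - e%:E) = - e%:E)%E.
    rewrite integralB// integralZl// -(fibredE fk measurableT) mu0 mule0 sub0e.
    congr (- _)%E; rewrite integral_cst// -[RHS]mule1; congr (_ * _)%E.
    exact: probability_setT.
  by rewrite -EFinN lee_fin oppr_ge0 leNgt e0.
have := sgn 1 (normr1 _); have := sgn (-1) (normrN1 _); move: op.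
by rewrite ltr_normr => /orP[]; lra.
Qed.

End spectral_gap.

(** * The invariant measure *)

Section contraction_section.
Context d (T : measurableType d) (R : realType) (K : pmetricType R).
Hypothesis cK : compact [set: K].
Variables (S : T -> T) (mS : measurable_fun setT S).
Variables (H : T * borel K -> borel K) (mH : measurable_fun setT H).
Variables (alpha : R) (alpha01 : 0 < alpha < 1) (W : set T) (mW : measurable W).
Hypothesis diam1 : forall y z : K, mdist y z <= 1.
Hypothesis contrH : forall z, W z -> forall y1 y2 : K,
  mdist (H (z, y1) : K) (H (z, y2)) <= alpha * mdist y1 y2.

Let al0 : 0 < alpha. Proof. by case/andP: alpha01. Qed.
Let al1 : alpha < 1. Proof. by case/andP: alpha01. Qed.

Definition orbit_in : set T := [set z | forall n, W (iter n S z)].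

Let c n : R := alpha ^+ n / (1 - alpha).

Let c_gt0 n : 0 < c n.
Proof. by rewrite /c divr_gt0 ?exprn_gt0// subr_gt0. Qed.

Let cS n : c n = alpha ^+ n + c n.+1.
Proof. by rewrite /c exprS; field; rewrite subr_eq0 gt_eqF. Qed.

Let c_small e : 0 < e -> exists n, c n < e.
Proof.
move=> e0.
have : alpha ^+ n @[n --> \oo] --> (0 : R) by apply: cvg_expr; rewrite ger0_norm// ltW.
have e1 : 0 < e * (1 - alpha) by rewrite mulr_gt0// subr_gt0.
move=> /cvgr0Pnorm_lt/(_ _ e1)[n _ /(_ n (leqnn n))/= h]; exists n.
rewrite /c ltr_pdivrMr ?subr_gt0//; apply: le_lt_trans h; exact: ler_norm.
Qed.

(** Compactness provides a cluster point; the geometric sum makes it a limit. *)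
Lemma geometric_limit (u : nat -> K) : (forall n, mdist (u n) (u n.+1) <= alpha ^+ n) ->
  exists l, forall n, mdist (u n) l <= c n.
Proof.
move=> uS.
have uk n k : mdist (u n) (u (n + k)%N) <= c n.
  elim: k n => [|k ih] n; first by rewrite addn0 mdistxx ltW.
  apply: le_trans (metric_triangle _ (u n.+1) _) _.
  by rewrite cS lerD// -addSnnS.
have [l [_ cl]] := cK (F := u @ \oo) _ filterT.
exists l => n; apply/ler_addgt0Pr => e e0.
have h1 : (u @ \oo) [set y | exists k, y = u (n + k)%N].
  by exists n => // k /= nk; exists (k - n)%N; rewrite subnKC.
have [_ [[k ->]]] := cl _ _ h1 (nbhsx_ballx l _ e0).
rewrite ballEmdist/= => /ltW lk.
apply: le_trans (metric_triangle _ (u (n + k)%N) _) _.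
by rewrite lerD// metric_sym.
Qed.

Fixpoint section_approx n (z : T) : borel K :=
  if n is n'.+1 then H (z, section_approx n' (S z)) else (point : K).

Lemma measurable_section_approx n : measurable_fun setT (section_approx n).
Proof.
elim: n => [|n ih]; first exact: measurable_cst.
apply: measurableT_comp mH _; apply: measurable_fun_pair => //.
exact: measurableT_comp ih mS.
Qed.

Lemma orbit_inS z : orbit_in z -> orbit_in (S z).
Proof. by move=> Wz n; rewrite -iterSr; exact: Wz. Qed.

Lemma section_approx_step z n : orbit_in z ->
  mdist (section_approx n z : K) (section_approx n.+1 z) <= alpha ^+ n.
Proof.
elim: n z => [|n ih] z Wz; first by rewrite expr0.
apply: le_trans (contrH (Wz 0%N) _ _) _.
by rewrite exprS ler_wpM2l ?(ltW al0)//; exact/ih/orbit_inS.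
Qed.

Lemma measurable_orbit_in : measurable orbit_in.
Proof.
rewrite (_ : orbit_in = \bigcap_n (iter n S @^-1` W)).
  apply: bigcapT_measurable => n; rewrite -[X in measurable X]setTI.
  suff : measurable_fun setT (iter n S) by exact.
  elim: n => [|n ih]; first exact: measurable_id.
  exact: measurableT_comp mS ih.
by apply/seteqP; split=> z h n; [move=> _|]; exact: h.
Qed.

Let measurable_openK (U : set K) : open U -> measurable (U : set (borel K)).
Proof. by move=> oU; exact: sub_sigma_algebra. Qed.

(** On the orbits that stay in [W] the approximations converge with the uniform
   rate [c n].  Hence the limit is in an open set [U] if and only if, for some [n],
   the [n]-th approximation has a ball of radius more than [c n] inside [U], which
   is an open condition on it: this gives measurability. *)
Lemma contraction_section : exists2 Y : T -> borel K, measurable_fun setT Y &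
  forall z, orbit_in z -> Y z = H (z, Y (S z)).
Proof.
have lim z : exists l : K, orbit_in z -> forall n, mdist (section_approx n z : K) l <= c n.
  have [Wz|Wz] := pselect (orbit_in z); last by exists point.
  by have [l hl] := geometric_limit (fun n => section_approx_step n Wz); exists l.
pose Y z : borel K := if `[< orbit_in z >] then sval (cid (lim z)) else (point : K).
have YE z : orbit_in z -> forall n, mdist (section_approx n z : K) (Y z) <= c n.
  by move=> Wz n; rewrite /Y asboolT//; case: cid => l /=; exact.
exists Y; last first.
  move=> z Wz; apply: mdist_positivity; apply/eqP; rewrite eq_le mdist_ge0 andbT.
  apply/ler_addgt0Pr => e e0; rewrite add0r.
  have [n cn] : exists n, c n < e / 2 by apply: c_small; rewrite divr_gt0.
  apply: le_trans (metric_triangle _ (section_approx n.+1 z : K) _) _.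
  have h1 : mdist (Y z : K) (section_approx n.+1 z) <= c n.
    rewrite metric_sym; apply: le_trans (YE _ Wz _) _; rewrite [leRHS]cS lerDr exprn_ge0//.
    exact: ltW.
  have h2 : mdist (section_approx n.+1 z : K) (H (z, Y (S z))) <= c n.
    apply: le_trans (contrH (Wz 0%N) _ _) _.
    apply: (@le_trans _ _ (alpha * c n)).
      by rewrite ler_wpM2l ?(ltW al0)//; exact/YE/orbit_inS.
    by rewrite ler_piMl// ltW.
  by rewrite [leRHS]splitr; apply: lerD; apply: le_trans (ltW cn).
apply: (@measurability _ _ T (borel K) setT _ (@open K)) => // _ [U oU <-]; rewrite setTI.
pose V n : set (borel K) := [set y | exists2 e, c n < e & ball (y : K) e `<=` U].
have mV n : measurable (V n).
  apply: measurable_openK; rewrite openE => y [e ce yU].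
  have e0 : 0 < (e - c n) / 2 by rewrite divr_gt0// subr_gt0.
  suff : nbhs (y : K) (V n) by [].
  apply/nbhs_ballP; exists ((e - c n) / 2) => //= w yw; exists (e - (e - c n) / 2); first by lra.
  move=> x wx; apply: yU; have := ball_triangle yw wx.
  by rewrite addrC subrK.
have -> : Y @^-1` U = (orbit_in `&` \bigcup_n section_approx n @^-1` V n) `|`
    (~` orbit_in `&` [set z | U (point : K)]).
  apply/seteqP; split=> z /=.
  - have [Wz|Wz] := pselect (orbit_in z); last by rewrite /Y asboolF//; right.
    move=> Uz; left; split=> //.
    have : nbhs (Y z : K) U by exact: open_nbhs_nbhs.
    move=> /nbhs_ballP[r /= r0 rU].
    have [n cn] : exists n, c n < r / 2 by apply: c_small; rewrite divr_gt0.
    exists n => //=; exists (r - c n); first by lra.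
    move=> x yx; apply: rU; rewrite ballEmdist/=.
    apply: le_lt_trans (metric_triangle _ (section_approx n z : K) _) _.
    move: yx; rewrite ballEmdist/=; have := YE _ Wz n; rewrite metric_sym; lra.
  - move=> [[Wz [n _ [e ce yU]]]|[Wz Up]]; last by rewrite /Y asboolF.
    apply: yU; rewrite ballEmdist/=; apply: le_lt_trans ce; exact: YE.
have mO := measurable_orbit_in.
apply: measurableU; first apply: measurableI => //.
  apply: bigcupT_measurable => n; rewrite -[X in measurable X]setTI.
  exact: measurable_section_approx.
apply: measurableI; first exact: measurableC.
have [Up|Up] := pselect (U (point : K)).
  by rewrite (_ : [set _ | _] = setT)//; apply/seteqP; split.
by rewrite (_ : [set _ | _] = set0)//; apply/seteqP; split.
Qed.

End contraction_section.

Section as_probability.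
Context d (T : measurableType d) (R : realType) (nu : {measure set T -> \bar R}).

(** The argument [nu1] lets the probability structure be inferred from the alias. *)
Definition as_probability (nu1 : nu setT = 1%E) : set T -> \bar R := nu.

HB.instance Definition _ h := Measure.copy (as_probability h) nu.
HB.instance Definition _ h :=
  Measure_isProbability.Build _ _ _ (as_probability h) h.

End as_probability.

Section invariant_measure.
Variables (N0 : nat) (A : aperiodic_mx N0) (R : realType) (theta : R).
Hypothesis theta01 : 0 < theta < 1.
Variables (p : 'M[R]_N0) (q : 'rV[R]_N0) (m : probability (Sigma A theta) R).
Hypothesis hm : markov_measure p q m.
Variables (K : pmetricType R) (cK : compact [set: K]) (diamK : diam K = 1%E).
Local Notation X := (Sigma A theta).
Local Notation XK := (Sigma A theta * borel K)%type.
Variables (G : XK -> borel K) (mG : measurable_fun setT G).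
Variables (alpha : R) (alpha01 : 0 < alpha < 1).
Hypothesis contr : {ae m, forall x, forall y1 y2 : K,
  mdist (G (x, y1) : K) (G (x, y2)) <= alpha * mdist y1 y2}.
Local Notation F := (transfer theta01 mG).
Local Notation Z := (X * measurableTypeR R)%type.
Local Notation S := (baker p q : Z -> Z).
Local Notation mZ := (m \x (@unif R))%E.

Let mS : measurable_fun setT S.
Proof. exact: (measurable_baker theta01 hm). Qed.

Let mZ_iter n D : measurable D -> measurable (iter n S @^-1` D) /\
  mZ (iter n S @^-1` D) = mZ D.
Proof.
elim: n D => [//|n ih] D mD.
have [m1 e1] := ih _ (measurable_baker_preimage theta01 hm mD).
by split; [exact: m1|rewrite [LHS]e1; exact: baker_preserving].
Qed.

(** The full set [Q] consists of the points whose baker orbit always meets a piece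
   and whose next base points lie in the set where the fibre map contracts.  There
   the baker map prepends an admissible symbol, hence inverts the shift. *)
Lemma baker_section : exists2 Y : Z -> borel K, measurable_fun setT Y &
  exists2 Q : set Z, measurable Q /\ mZ (~` Q) = 0%E &
  forall z, Q z -> sft_shift (S z).1 = z.1 /\ Y z = G ((S z).1, Y (S z)).
Proof.
have [B [mB B0 BG]] := contr.
pose W : set Z := S @^-1` (~` B `*` setT) `&` [set z | slot_at p q z.1 z.2 <> None].
have mNone : measurable [set z : Z | slot_at p q z.1 z.2 = None].
  rewrite (_ : [set _ | _] = \bigcup_(j in [set: 'I_N0]) ([set x : X | x 0%N = j] `*`
      [set u : measurableTypeR R | slot (rev_weight p q j) u = None])).
    apply: countable_bigcupT_measurable => [|j]; first exact: countableP.
    apply: measurableX; last exact: (measurable_slot hm).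
    exact: (measurable_head_set theta01 [set j]).
  apply/seteqP; split=> [[x u] /= xu|[x u] [j _ [/= <-]]//].
  by exists (x 0%N).
have mW : measurable W.
  apply: measurableI; last exact: measurableC.
  apply: (measurable_baker_preimage theta01 hm); apply: measurableX => //.
  exact: measurableC.
have W0 : mZ (~` W) = 0%E.
  have -> : ~` W = S @^-1` (B `*` setT) `|` [set z | slot_at p q z.1 z.2 = None].
    apply/seteqP; split=> z /=.
      move=> nW; have [Bz|nB] := pselect (B (S z).1); first by left.
      right; apply: contrapT => nN; apply: nW; split=> //; split=> //; exact: nB.
    by move=> [[Bz _] [[/= nB _] _]|zN [_ []]].
  have mBT : measurable (B `*` [set: measurableTypeR R]) by exact: measurableX.
  rewrite measureU0//; last 2 first.
  - exact: (measurable_baker_preimage theta01 hm).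
  - transitivity (\int[m]_x unif (xsection [set z | slot_at p q z.1 z.2 = None] x))%E => //.
    rewrite integral0_eq// => x _.
    rewrite -[RHS](unif_noslot hm (x 0%N)); congr (unif _).
    by apply/seteqP; split=> u; rewrite /xsection/= ?inE.
  transitivity (mZ (B `*` setT)); first exact: baker_preserving.
  transitivity (m B * (@unif R) setT)%E; first exact: product_measure1E.
  by rewrite B0 mul0e.
pose H (w : Z * borel K) : borel K := G ((S w.1).1, w.2).
have mH : measurable_fun setT H.
  apply: measurableT_comp mG _; apply: measurable_fun_pair => //.
  apply: measurableT_comp => //; exact: measurableT_comp mS _.
have [|Y mY YE] := contraction_section cK mS mH alpha01 mW (diam_le1 diamK).
  move=> z [[/= nB _] _] y1 y2; apply: contrapT => h; apply: nB; apply: BG => /= h'.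
  exact/h/h'.
exists Y => //; exists (orbit_in S W); first split.
- exact: measurable_orbit_in.
- apply: measure_negligible; first exact/measurableC/measurable_orbit_in.
  have -> : ~` orbit_in S W = \bigcup_n (iter n S @^-1` (~` W)).
    apply/seteqP; split=> z /=; first by move=> /existsNP[n nW]; exists n.
    by move=> [n _ nW] h; exact/nW/h.
  apply: negligible_bigcup => n; have [m1 e1] := mZ_iter n (measurableC mW).
  by exists (iter n S @^-1` (~` W)); split; [exact: m1|exact: etrans e1 W0|].
- move=> z Oz; split; last exact: YE.
  have [_] := Oz 0%N; rewrite /= /baker; case sz: slot_at => [i|//] _ /=.
  apply: sft_consK; apply: (rev_weight_supp hm).
  by apply: slot_pos sz; exact: (rev_weight_ge0 hm).
Qed.

(** The skew product maps [((S z).1, Y (S z))] to [(z.1, Y z)], and [S z] has the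
   law of [z]; the leaves of [mu0] are the laws of [Y (x, _)], which are
   probabilities. *)
Lemma invariant_measure : exists mu0 kap0, [/\ regular m mu0 kap0 (cst 1) 1,
  mu0 setT = 1%E & F mu0 = mu0].
Proof.
have [Y mY [Q [mQ Q0] QE]] := baker_section.
pose psi (z : Z) : XK := (z.1, Y z).
have mpsi : measurable_fun setT psi by exact: measurable_fun_pair.
have mpre E : measurable E -> measurable (psi @^-1` E).
  by move=> mE; rewrite -[X in measurable X]setTI; exact: mpsi.
have mpair x : measurable_fun setT (fun u : measurableTypeR R => psi (x, u)).
  by apply: measurableT_comp mpsi _; exact: measurable_pair1.
have nu1 : mpush mpsi mZ setT = 1%E.
  rewrite [LHS](_ : _ = mZ (setT `*` setT)); last by rewrite setXTT.
  rewrite [LHS]product_measure1E//; rewrite -[RHS]mule1; congr (_ * _)%E; exact: probability_setT.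
have kap1 x : mpush (mpair x) (@unif R) setT = 1%E by exact: probability_setT.
pose mu0 := smeasure_of_measure (as_probability nu1).
pose kap0 x := smeasure_of_measure (as_probability (kap1 x)).
have mu0E E : measurable E -> mu0 E = mZ (psi @^-1` E).
  exact: smeasure_of_measureE.
have kap0E x E : measurable E -> kap0 x E = unif (xsection (psi @^-1` E) x).
  move=> mE; rewrite [LHS]smeasure_of_measureE//.
  transitivity (unif ((fun u => psi (x, u)) @^-1` E)) => //; congr (unif _).
  by apply/seteqP; split=> u; rewrite /xsection/= ?inE.
have kapT x : kap0 x setT = 1%E by rewrite [LHS]smeasure_of_measureE//; exact: kap1.
have mu0T : mu0 setT = 1%E by rewrite [LHS]smeasure_of_measureE.
exists mu0, kap0; split=> //.
- split.
  + split.
    * move=> E mE; apply: (@le_integrable _ _ _ m setT measurableT _ (cst 1%E)).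
      - rewrite (_ : (fun x => _) = (fun x => unif (xsection (psi @^-1` E) x))).
          by apply: measurable_fun_xsection; exact: mpre.
        by apply/funext => x; exact: kap0E.
      - move=> x _; rewrite kap0E// gee0_abs// gee0_abs//; apply: probability_le1.
        by apply: measurable_xsection; exact: mpre.
      - exact: finite_measure_integrable_cst.
    * apply: nearW => x E mE xE; rewrite kap0E// (_ : xsection _ _ = set0) ?measure0//.
      by rewrite -subset0 => u /xsectionP/= Eu; exact: (xE (Y (x, u))).
    * by move=> E mE; rewrite mu0E//; apply: eq_integral => x _; rewrite kap0E.
  + apply: nearW => x.
    have mYx : measurable_fun setT (fun u : measurableTypeR R => Y (x, u)).
      by apply: measurableT_comp mY _; exact: measurable_pair1.
    have Yx1 : mpush mYx (@unif R) setT = 1%E by exact: probability_setT.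
    apply: (normW_prob (P := as_probability Yx1)) => E mE.
    rewrite [LHS]spushE// [LHS]smeasure_of_measureE//.
    by rewrite -[X in measurable X]setTI; exact: measurable_snd.
  + by apply: nearW => x; rewrite kapT.
- apply: smeasure_eq => E mE; rewrite transferE// !mu0E//; last exact: measurable_skew_preimage.
  have mD := mpre _ (measurable_skew_preimage theta01 mG mE).
  have onQ D : measurable D -> mZ D = mZ (D `&` Q).
    move=> mD'; rewrite [LHS](measureDI _ mD' mQ) [X in (X + _)%E](_ : _ = 0%E) ?add0e//.
    apply: subset_measure0 Q0; [exact: measurableD|exact: measurableC|].
    by move=> z [].
  transitivity (mZ (S @^-1` (psi @^-1` (skew G @^-1` E)))).
    by apply/esym; exact: baker_preserving.
  have mS' := measurable_baker_preimage theta01 hm mD.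
  rewrite [LHS]onQ// [RHS]onQ; last exact: mpre.
  congr (mZ _); apply/seteqP; split=> z [+ Qz]; rewrite /preimage/= /skew/= /psi.
    by have [<- <-] := QE z Qz; rewrite (QE z Qz).1.
  by have [e1 e2] := QE z Qz; rewrite e1 -e2.
Qed.

End invariant_measure.

(** * Exponential decay and the spectral decomposition *)

Section decay.
Variables (N0 : nat) (A : aperiodic_mx N0) (R : realType) (theta : R).
Hypothesis theta01 : 0 < theta < 1.
Variables (p : 'M[R]_N0) (q : 'rV[R]_N0) (m : probability (Sigma A theta) R).
Hypothesis hm : markov_measure p q m.
Variables (K : pmetricType R) (cK : compact [set: K]) (diamK : diam K = 1%E).
Local Notation X := (Sigma A theta).
Local Notation XK := (Sigma A theta * borel K)%type.
Variables (G : XK -> borel K) (mG : measurable_fun setT G).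
Variables (alpha : R) (alpha01 : 0 < alpha < 1).
Hypothesis contr : {ae m, forall x, forall y1 y2 : K,
  mdist (G (x, y1) : K) (G (x, y2)) <= alpha * mdist y1 y2}.
Local Notation F := (transfer theta01 mG).
Local Notation L := (branch_sum p q : (X -> R) -> X -> R).
Implicit Types (mu nu : smeasure XK R) (kap : X -> smeasure XK R) (phi : X -> R).

Definition mass mu : R := fine (mu setT).

Lemma massE mu : mu setT = (mass mu)%:E.
Proof. exact: smeasure_fin. Qed.

Lemma mass_lin a mu nu : mass (a *: mu + nu) = a * mass mu + mass nu.
Proof. by rewrite /mass smeasureDE// smeasureZE// !massE. Qed.

Lemma mass_transfer n mu : mass (iter n F mu) = mass mu.
Proof. by elim: n => // n <-; rewrite /mass iterS transferT. Qed.

Lemma mass_le mu kap phi a (s : R) : regular m mu kap phi a -> (forall x, `|phi x| <= s) ->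
  `|mass mu| <= s.
Proof.
move=> [f _ d] phis; rewrite -lee_fin -abse_EFin -massE (fibredE f measurableT).
have int := fibred_int f measurableT.
apply: le_trans (le_abse_integral _ _ _) _ => //; first exact: measurable_int int.
rewrite (_ : s%:E = \int[m]_x (cst s%:E x))%E; last first.
  rewrite integral_cst// -[LHS]mule1; congr (_ * _)%E.
  by apply/esym; exact: probability_setT.
have s0 : 0 <= s by apply: le_trans (phis point).
apply: ae_ge0_le_integral => //.
- by apply: measurableT_comp => //; exact: measurable_int int.
- by apply: filterS d => x -> _; rewrite abse_EFin lee_fin.
Qed.

Lemma Sinf_lin c mu nu : Sinf m mu -> Sinf m nu -> Sinf m (c *: mu + nu).
Proof.
move=> /(Sinf_regular theta01)/(_ ltr01)[k [f [a [S [C [r _ C0 fC _]]]]]].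
move=> /(Sinf_regular theta01)/(_ ltr01)[k' [f' [a' [S' [C' [r' _ C0' fC' _]]]]]].
apply: (regular_Sinf theta01 cK (regular_lin c r r') (C := `|c| * C + C')).
  by rewrite addr_ge0// mulr_ge0.
move=> x y; rewrite opprD addrACA -mulrBr mulrDl.
by apply: le_trans (ler_normD _ _) _; rewrite lerD// normrM -mulrA ler_wpM2l.
Qed.

Lemma Sinf_transfer mu : Sinf m mu -> Sinf m (F mu).
Proof.
move=> /(Sinf_regular theta01)/(_ ltr01)[k [f [a [S [C [r fS C0 fC _]]]]]].
have [B [M [rho [B1 M0 /andP[rho0 rho1] gap]]]] := spectral_gap theta01 hm.
have B0 : 0 <= B by apply: le_trans B1.
have osc := gap _ _ 1%N (lipschitz_osc_norm B0 C0 fS fC).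
have r' := regular_transfer theta01 hm mG diamK alpha01 contr r fS.
apply: (regular_Sinf theta01 cK r'); last exact: osc_norm_lipschitz osc.
have S0 : 0 <= S by apply: le_trans (fS point).
by rewrite mulr_ge0// ?addr_ge0// ?mulr_ge0// ?ltW.
Qed.

Variables (mu0 : smeasure XK R) (kap0 : X -> smeasure XK R).
Hypothesis r0 : regular m mu0 kap0 (cst 1) 1.
Hypothesis mu0T : mass mu0 = 1.

(** The density of [eta = mu - mass mu *: mu0] satisfies, after [k] steps, the bound
   [s_k = M rho^k v], and the leaf bounds satisfy [a_{k+1} <= alpha a_k + s_k].  Any
   rate [xi] above [alpha] and [rho] absorbs the recurrence. *)
Lemma decay : exists xi M : R, [/\ 0 < xi < 1, 0 < M & forall mu kap phi (a S C : R) n,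
  regular m mu kap phi a -> (forall x, `|phi x| <= S) -> 0 <= C -> lipschitz_sft theta phi C ->
  (norm_Sinf m (iter n F (- mass mu *: mu0 + mu)%R) <= (M * xi ^+ n * (S + C + a))%:E)%E].
Proof.
have [B [M [rho [B1 M0 /andP[rho0 rho1] gap]]]] := spectral_gap theta01 hm.
have B0 : 0 <= B by apply: le_trans B1.
have [al0 al1] := andP alpha01.
pose xi := (1 + Num.max alpha rho) / 2.
have mx : Num.max alpha rho < 1 by rewrite gt_max al1.
have xia : alpha < xi.
  have : alpha <= Num.max alpha rho by rewrite le_max lexx.
  by rewrite /xi; lra.
have xir : rho < xi.
  have : rho <= Num.max alpha rho by rewrite le_max lexx orbT.
  by rewrite /xi; lra.
have xi0 : 0 < xi by apply: lt_trans xia.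
have xi1 : xi < 1 by rewrite /xi; lra.
have xa0 : 0 < xi - alpha by rewrite subr_gt0.
pose I := (xi - alpha)^-1.
have I0 : 0 < I by rewrite invr_gt0.
exists xi, (M * (2 + I) * (4 + B) + 1); split; first by rewrite xi0.
  by rewrite addr_gt0// !mulr_gt0// addr_gt0//; lra.
move=> mu kap phi a S C n r fS C0 fC.
have S0 : 0 <= S by apply: le_trans (fS point).
have a0 := regular_ge0 r.
pose eta := - mass mu *: mu0 + mu.
have cS : `|mass mu| <= S := mass_le r fS.
have eta_mass k : iter k F eta setT = 0%E.
  by rewrite massE mass_transfer mass_lin mu0T mulr1 addNr.
pose kap1 x := - mass mu *: kap0 x + kap x.
pose psi x : R := - mass mu * 1 + phi x.
have r1 : regular m eta kap1 psi (`|mass mu| + a).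
  by rewrite -normrN -[X in X + a]mulr1; exact: regular_lin.
have psiS x : `|psi x| <= 2 * S.
  rewrite /psi mulr1; apply: le_trans (ler_normD _ _) _; rewrite normrN.
  by have := fS x; lra.
have psiC : lipschitz_sft theta psi C.
  by move=> x y; rewrite /psi opprD addrACA subrr add0r.
pose v := 4 * S + B * C.
have v0 : 0 <= v by rewrite addr_ge0 ?mulr_ge0.
have osc k : osc_norm B (iter k L psi) (M * rho ^+ k * v).
  apply: gap; have := lipschitz_osc_norm B0 C0 psiS psiC.
  by rewrite mulrA -natrM.
(* [T xi^k] bounds [a_k] since [M v <= (xi - alpha) T]. *)
pose T := S + a + M * v * I.
have regn k : exists kapk ak, regular m (iter k F eta) kapk (iter k L psi) ak /\ ak <= T * xi ^+ k.
  elim: k => [|k [kapk [ak [rk aT]]]].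
    exists kap1, (`|mass mu| + a); split => //; rewrite expr0 mulr1 /T.
    have : 0 <= M * v * I by rewrite !mulr_ge0// ltW.
    lra.
  have [fk _ dk] := rk.
  have sk := osc_norm_mass0 fk dk (eta_mass k) B0 (osc k).
  exists (branch_kernel theta01 p q mG kapk), (alpha * ak + M * rho ^+ k * v); split.
    exact: (regular_transfer theta01 hm mG diamK alpha01 contr rk sk).
  have h1 : alpha * ak <= alpha * (T * xi ^+ k) by rewrite ler_wpM2l// ltW.
  have h2 : M * rho ^+ k * v <= M * v * xi ^+ k.
    by rewrite mulrAC ler_wpM2l ?mulr_ge0 ?(ltW M0)// lerXn2r// ?nnegrE ltW.
  have h3 : M * v <= (xi - alpha) * T.
    rewrite /T [leRHS]mulrDr; have -> : (xi - alpha) * (M * v * I) = M * v.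
      by rewrite /I; field; rewrite gt_eqF.
    by rewrite lerDr; apply: mulr_ge0; [exact: ltW|exact: addr_ge0].
  have h4 : M * v * xi ^+ k <= (xi - alpha) * T * xi ^+ k.
    by rewrite ler_wpM2r// exprn_ge0// ltW.
  apply: le_trans (lerD h1 (le_trans h2 h4)) _.
  by rewrite exprS le_eqVlt; apply/orP; left; apply/eqP; ring.
have [kapn [an [rn anT]]] := regn n.
have [fn _ dn] := rn.
have sn := osc_norm_mass0 fn dn (eta_mass n) B0 (osc n).
have Cn := osc_norm_lipschitz theta01 B1 (osc n).
have w0 : 0 <= M * rho ^+ n * v by apply: le_trans (sn point).
apply: le_trans (regular_norm theta01 cK rn sn w0 Cn) _; rewrite lee_fin.
have xn : 0 <= xi ^+ n by rewrite exprn_ge0// ltW.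
have h2 : M * rho ^+ n * v <= M * v * xi ^+ n.
  by rewrite mulrAC ler_wpM2l ?mulr_ge0 ?(ltW M0)// lerXn2r// ?nnegrE ltW.
apply: (@le_trans _ _ ((M * v * (2 + I) + S + a) * xi ^+ n)).
  have -> : (M * v * (2 + I) + S + a) * xi ^+ n =
    M * v * xi ^+ n + M * v * xi ^+ n + T * xi ^+ n by rewrite /T; ring.
  by rewrite !lerD.
rewrite [leRHS]mulrAC ler_wpM2r//.
have h5 : v <= (4 + B) * (S + C + a).
  have -> : (4 + B) * (S + C + a) = v + (4 * (C + a) + B * (S + a)) by rewrite /v; ring.
  by rewrite lerDl addr_ge0// mulr_ge0// addr_ge0.
have h6 : M * (2 + I) * v <= M * (2 + I) * ((4 + B) * (S + C + a)).
  by rewrite ler_wpM2l// mulr_ge0 ?ltW// addr_gt0.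
have -> : (M * (2 + I) * (4 + B) + 1) * (S + C + a) =
  M * (2 + I) * ((4 + B) * (S + C + a)) + (S + a) + C by ring.
have -> : M * v * (2 + I) + S + a = M * (2 + I) * v + (S + a) by ring.
apply: (@le_trans _ _ (M * (2 + I) * ((4 + B) * (S + C + a)) + (S + a))).
  by rewrite lerD2r.
by rewrite lerDl.
Qed.

End decay.

Theorem theorem2 (R : realType) (N0 : nat) (A : aperiodic_mx N0)
    (theta : R) (theta01 : 0 < theta < 1)
    (p : 'M[R]_N0) (q : 'rV[R]_N0) (m : probability (Sigma A theta) R)
    (hm : markov_measure p q m)
    (K : pmetricType R) (cK : compact [set: K]) (diamK : diam K = 1%E)
    (G : Sigma A theta * borel K -> borel K) (mG : measurable_fun setT G)
    (alpha : R) (alpha01 : 0 < alpha < 1)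
    (contr : {ae m, forall x, forall y1 y2 : K,
       mdist (G (x, y1) : K) (G (x, y2)) <= alpha * mdist y1 y2}) :
  linear_on (Sinf m) (transfer theta01 mG) /\
  exists P N : smeasure (Sigma A theta * borel K)%type R ->
               smeasure (Sigma A theta * borel K)%type R,
    [/\ linear_on (Sinf m) P,
        linear_on (Sinf m) N &
        forall mu, Sinf m mu -> transfer theta01 mG mu = P mu + N mu] /\
    [/\ (forall mu, Sinf m mu -> P (P mu) = P mu) /\ dim1 (P @` Sinf m),
        exists xi M : R, [/\ 0 < xi < 1, 0 < M &
          forall mu n, Sinf m mu -> (1 <= n)%N ->
            (norm_Sinf m (iter n N mu) <= (M * xi ^+ n)%:E * norm_Sinf m mu)%E] &
        forall mu, Sinf m mu -> P (N mu) = 0 /\ N (P mu) = 0].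
Proof.
have [mu0 [kap0 [r0 mu0T F0]]] := invariant_measure theta01 hm cK diamK mG alpha01 contr.
have mass0 : mass mu0 = 1 by rewrite /mass mu0T.
have Sinf0 : Sinf m mu0.
  by apply: (regular_Sinf theta01 cK r0 (C := 0)) => // x y; rewrite subrr normr0 mul0r.
have SinfZ a : Sinf m (a *: mu0).
  have := Sinf_lin theta01 cK (a - 1) Sinf0 Sinf0.
  by rewrite -[X in _ + X]scale1r -scalerDl subrK.
pose F := transfer theta01 mG.
have SinfF mu : Sinf m mu -> Sinf m (F mu).
  exact: (Sinf_transfer theta01 hm cK diamK mG alpha01 contr).
have Flin : linear_on (Sinf m) F.
  by split=> [u /SinfF//|a u v _ _]; exact: transfer_lin.
split=> //.
pose P (mu : smeasure (Sigma A theta * borel K)%type R) := mass mu *: mu0.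
(* Written in the form that [mass_lin] and [Sinf_lin] accept. *)
pose N mu := - 1 *: P mu + F mu.
have FZ a : F (a *: mu0) = a *: mu0.
  have -> : a *: mu0 = (a - 1) *: mu0 + mu0 by rewrite scalerBl scale1r subrK.
  by rewrite /F transfer_lin F0.
have massZ a : mass (a *: mu0) = a.
  have -> : a *: mu0 = (a - 1) *: mu0 + mu0 by rewrite scalerBl scale1r subrK.
  by rewrite mass_lin mass0 mulr1 subrK.
have massP mu : mass (P mu) = mass mu.
  by rewrite /P massZ.
have massF mu : mass (F mu) = mass mu := mass_transfer theta01 mG 1 mu.
have massN mu : mass (N mu) = 0 by rewrite /N mass_lin massP massF mulN1r addNr.
have iterN n mu : iter n.+1 N mu = iter n.+1 F (- mass mu *: mu0 + mu).
  elim: n => [|n ih].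
    by rewrite /N /P /= /F transfer_lin F0 scaleN1r scaleNr.
  rewrite iterS ih [RHS]iterS /N /P.
  by rewrite (mass_transfer theta01 mG) mass_lin mass0 mulr1 addNr scale0r scaler0 add0r.
have Plin a u v : P (a *: u + v) = a *: P u + P v.
  by rewrite /P mass_lin scalerDl scalerA.
exists P, N; split; split.
- by split=> [u _|a u v _ _]; [exact: SinfZ|exact: Plin].
- split=> [u Su|a u v _ _].
    by apply: (Sinf_lin theta01 cK) => //; [exact: SinfZ|exact: SinfF].
  by rewrite /N Plin /F transfer_lin !scaleN1r opprD addrACA scalerDr scalerN.
- by move=> mu _; rewrite /N scaleN1r addrA subrr add0r.
- split; first by move=> mu _; rewrite {1}/P massP.
  exists mu0.
    apply/eqP => mu00; have := mass0; rewrite mu00 /mass smeasure_ofE//=.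
    by apply/eqP; rewrite eq_sym oner_eq0.
  apply/seteqP; split=> nu /=.
    by move=> [mu _ <-]; exists (mass mu).
  move=> [a _ <-]; exists (a *: mu0); first exact: SinfZ.
  by rewrite /P massZ.
- have [xi [M [xi01 M0 dec]]] := decay theta01 hm cK diamK mG alpha01 contr r0 mass0.
  exists xi, M; split=> // mu [//|n] Smu _; rewrite iterN.
  have [xi0 xi1] := andP xi01.
  have c0 : 0 < M * xi ^+ n.+1 by rewrite mulr_gt0// exprn_gt0.
  have bound e : 0 < e -> (norm_Sinf m (iter n.+1 F (- mass mu *: mu0 + mu)%R) <=
      (M * xi ^+ n.+1)%:E * (norm_Sinf m mu + e%:E))%E.
    move=> e0; have [kap [phi [a [S [C [r fS C0 fC h]]]]]] := Sinf_regular theta01 Smu e0.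
    apply: le_trans (dec mu kap phi a S C n.+1 r fS C0 fC) _.
    by rewrite EFinM lee_pmul2l// lte_fin.
  (* The norm is finite on [Sinf], but the bounds also settle the infinite values. *)
  move: bound; case: (norm_Sinf m mu) => [t| |] bound.
  - apply/lee_addgt0Pr => e e0.
    have := bound _ (divr_gt0 e0 c0); move: c0; set b := M * _ => c0.
    rewrite -EFinD -EFinM -[X in (_ -> _ <= X + _)%E]EFinM -EFinD.
    by rewrite (_ : b * (t + e / b) = b * t + e)//; field; rewrite gt_eqF.
  - by rewrite gt0_muley ?lte_fin// leey.
  - by have := bound 1 ltr01; rewrite addNye.
- move=> mu _; split; first by rewrite {1}/P massN scale0r.
  by rewrite /N {1}/P massP -/(P mu) /P FZ scaleN1r addNr.
Qed.
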